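(* Let $(X,\tau,d)$ be an extended metric-topological space, and let $\mathsf{HK}$, $\mathsf{LET}$ and the problems (HK), (HK$_\le$), (Y$_\le$), (Y$_=$) be as in the context. For all $\mu_1,\mu_2\in\mathcal M(X)$, $$\mathsf{HK}^2(\mu_1,\mu_2)=\mathsf{LET}(\mu_1,\mu_2),$$ and $\alpha(\boldsymbol{\mathfrak C}')=0$ for every optimal solution $\alpha\in\mathcal M(\mathfrak C\times\mathfrak C)$ of (HK) or of (HK$_\le$), where $\boldsymbol{\mathfrak C}'=\{(y_1,y_2)\in\mathfrak C_o\times\mathfrak C_o:\ d(\mathsf x_1,\mathsf x_2)>\pi/2\}$, $\mathfrak C_o=\mathfrak C\setminus\{\mathfrak o\}$. Moreover: (i) $\alpha\in\mathcal M(\mathfrak C\times\mathfrak C)$ is an optimal plan for (HK$_\le$) if and only if $\alpha(\boldsymbol{\mathfrak C}')=0$ and $\boldsymbol{\mathsf y}_\sharp\big(\alpha|_{\mathfrak C_o\times\mathfrak C_o}\big)$ is an optimal plan for (Y$_\le$). (ii) $\bar\alpha\in\mathcal M(Y\times Y)$ is an optimal plan for (Y$_=$) if and only if $\alpha:=\boldsymbol{\mathfrak p}_\sharp\bar\alpha$ is an optimal plan for (HK). (iii) If $\gamma\in\mathcal M(X\times X)$ belongs to $\mathrm{Opt}_{\mathsf{LET}}(\mu_1,\mu_2)$ and $\varrho_i:X\to[0,\infty)$ are Borel maps with $\mu_i=\varrho_i\gamma_i+\mu_i^\perp$ ($\gamma_i$ the marginals of $\gamma$, $\mu_i^\perp\perp\gamma_i$),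 then the push-forward $\beta$ of $\gamma$ under $(x_1,x_2)\mapsto([x_1,\varrho_1^{1/2}(x_1)],[x_2,\varrho_2^{1/2}(x_2)])$ is an optimal plan for (HK$_\le$) and satisfies $\mathsf r_1\mathsf r_2\cos(d_{\pi/2}(\mathsf x_1,\mathsf x_2))=1$ $\beta$-a.e.; in particular $\beta$ is concentrated on $\boldsymbol{\mathfrak G}=\{([x_1,r_1],[x_2,r_2]):r_1r_2\ne0,\ d(x_1,x_2)<\pi/2\}$. (iv) If $\alpha\in\mathcal M(\mathfrak C\times\mathfrak C)$ is an optimal plan for (HK), then $\tilde\alpha:=\alpha|_{\boldsymbol{\mathfrak G}}$ is an optimal plan for (HK$_\le$). Moreover: - the plan $\beta:=\mathrm{dil}_{\vartheta,2}(\tilde\alpha)$, with $\vartheta=\big(\mathsf r_1\mathsf r_2\cos(d_{\pi/2}(\mathsf x_1,\mathsf x_2))\big)^{1/2}$, is an optimal plan (for (HK$_\le$)) satisfying $\mathsf r_1\mathsf r_2\cos(d_{\pi/2}(\mathsf x_1,\mathsf x_2))=1$ $\beta$-a.e.; - if $(X,\tau)$ is separable and metrizable, $\gamma:=(\mathsf x_1,\mathsf x_2)_\sharp\beta$ belongs to $\mathrm{Opt}_{\mathsf{LET}}(\mu_1,\mu_2)$; - if $(X,\tau)$ is separable and metrizable, $\beta$ is the push-forward of this $\gamma$ under $(x_1,x_2)\mapsto([x_1,\varrho_1^{1/2}(x_1)],[x_2,\varrho_2^{1/2}(x_2)])$, where $\mu_i=\varrho_i\gamma_i+\mu_i^\perp$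 is the Lebesgue decomposition of $\mu_i$ w.r.t. the marginal $\gamma_i$ of $\gamma$.
   Context: An extended metric-topological space $(X,\tau,d)$ is a Hausdorff space $(X,\tau)$ with an extended distance $d:X\times X\to[0,\infty]$ lower semicontinuous w.r.t. $\tau$. $\mathcal M(\cdot)$ denotes finite nonnegative Radon measures; $\alpha|_B$ is restriction to $B$. For $a\ge0$, $d_a=\min(d,a)$. Logarithmic Entropy-Transport: with $\ell(s)=-\log(\cos^2 s)$ for $s\in[0,\pi/2)$, $\ell(s)=+\infty$ for $s\ge\pi/2$, $$\mathsf{LET}(\mu_1,\mu_2)=\min_{\gamma\in\mathcal M(X\times X),\ \gamma_i\ll\mu_i}\ \sum_i\int_X(\sigma_i\log\sigma_i-\sigma_i+1)\,d\mu_i+\int\ell(d(x_1,x_2))\,d\gamma,\quad\sigma_i=\frac{d\gamma_i}{d\mu_i},$$ $\gamma_i$ the marginals of $\gamma$; $\mathrm{Opt}_{\mathsf{LET}}(\mu_1,\mu_2)$ is the set of minimizers. Cone: $Y=X\times[0,\infty)$; $\mathfrak C$ is the quotient of $Y$ identifying all points $(x,0)$ to the vertex $\mathfrak o$; $\mathfrak p(x,r)=[x,r]$, $\boldsymbol{\mathfrak p}=\mathfrak p\otimes\mathfrak p:Y\times Y\to\mathfrak C\times\mathfrak C$. $d_{\mathfrak C}^2([x_1,r_1],[x_2,r_2])=r_1^2+r_2^2-2r_1r_2\cos(d_\pi(x_1,x_2))$. Topology of $\mathfrak C$: that of $X\times(0,\infty)$ away from $\mathfrak o$, with the sets $\{[x,r]:r<\varepsilon\}$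 as neighborhood basis of $\mathfrak o$. $\mathsf r([x,r])=r$; $\mathsf x([x,r])=x$ if $r>0$ and $\mathsf x(\mathfrak o)=\bar x$, a fixed point of $X$; $\mathsf y=(\mathsf x,\mathsf r):\mathfrak C\to Y$, $\boldsymbol{\mathsf y}=\mathsf y\otimes\mathsf y$. On $\mathfrak C\times\mathfrak C$, $\mathsf x_i,\mathsf r_i$ refer to the $i$-th component. $\mathcal M_2(\mathfrak C\times\mathfrak C)$: Radon measures $\alpha\in\mathcal M(\mathfrak C\times\mathfrak C)$ with $\int(\mathsf r_1^2+\mathsf r_2^2)\,d\alpha<\infty$; $\mathfrak h_i\alpha=(\mathsf x_i)_\sharp(\mathsf r_i^2\alpha)\in\mathcal M(X)$. Similarly, for $\bar\alpha\in\mathcal M(Y\times Y)$ with $\int(r_1^2+r_2^2)\,d\bar\alpha<\infty$, $\mathrm h_i\bar\alpha=\pi^{x_i}_\sharp(r_i^2\bar\alpha)$. Dilations: for a positive Borel $\vartheta\in L^2(\alpha)$, $\mathrm{dil}_{\vartheta,2}(\alpha)=(\mathrm{prd}_\vartheta)_\sharp(\vartheta^2\alpha)$, $\mathrm{prd}_\vartheta([x_1,r_1],[x_2,r_2])=([x_1,r_1/\vartheta],[x_2,r_2/\vartheta])$, $\vartheta$ evaluated at $([x_1,r_1],[x_2,r_2])$ (it suffices that $\vartheta$ be defined and positive on a set where $\alpha$ is concentrated). Problems, for given $\mu_1,\mu_2$: (HK) $\mathsf{HK}^2(\mu_1,\mu_2)=\min\{\int d_{\mathfrak C}^2\,d\alpha:\alpha\in\mathcal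 M_2(\mathfrak C\times\mathfrak C),\ \mathfrak h_i\alpha=\mu_i\}$. (HK$_\le$) minimize $\int d_{\mathfrak C}^2\,d\alpha+\sum_i(\mu_i-\mathfrak h_i\alpha)(X)$ over $\alpha\in\mathcal M_2(\mathfrak C\times\mathfrak C)$ with $\mathfrak h_i\alpha\le\mu_i$ (equivalently, maximize $2\int\mathsf r_1\mathsf r_2\cos(d_\pi(\mathsf x_1,\mathsf x_2))\,d\alpha$ over the same set). (Y$_\le$) minimize $\int\big(r_1^2+r_2^2-2r_1r_2\cos(d_{\pi/2}(x_1,x_2))\big)d\bar\alpha+\sum_i(\mu_i-\mathrm h_i\bar\alpha)(X)$ over $\bar\alpha\in\mathcal M(Y\times Y)$ with $\int(r_1^2+r_2^2)\,d\bar\alpha<\infty$ and $\mathrm h_i\bar\alpha\le\mu_i$ (equivalently, maximize $2\int r_1r_2\cos(d_{\pi/2}(x_1,x_2))\,d\bar\alpha$ over the same set). (Y$_=$) minimize $\int\big(r_1^2+r_2^2-2r_1r_2\cos(d_{\pi/2}(x_1,x_2))\big)d\bar\alpha$ over $\bar\alpha\in\mathcal M(Y\times Y)$ with $\int(r_1^2+r_2^2)\,d\bar\alpha<\infty$ and $\mathrm h_i\bar\alpha=\mu_i$.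
   Formalization: In (i) the right-hand side also requires α to be admissible for (HK≤) (second moment finite, 𝔥_iα ≤ μ_i); in (ii) the left-hand side also requires (𝔭_♯ᾱ)(ℭ′)=0. Without these the literal ''if'' in (i) and ''only if'' in (ii) fail. *)

(* Defs.v *)
From HB Require Import structures.
From mathcomp Require Import all_boot all_order all_algebra.
From mathcomp Require Import generic_quotient.
From mathcomp Require Import all_classical all_reals all_analysis.

Set Implicit Arguments.
Unset Strict Implicit.
Unset Printing Implicit Defensive.

Import Order.TTheory GRing.Theory Num.Theory.
Import numFieldNormedType.Exports.

Local Open Scope classical_set_scope.
Local Open Scope ring_scope.
Local Open Scope quotient_scope.

(* makes S * T a ptopologicalType when S and T are *)
HB.saturate prod.

(* [borel (S * T)] is generated by the open sets of the product topology; it is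
   in general larger than the product of the two Borel sigma-algebras. *)
Notation borel T := (g_sigma_algebraType (@open T)).

(* A measure is handled through its underlying set function, so that
   push-forwards and weighted measures can be written before one knows that
   they are measures; [radon] states that a set function is one. *)
Notation setfun T R := (set (borel T) -> \bar R).

Section Measures.
Context {R : realType}.
Implicit Types S T : ptopologicalType.

Definition inner_regular T (mu : setfun T R) : Prop :=
  forall B : set (borel T), measurable B -> forall e : R, 0 < e ->
  exists K : set T, [/\ compact K, K `<=` B & (mu (B `\` K) <= e%:E)%E].

Definition radon T (mu : setfun T R) : Prop :=
  (exists m : {finite_measure set (borel T) -> \bar R},
      mu = m :> (set (borel T) -> \bar R)) /\ inner_regular mu.

Definition eq_meas T (mu nu : setfun T R) : Prop :=
  forall B : set (borel T), measurable B -> mu B = nu B.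

Definition le_meas T (mu nu : setfun T R) : Prop :=
  forall B : set (borel T), measurable B -> (mu B <= nu B)%E.

Definition push S T (f : S -> T) (mu : setfun S R) : setfun T R :=
  @pushforward _ _ (borel S) (borel T) R mu f.

Definition restr T (D : set T) (mu : setfun T R) : setfun T R :=
  fun A => mu (A `&` D).

Definition weight T (f : T -> R) (mu : setfun T R) : setfun T R :=
  fun A => (\int[mu]_(x in A) (f x)%:E)%E.

Definition borel_nonneg T (f : T -> R) : Prop :=
  measurable_fun [set: borel T] (f : borel T -> R) /\ forall x, 0 <= f x.

Definition mutually_singular T (mu nu : setfun T R) : Prop :=
  exists N : set (borel T), [/\ measurable N, mu N = 0%E & nu (~` N) = 0%E].

(* mu = rho nu + mu', mu' singular with respect to nu *)
Definition lebesgue_decomposition T (mu nu : setfun T R) (rho : T -> R) : Prop :=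
  borel_nonneg rho /\
  exists mu' : setfun T R, [/\ radon mu', mutually_singular mu' nu &
    eq_meas mu (fun A => weight rho nu A + mu' A)%E].

(* A real-valued Borel version of the density d nu / d mu; such a version exists
   when nu << mu are finite measures and is unique up to mu-null sets. *)
Definition rn_density T (nu mu : setfun T R) : T -> R :=
  xget (fun=> 0) [set s | borel_nonneg s /\ eq_meas nu (weight s mu)].

Definition optimal T (plans : set (setfun T R)) (cost : setfun T R -> \bar R) :
    set (setfun T R) :=
  [set a | plans a /\ forall b, plans b -> (cost a <= cost b)%E].

Definition separable T : Prop := exists2 D : set T, countable D & dense D.

Definition metrizable T : Prop :=
  exists rho : T -> T -> R,
    [/\ forall x y, rho x y = 0 <-> x = y,
        forall x y, rho x y = rho y x,
        forall x y z, rho x z <= rho x y + rho y z &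
        forall U : set T, open U <-> forall x, U x ->
          exists2 e, 0 < e & forall y, rho x y < e -> U y].

End Measures.

Section ExtendedMetric.
Context {R : realType} {X : ptopologicalType}.
Variable d : X -> X -> \bar R.

Definition extended_distance : Prop :=
  [/\ forall x y, (0 <= d x y)%E,
      forall x y, d x y = 0%E <-> x = y,
      forall x y, d x y = d y x &
      forall x y z, (d x z <= d x y + d y z)%E].

Definition extended_metric_topological : Prop :=
  [/\ hausdorff_space X, extended_distance &
      lower_semicontinuous (fun p : X * X => d p.1 p.2)].

Definition trunc_dist (a : R) (x y : X) : R := fine (Order.min (d x y) a%:E).

End ExtendedMetric.

Definition halfline (R : realType) : Type :=
  initial_topology (fun r : {nonneg R} => r%:num : R).

HB.instance Definition _ (R : realType) :=
  Topological.copy (halfline R)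
    (initial_topology (fun r : {nonneg R} => r%:num : R)).
HB.instance Definition _ (R : realType) :=
  isPointed.Build (halfline R) (0%:nng : {nonneg R}).

Definition hval (R : realType) (r : halfline R) : R := (r : {nonneg R})%:num.

Notation Yspace R X := ((X : ptopologicalType) * halfline R)%type.

Section Cone.
Context (R : realType) (X : ptopologicalType).

Definition cone_rel (y z : Yspace R X) : bool :=
  `[< y = z \/ (hval y.2 = 0 /\ hval z.2 = 0) >].

Lemma cone_rel_refl : reflexive cone_rel.
Proof. by move=> y; apply/asboolP; left. Qed.

Lemma cone_rel_sym : symmetric cone_rel.
Proof.
by move=> y z; apply/asboolP/asboolP => -[->|[? ?]]; [left|right|left|right].
Qed.

Lemma cone_rel_trans : transitive cone_rel.
Proof.
move=> z y w /asboolP[->//|[y0 z0]] /asboolP[<-|[_ w0]];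
  by apply/asboolP; right.
Qed.

Definition cone_equiv :=
  EquivRel cone_rel cone_rel_refl cone_rel_sym cone_rel_trans.

Definition cone : Type := {eq_quot cone_equiv}.
HB.instance Definition _ := Choice.copy cone {eq_quot cone_equiv}.

Definition cone_proj (y : Yspace R X) : cone := \pi_({eq_quot cone_equiv}) y.

Definition cone_repr (c : cone) : Yspace R X := repr (c : {eq_quot cone_equiv}).

Definition vertex : cone := cone_proj (point, (0%:nng : {nonneg R})).

HB.instance Definition _ := isPointed.Build cone vertex.

Definition cone_r (c : cone) : R := hval (cone_repr c).2.

(* The distinguished [point] of X serves as the fixed point xbar. *)
Definition cone_x (c : cone) : X :=
  if 0 < cone_r c then (cone_repr c).1 else point.

Definition cone_y (c : cone) : Yspace R X := (cone_x c, (cone_repr c).2).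

(* This is NOT the quotient topology of Y: the neighbourhoods of the vertex
   must contain a set {r < e}. *)
Definition cone_open (U : set cone) : Prop :=
  open [set y : Yspace R X | 0 < hval y.2 /\ U (cone_proj y)] /\
  (U vertex -> exists2 e : R, 0 < e & [set c | cone_r c < e] `<=` U).

Lemma hval_continuous : continuous (@hval R).
Proof. exact: (@initial_continuous _ _ (fun r : {nonneg R} => r%:num : R)). Qed.

Lemma open_hval_gt0 : open [set y : Yspace R X | 0 < hval y.2].
Proof.
have -> : [set y : Yspace R X | 0 < hval y.2]
        = (@hval R \o snd) @^-1` [set x : R | 0 < x] by [].
apply: open_comp; last exact: open_gt.
move=> y _; apply: continuous_comp; first exact: cvg_snd.
exact: hval_continuous.
Qed.

Lemma cone_openT : cone_open setT.
Proof.
split=> [|_]; last by exists 1.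
have -> : [set y : Yspace R X | 0 < hval y.2 /\ [set: cone] (cone_proj y)]
        = [set y | 0 < hval y.2] by apply/seteqP; split=> // y [].
exact: open_hval_gt0.
Qed.

Lemma cone_openI : setI_closed cone_open.
Proof.
move=> A B [oA vA] [oB vB]; split.
  have -> : [set y : Yspace R X | 0 < hval y.2 /\ (A `&` B) (cone_proj y)]
    = [set y | 0 < hval y.2 /\ A (cone_proj y)]
      `&` [set y | 0 < hval y.2 /\ B (cone_proj y)].
    by apply/seteqP; split=> y /=; [case=> ? []|case=> -[? ?] []].
  exact: openI.
move=> [/vA[e e0 eA] /vB[f f0 fB]]; exists (Num.min e f).
  by rewrite lt_min e0.
by move=> c /=; rewrite lt_min => /andP[ce cf]; split; [exact: eA|exact: fB].
Qed.

Lemma cone_open_bigU (I : Type) (f : I -> set cone) :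
  (forall i, cone_open (f i)) -> cone_open (\bigcup_i f i).
Proof.
move=> of_; split.
  have -> : [set y : Yspace R X | 0 < hval y.2 /\ (\bigcup_i f i) (cone_proj y)]
    = \bigcup_i [set y | 0 < hval y.2 /\ f i (cone_proj y)].
    by apply/seteqP; split=> y /=; [case=> ? [i _ ?]; exists i|case=> i _ [? ?];
      split=> //; exists i].
  by apply: bigcup_open => i _; have [] := of_ i.
move=> [i _ fiv]; have [_ /(_ fiv) [e e0 ef]] := of_ i.
by exists e => // c ce; exists i => //; exact: ef.
Qed.

HB.instance Definition _ :=
  isOpenTopological.Build cone cone_openT cone_openI cone_open_bigU.

Lemma cone_openE : @open cone = cone_open.
Proof. by []. Qed.

Lemma cone_repr_proj (y : Yspace R X) : cone_rel (cone_repr (cone_proj y)) y.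
Proof.
rewrite /cone_repr /cone_proj.
by rewrite -[cone_rel _ _]/(cone_equiv _ _) -eqmodE reprK.
Qed.

Lemma cone_r_proj (y : Yspace R X) : cone_r (cone_proj y) = hval y.2.
Proof.
by rewrite /cone_r; have /asboolP[->//|[-> ->]] := cone_repr_proj y.
Qed.

Lemma cone_x_proj (y : Yspace R X) : 0 < hval y.2 -> cone_x (cone_proj y) = y.1.
Proof.
move=> y0; rewrite /cone_x cone_r_proj y0.
by have /asboolP[->//|[_ yE]] := cone_repr_proj y; rewrite yE ltxx in y0.
Qed.

Lemma cone_proj_eq (y z : Yspace R X) : cone_proj y = cone_proj z <->
  y = z \/ (hval y.2 = 0 /\ hval z.2 = 0).
Proof.
rewrite /cone_proj; split=> [/eqquotP/asboolP//|yz].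
by apply/eqquotP/asboolP.
Qed.

Definition cone_proj2 (z : Yspace R X * Yspace R X) : cone * cone :=
  (cone_proj z.1, cone_proj z.2).

Definition cone_y2 (z : cone * cone) : Yspace R X * Yspace R X :=
  (cone_y z.1, cone_y z.2).

Definition cone_x2 (z : cone * cone) : X * X := (cone_x z.1, cone_x z.2).

(* the map prd_theta; the quotient by theta = 0 is 0, which is harmless since
   [dilation] weighs the measure by theta^2 *)
Definition prd (theta : cone * cone -> {nonneg R}) (z : cone * cone) :
    cone * cone :=
  let scaled c :=
    cone_proj (cone_x c,
      (((cone_repr c).2 : {nonneg R})%:num / (theta z)%:num)%:nng) in
  (scaled z.1, scaled z.2).

Definition dilation (theta : cone * cone -> {nonneg R})
    (a : setfun (cone * cone)%type R) : setfun (cone * cone)%type R :=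
  push (prd theta) (weight (fun z => (theta z)%:num ^+ 2) a).

Definition sqrt_lift (rho1 rho2 : X -> R) (p : X * X) : cone * cone :=
  (cone_proj (p.1, (Num.sqrt (rho1 p.1))%:nng),
   cone_proj (p.2, (Num.sqrt (rho2 p.2))%:nng)).

End Cone.

Section Problems.
Context {R : realType} {X : ptopologicalType}.
Variable d : X -> X -> \bar R.

Local Notation Y := (Yspace R X).
Local Notation C := (cone R X).
Implicit Types (mu : setfun X R).

Definition cone_cost (a : R) (x1 : X) (r1 : R) (x2 : X) (r2 : R) : R :=
  r1 ^+ 2 + r2 ^+ 2 - 2 * r1 * r2 * cos (trunc_dist d a x1 x2).

Definition cone_dist_sq (c1 c2 : C) : R :=
  cone_cost pi (cone_x c1) (cone_r c1) (cone_x c2) (cone_r c2).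

(* x_#(r^2 a), where x and r are coordinates on the space Z carrying a *)
Definition hmarg (Z : ptopologicalType) (x : Z -> X) (r : Z -> R)
    (a : setfun Z R) : setfun X R :=
  push x (weight (fun z => r z ^+ 2) a).

Definition hC1 : setfun (C * C)%type R -> setfun X R :=
  hmarg (fun z : C * C => cone_x z.1) (fun z => cone_r z.1).
Definition hC2 : setfun (C * C)%type R -> setfun X R :=
  hmarg (fun z : C * C => cone_x z.2) (fun z => cone_r z.2).
Definition hY1 : setfun (Y * Y)%type R -> setfun X R :=
  hmarg (fun z : Y * Y => z.1.1) (fun z => hval z.1.2).
Definition hY2 : setfun (Y * Y)%type R -> setfun X R :=
  hmarg (fun z : Y * Y => z.2.1) (fun z => hval z.2.2).

Definition M2C (a : setfun (C * C)%type R) : Prop :=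
  radon a /\ (\int[a]_z (cone_r z.1 ^+ 2 + cone_r z.2 ^+ 2)%:E < +oo)%E.

Definition M2Y (a : setfun (Y * Y)%type R) : Prop :=
  radon a /\ (\int[a]_z (hval z.1.2 ^+ 2 + hval z.2.2 ^+ 2)%:E < +oo)%E.

Definition cost_C (a : setfun (C * C)%type R) : \bar R :=
  (\int[a]_z (cone_dist_sq z.1 z.2)%:E)%E.

Definition cost_Y (a : setfun (Y * Y)%type R) : \bar R :=
  (\int[a]_z (cone_cost (pi / 2) z.1.1 (hval z.1.2) z.2.1 (hval z.2.2))%:E)%E.

Definition HK_plans mu1 mu2 : set (setfun (C * C)%type R) :=
  [set a | [/\ M2C a, eq_meas (hC1 a) mu1 & eq_meas (hC2 a) mu2]].

(* This value is HK^2; here and in [LET] the minimum is written as an infimum. *)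
Definition HK2 mu1 mu2 : \bar R := ereal_inf (cost_C @` HK_plans mu1 mu2).

Definition HK_opt mu1 mu2 := optimal (HK_plans mu1 mu2) cost_C.

Definition HKle_plans mu1 mu2 : set (setfun (C * C)%type R) :=
  [set a | [/\ M2C a, le_meas (hC1 a) mu1 & le_meas (hC2 a) mu2]].

Definition HKle_cost mu1 mu2 (a : setfun (C * C)%type R) : \bar R :=
  (cost_C a + (mu1 setT - hC1 a setT) + (mu2 setT - hC2 a setT))%E.

Definition HKle_opt mu1 mu2 :=
  optimal (HKle_plans mu1 mu2) (HKle_cost mu1 mu2).

Definition Yle_plans mu1 mu2 : set (setfun (Y * Y)%type R) :=
  [set a | [/\ M2Y a, le_meas (hY1 a) mu1 & le_meas (hY2 a) mu2]].

Definition Yle_cost mu1 mu2 (a : setfun (Y * Y)%type R) : \bar R :=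
  (cost_Y a + (mu1 setT - hY1 a setT) + (mu2 setT - hY2 a setT))%E.

Definition Yle_opt mu1 mu2 := optimal (Yle_plans mu1 mu2) (Yle_cost mu1 mu2).

Definition Yeq_plans mu1 mu2 : set (setfun (Y * Y)%type R) :=
  [set a | [/\ M2Y a, eq_meas (hY1 a) mu1 & eq_meas (hY2 a) mu2]].

Definition Yeq_opt mu1 mu2 := optimal (Yeq_plans mu1 mu2) cost_Y.

Definition marg1 (g : setfun (X * X)%type R) : setfun X R :=
  push (fun p : X * X => p.1) g.
Definition marg2 (g : setfun (X * X)%type R) : setfun X R :=
  push (fun p : X * X => p.2) g.

(* [ln 0 = 0], so this is 1 at s = 0. *)
Definition entropy (s : R) : R := s * ln s - s + 1.

Definition ell (s : \bar R) : \bar R :=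
  if (s < (pi / 2)%:E)%E then (- ln (cos (fine s) ^+ 2))%:E else +oo%E.

Definition LET_plans mu1 mu2 : set (setfun (X * X)%type R) :=
  [set g | [/\ radon g, marg1 g `<< mu1 & marg2 g `<< mu2]].

Definition LET_cost mu1 mu2 (g : setfun (X * X)%type R) : \bar R :=
  (\int[mu1]_x (entropy (rn_density (marg1 g) mu1 x))%:E
   + \int[mu2]_x (entropy (rn_density (marg2 g) mu2 x))%:E
   + \int[g]_p ell (d p.1 p.2))%E.

Definition LET mu1 mu2 : \bar R :=
  ereal_inf (LET_cost mu1 mu2 @` LET_plans mu1 mu2).

Definition LET_opt mu1 mu2 := optimal (LET_plans mu1 mu2) (LET_cost mu1 mu2).

Definition offvertex2 : set (C * C) :=
  [set z | z.1 <> vertex R X /\ z.2 <> vertex R X].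

Definition far_set : set (C * C) :=
  offvertex2 `&` [set z | ((pi / 2)%:E < d (cone_x z.1) (cone_x z.2))%E].

Definition good_set : set (C * C) :=
  [set z | cone_r z.1 * cone_r z.2 <> 0
         /\ (d (cone_x z.1) (cone_x z.2) < (pi / 2)%:E)%E].

Definition cross (z : C * C) : R :=
  cone_r z.1 * cone_r z.2
  * cos (trunc_dist d (pi / 2) (cone_x z.1) (cone_x z.2)).

Definition theta_cross (z : C * C) : {nonneg R} := (Num.sqrt (cross z))%:nng.

End Problems.

(* Main.v *)
Require Import Defs.
From HB Require Import structures.
From mathcomp Require Import all_boot all_order all_algebra.
From mathcomp Require Import all_classical all_reals all_analysis.
From mathcomp Require Import measurable_realfun ring lra.

Import Order.TTheory GRing.Theory Num.Theory.
Import numFieldNormedType.Exports.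

Set Implicit Arguments.
Unset Strict Implicit.
Unset Printing Implicit Defensive.

Local Open Scope classical_set_scope.
Local Open Scope ring_scope.

(** Write [u] for the integral over a plan of the cross term
  [r1 r2 cos (d_(pi/2))]. The cone cost is [r1^2 + r2^2 - 2 r1 r2 cos (d_pi)],
  and [cos (d_pi)] is at most [cos (d_(pi/2))], strictly so exactly where
  [d > pi/2]. Hence the cost of a plan with marginals below [mu1], [mu2],
  penalties included, is at least
  [value u = mu1(X) + mu2(X) - 2 u], with equality if and only if the plan does
  not charge [far_set] (lemma [total_cost]). On [Y * Y] the cost is [value u].

  The four transport problems allow the same values of [u]. Plans on [Y * Y]
  project to the cone, and a cone plan lifts once it is restricted to the
  complement of the vertex, where the projection is a homeomorphism. Neither
  this restriction nor the one to [good_set] changes [u], because the cross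
  term vanishes on what is removed. Finally, a plan whose marginals are too small
  is completed by matching the missing mass with the vertex, which again does
  not change [u] ([Y_extend]). So a competitor is optimal if and only if its [u]
  is the largest possible one and, on the cone, it does not charge [far_set]
  ([HKle_optP], [HK_optP], [Y_optP], [Yeq_optP]). This gives the vanishing of
  optimal plans on [far_set] and parts (i) and (ii).

  Entropy-transport enters through the inequality [ln t <= t - 1], which is an
  equality only at [t = 1]. Dilating a plan by the square root of its cross
  term makes the cross term [1] and keeps [u] ([dilation_plan]). If [sigma_i]
  are the densities of the marginals of the projection of the dilated plan to
  [X * X], the inequality at [t = sigma_i r_i^2] shows that the cost of this
  projection is at most [value u] ([LET_upper]). Conversely, a competitor on
  [X * X] is lifted to the cone with radii [sigma_i^(-1/2)], and the inequality
  at [t = r1 r2 cos (d_(pi/2))] bounds its cost from below by [value u] for the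
  lift ([LET_lower]). Together these give the equality of the two values; the
  equality cases give the unit cross term in part (iii) and, in part (iv), the
  identities [sigma_i r_i^2 = 1], which say that the dilated plan is the
  lift of its projection.

  The space is not assumed to have a countable base, so the image of a Radon
  measure under a Borel map need not be Radon. The maps that occur have
  the Lusin property: a Borel function into the line always has it, the maps
  into [X * X] are continuous outside a closed null set, and the property is
  kept by pairing and by composition with continuous maps. *)

(** * Finite Borel measures *)

Definition finmeas (R : realType) (T : ptopologicalType) (mu : setfun T R) : Prop :=
  exists m : {finite_measure set (borel T) -> \bar R},
    mu = m :> (set (borel T) -> \bar R).

Section FiniteMeasures.
Context {R : realType}.
Implicit Types S T : ptopologicalType.
Local Open Scope ereal_scope.

Lemma finmeasP T (mu : setfun T R) :
  mu set0 = 0 -> (forall A, 0 <= mu A) ->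
  semi_sigma_additive (mu : set (borel T) -> \bar R) -> mu setT < +oo -> finmeas mu.
Proof.
move=> mu0 mu_ge0 mus muT.
pose Hm := isMeasure.Build _ (borel T) R mu mu0 mu_ge0 mus.
pose m : {measure set (borel T) -> \bar R} :=
  HB.pack_for {measure set (borel T) -> \bar R} mu Hm.
have mf : fin_num_fun (m : set (borel T) -> \bar R).
  move=> A mA; rewrite ge0_fin_numE ?measure_ge0//.
  by rewrite (le_lt_trans _ muT)// -[mu]/(m : set _ -> _) le_measure ?inE.
pose Hf := Measure_isFinite.Build _ (borel T) R m mf.
pose m' : {finite_measure set (borel T) -> \bar R} :=
  HB.pack_for {finite_measure set (borel T) -> \bar R} (Measure.sort m) Hf.
by exists m'.
Qed.

Lemma finmeas_of T (m : {measure set (borel T) -> \bar R}) :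
  m setT < +oo -> finmeas (m : setfun T R).
Proof.
move=> mT; apply: finmeasP => //; exact: measure_semi_sigma_additive.
Qed.

Lemma radon_finmeas T (mu : setfun T R) : radon mu -> finmeas mu.
Proof. by case. Qed.

Lemma finmeas_fin T (mu : setfun T R) (A : set (borel T)) :
  finmeas mu -> measurable A -> mu A \is a fin_num.
Proof. by case=> m -> mA; exact: fin_num_measure. Qed.

Lemma finmeas_ge0 T (mu : setfun T R) A : finmeas mu -> 0 <= mu A.
Proof. by case=> m ->; exact: measure_ge0. Qed.

Lemma finmeas_le T (mu : setfun T R) (A B : set (borel T)) : finmeas mu ->
  measurable A -> measurable B -> A `<=` B -> mu A <= mu B.
Proof. by case=> m -> mA mB AB; rewrite le_measure ?inE. Qed.

Lemma push_finmeas S T (f : S -> T) (mu : setfun S R) :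
  finmeas mu -> measurable_fun [set: borel S] (f : borel S -> borel T) ->
  finmeas (push f mu).
Proof.
move=> [m ->] mf; pose Hm := isMeasurableFun.Build _ _ _ _ _ mf.
pose f' : {mfun borel S >-> borel T} := HB.pack (f : borel S -> borel T) Hm.
have := @finmeas_of T (pushforward m f').
apply; change (m setT < +oo).
by rewrite -ge0_fin_numE// fin_num_measure.
Qed.

Lemma push_integral S T (f : S -> T) (mu : setfun S R) (g : T -> \bar R) :
  finmeas mu -> measurable_fun [set: borel S] (f : borel S -> borel T) ->
  measurable_fun [set: borel T] (g : borel T -> \bar R) -> (forall x, 0 <= g x) ->
  \int[push f mu]_x g x = \int[mu]_x g (f x).
Proof.
move=> [m ->] mf mg g0.
by rewrite /push ge0_integral_pushforward// => x _; exact: g0.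
Qed.

Lemma restr_finmeas T (D : set (borel T)) (mu : setfun T R) :
  finmeas mu -> measurable D -> finmeas (restr D mu).
Proof.
move=> [m ->] mD; have := @finmeas_of T (mrestr m mD).
apply; rewrite /= /mrestr setTI.
by rewrite -ge0_fin_numE// fin_num_measure.
Qed.

Lemma restr_integral T (D : set (borel T)) (mu : setfun T R) (g : T -> \bar R) :
  finmeas mu -> measurable D ->
  measurable_fun [set: borel T] (g : borel T -> \bar R) -> (forall x, 0 <= g x) ->
  \int[restr D mu]_x g x = \int[mu]_(x in D) g x.
Proof.
move=> [m ->] mD mg g0.
change (\int[mrestr m mD]_x g x = \int[m]_(x in D) g x).
have mDC : measurable (~` D) by exact: measurableC.
rewrite -(setvU D) ge0_integral_setU//; last 2 first.
  by rewrite setvU.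
  by apply/disj_set2P; rewrite setICl.
rewrite [X in X + _](_ : _ = 0) ?add0e.
  by apply: eq_measure_integral => A mA AD; rewrite /mrestr/= /mrestr setIidl.
apply: null_set_integral => //; first exact: measurable_funTS.
by rewrite /= /mrestr setICl measure0.
Qed.

Lemma restr_integral_ind T (D : set (borel T)) (mu : setfun T R) (g : T -> \bar R) :
  finmeas mu -> measurable D ->
  measurable_fun [set: borel T] (g : borel T -> \bar R) -> (forall x, 0 <= g x) ->
  \int[restr D mu]_x g x = \int[mu]_x ((\1_D x)%:E * g x).
Proof.
move=> fm mD mg g0; rewrite restr_integral//; case: fm => m ->.
rewrite integral_mkcond; apply: eq_integral => x _; rewrite patchE indicE.
by case: (x \in D); rewrite ?mul1e ?mul0e.
Qed.

Lemma weight_finmeas T (f : T -> R) (mu : setfun T R) :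
  finmeas mu -> borel_nonneg f -> \int[mu]_x (f x)%:E < +oo ->
  finmeas (weight f mu).
Proof.
move=> [m ->] [mf f0] foo; apply: finmeasP => //.
- by rewrite /weight integral_set0.
- by move=> A; apply: integral_ge0 => x _; rewrite lee_fin.
move=> F mF tF mU.
rewrite /weight (@ge0_integral_bigcup _ _ _ m)//.
- by apply: is_cvg_ereal_nneg_natsum => n _;
    apply: integral_ge0 => x _; rewrite lee_fin.
- by apply/measurable_EFinP; exact: measurable_funTS.
- by move=> x _; rewrite lee_fin.
Qed.

(** [f] is a Radon-Nikodym density of [weight f mu], and almost everywhere
  uniqueness of densities transfers the change of variables to [f] itself. *)
Lemma weight_integral T (f : T -> R) (mu : setfun T R) (g : T -> \bar R) :
  finmeas mu -> borel_nonneg f -> \int[mu]_x (f x)%:E < +oo ->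
  measurable_fun [set: borel T] (g : borel T -> \bar R) -> (forall x, 0 <= g x) ->
  \int[weight f mu]_x g x = \int[mu]_x ((f x)%:E * g x).
Proof.
move=> fm bf foo mg g0; have [nu nuE] := weight_finmeas fm bf foo.
case: fm bf => [m mE] [mf f0]; rewrite {}mE in foo nuE *.
have mEf : measurable_fun [set: borel T] (EFin \o f) by exact/measurable_EFinP.
have num : nu `<< m.
  apply/null_content_dominatesP => A mA mA0; rewrite -nuE.
  by apply: null_set_integral => //; exact: measurable_funTS.
rewrite nuE -(Radon_Nikodym_SigmaFinite.change_of_variables num)//.
have ae : ae_eq m setT (EFin \o f) (Radon_Nikodym_SigmaFinite.f nu m).
  apply: integral_ae_eq => //.
  - apply/integrableP; split=> //.
    by under eq_integral do rewrite gee0_abs ?lee_fin//.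
  - exact: measurable_int (Radon_Nikodym_SigmaFinite.f_integrable num).
  - move=> E _ mE; rewrite -(Radon_Nikodym_SigmaFinite.f_integral num)//.
    by rewrite -nuE.
apply: ae_eq_integral => //.
- apply: emeasurable_funM => //.
  exact: measurable_int (Radon_Nikodym_SigmaFinite.f_integrable num).
- exact: emeasurable_funM.
apply: filterS ae => x /(_ I) fx _.
by rewrite /= -fx muleC.
Qed.

Lemma le_meas_integral T (mu nu : setfun T R) (g : T -> \bar R) :
  finmeas mu -> finmeas nu -> le_meas mu nu ->
  measurable_fun [set: borel T] (g : borel T -> \bar R) -> (forall x, 0 <= g x) ->
  \int[mu]_x g x <= \int[nu]_x g x.
Proof. by move=> [m ->] [n ->] mn mg g0; exact: ge0_le_measure_integral. Qed.

Lemma eq_meas_le T (mu nu : setfun T R) : eq_meas mu nu -> le_meas mu nu.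
Proof. by move=> e A mA; rewrite e. Qed.

Lemma eq_meas_integral T (mu nu : setfun T R) (g : T -> \bar R) :
  finmeas mu -> finmeas nu -> eq_meas mu nu ->
  \int[mu]_x g x = \int[nu]_x g x.
Proof.
by move=> [m ->] [n ->] mn; apply: eq_measure_integral => A mA _; exact: mn.
Qed.

Lemma add_finmeas T (mu nu : setfun T R) : finmeas mu -> finmeas nu ->
  finmeas (fun A => mu A + nu A).
Proof.
move=> [m ->] [n ->].
have -> : (fun A => m A + n A) = (measure_add m n : set (borel T) -> \bar R).
  by apply/funext => A; rewrite measure_addE.
apply: finmeas_of; change (measure_add m n setT < +oo).
by rewrite measure_addE lte_add_pinfty// -ge0_fin_numE// fin_num_measure.
Qed.

Lemma add_integral T (mu nu : setfun T R) (g : T -> \bar R) :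
  finmeas mu -> finmeas nu ->
  measurable_fun [set: borel T] (g : borel T -> \bar R) -> (forall x, 0 <= g x) ->
  \int[(fun A => mu A + nu A)]_x g x = \int[mu]_x g x + \int[nu]_x g x.
Proof.
move=> [m ->] [n ->] mg g0; rewrite -ge0_integral_measure_add//.
by congr integral; apply/funext => A; rewrite measure_addE.
Qed.

(** Set functions are defined on all sets, and a measure has to be nonnegative on
  all of them; the truncation at [0] has an effect on non-measurable sets only. *)
Definition meas_diff T (mu nu : setfun T R) : setfun T R :=
  fun A => maxe 0 (mu A - nu A).

Lemma meas_diffE T (mu nu : setfun T R) (A : set (borel T)) :
  finmeas nu -> le_meas nu mu -> measurable A ->
  meas_diff mu nu A = mu A - nu A.
Proof.
move=> fn le mA; rewrite /meas_diff; apply/max_idPr.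
by rewrite sube_ge0 ?le// finmeas_fin ?orbT.
Qed.

Lemma diff_finmeas T (mu nu : setfun T R) : finmeas mu -> finmeas nu ->
  le_meas nu mu -> finmeas (meas_diff mu nu).
Proof.
move=> fm fn le; have dE := meas_diffE fn le.
case: (fm) (fn) => [m mE] [n nE].
pose c : {charge set (borel T) -> \bar R} := cadd (charge_of_finite_measure m)
  (cscale (-1) (charge_of_finite_measure n)).
have cE A : c A = m A - n A.
  by congr (_ + _); exact: mulN1e.
apply: finmeasP => //.
- by rewrite dE// mE nE !measure0 subee.
- by move=> A; rewrite /meas_diff le_max lexx.
- move=> F mF tF mU; rewrite dE// mE nE -cE.
  have FE : (fun k => \sum_(0 <= i < k) meas_diff mu nu (F i))
          = (fun k => \sum_(0 <= i < k) c (F i)).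
    by apply/funext => k; apply: eq_bigr => i _; rewrite dE// mE nE cE.
  by move: FE; rewrite mE nE => ->; exact: charge_semi_sigma_additive.
rewrite dE// -ge0_fin_numE; last by rewrite sube_ge0 ?le// finmeas_fin ?orbT.
by rewrite fin_numB !finmeas_fin.
Qed.

End FiniteMeasures.

(** * Radon measures and the Lusin property *)

Section BorelMeasurability.
Implicit Types S T : ptopologicalType.

Lemma open_borel T (A : set T) : open A -> measurable (A : set (borel T)).
Proof. by move=> oA; exact: sub_sigma_algebra. Qed.

Lemma closed_borel T (A : set T) : closed A -> measurable (A : set (borel T)).
Proof.
move=> cA; rewrite -(setCK A); apply: measurableC; apply: open_borel.
exact: closed_openC.
Qed.

Lemma compact_borel T (A : set T) : hausdorff_space T -> compact A ->
  measurable (A : set (borel T)).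
Proof. by move=> hT cA; apply: closed_borel; exact: compact_closed. Qed.

Lemma borel_fun_open S T (f : S -> T) :
  (forall U, open U -> measurable (f @^-1` U : set (borel S))) ->
  measurable_fun [set: borel S] (f : borel S -> borel T).
Proof.
move=> fo; apply: (@measurability _ _ (borel S) (borel T) setT f (@open T)) => //.
by move=> _ [U oU <-]; rewrite setTI; exact: fo.
Qed.

Lemma borel_preimage_open S T (f : S -> T) (U : set T) :
  measurable_fun [set: borel S] (f : borel S -> borel T) -> open U ->
  measurable (f @^-1` U : set (borel S)).
Proof.
move=> mf oU; rewrite -[X in measurable X]setTI; apply: mf => //.
exact: open_borel.
Qed.

Lemma continuous_borel S T (f : S -> T) : continuous f ->
  measurable_fun [set: borel S] (f : borel S -> borel T).
Proof.
move=> cf; apply: borel_fun_open => U oU; apply: open_borel.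
by apply: open_comp => // x _; exact: cf.
Qed.

Lemma borel_comp S T d (U : measurableType d) (g : T -> U) (f : S -> T) :
  measurable_fun [set: borel T] (g : borel T -> U) ->
  measurable_fun [set: borel S] (f : borel S -> borel T) ->
  measurable_fun [set: borel S] ((fun x => g (f x)) : borel S -> U).
Proof. exact: measurableT_comp. Qed.

Lemma borel_fst S T :
  measurable_fun [set: borel (S * T)%type] (fst : borel (S * T)%type -> borel S).
Proof. by apply: continuous_borel => z; exact: cvg_fst. Qed.

Lemma borel_snd S T :
  measurable_fun [set: borel (S * T)%type] (snd : borel (S * T)%type -> borel T).
Proof. by apply: continuous_borel => z; exact: cvg_snd. Qed.

(** The coordinates of a cone point are continuous off the vertex only, and constant
  on the rest. *)
Lemma borel_fun_glue S T (D : set S) (f g : S -> T) : open D ->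
  (forall x, D x -> {for x, continuous f}) ->
  measurable_fun [set: borel S] (g : borel S -> borel T) ->
  (forall x, ~ D x -> f x = g x) ->
  measurable_fun [set: borel S] (f : borel S -> borel T).
Proof.
move=> oD cf mg fg; apply: borel_fun_open => U oU.
rewrite -(setTI (f @^-1` U)) -(setUv D) setIUl; apply: measurableU.
  apply: open_borel; rewrite openE => x [Dx Ufx].
  have nD : nbhs x D := open_nbhs_nbhs (conj oD Dx).
  have nU : nbhs (f x) U := open_nbhs_nbhs (conj oU Ufx).
  exact: (filterI nD (cf _ Dx _ nU)).
rewrite (_ : _ `&` _ = ~` D `&` g @^-1` U).
  apply: measurableI; first by apply: measurableC; exact: open_borel.
  by rewrite -[X in measurable X]setTI; apply: mg => //; exact: open_borel.
by apply/seteqP; split=> x [nDx] /=; rewrite fg.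
Qed.

Lemma continuous_real (R : realType) T (f : T -> R) : continuous f ->
  measurable_fun [set: borel T] (f : borel T -> R).
Proof.
move=> cf; apply: (measurability _ (RGenOInfty.measurableE R)).
move=> _ [_ [a ->]] <-; rewrite setTI; apply: open_borel.
by apply: open_comp => [x _|]; [exact: cf|exact: interval_open].
Qed.

Definition rat_itv (R : realType) (n : nat) : set R :=
  if unpickle n is Some (a, b) then `](ratr a : R), ratr b[%classic else set0.

Lemma rat_itv_open (R : realType) n : open (@rat_itv R n).
Proof. by rewrite /rat_itv; case: unpickle => [[a b]|]; [exact: interval_open|exact: open0]. Qed.

Lemma rat_itv_measurable (R : realType) n : measurable (@rat_itv R n).
Proof. by apply: open_measurable; exact: rat_itv_open. Qed.

Lemma rat_itv_basis (R : realType) (x : R) (V : set R) : nbhs x V ->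
  exists n, rat_itv n x /\ rat_itv n `<=` V.
Proof.
move=> /nbhs_ballP[e /= e0 eV].
have /rat_in_itvoo[a /itvP aE] : x - e < x by rewrite ltrBlDr ltrDl.
have /rat_in_itvoo[b /itvP bE] : x < x + e by rewrite ltrDl.
exists (pickle (a, b)); rewrite /rat_itv pickleK; split.
  by rewrite /= in_itv /= aE bE.
move=> y /=; rewrite in_itv /= => /andP[ay yb]; apply: eV.
rewrite /ball /= distrC ltr_distl (lt_trans _ ay) ?aE//=.
by rewrite (lt_trans yb)// bE.
Qed.

(** The Borel sets of a product can exceed the product of the Borel sets. One
  second countable factor is enough for a pair of Borel maps to be Borel: an
  open set is a countable union of rectangles with sides [rat_itv n]. *)
Lemma borel_pair_real (R : realType) S T (f : S -> T) (g : S -> R) :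
  measurable_fun [set: borel S] (f : borel S -> borel T) ->
  measurable_fun [set: borel S] (g : borel S -> R) ->
  measurable_fun [set: borel S]
    ((fun x => (f x, g x)) : borel S -> borel (T * R)%type).
Proof.
move=> mf mg; apply: borel_fun_open => W oW.
pose A n := \bigcup_(O in [set O : set T | open O /\ O `*` rat_itv n `<=` W]) O.
rewrite (_ : _ @^-1` W = \bigcup_n (f @^-1` A n `&` g @^-1` (@rat_itv R n))).
  apply: bigcup_measurable => n _; apply: measurableI.
    rewrite -[X in measurable X]setTI; apply: mf => //; apply: open_borel.
    by apply: bigcup_open => O [].
  by rewrite -[X in measurable X]setTI; apply: mg => //; exact: rat_itv_measurable.
apply/seteqP; split=> x /=.
  move=> Wx; have [[P Q] [nP nQ] PQ] : nbhs (f x, g x) W.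
    exact: open_nbhs_nbhs (conj oW Wx).
  have [n [nx nQ']] := rat_itv_basis nQ.
  exists n => //; split => //.
  exists P°; last exact: nP.
  split; first exact: open_interior.
  by case=> y z [yP zn]; apply: PQ; split; [exact: (interior_subset yP)|exact: nQ'].
by move=> [n _ [[V [oV VW] Vfx] gn]]; apply: VW; split.
Qed.

End BorelMeasurability.

Section Hausdorff.
Implicit Types S T U : topologicalType.

Lemma continuous_fst S T : continuous (@fst S T).
Proof. by move=> z; exact: cvg_fst. Qed.

Lemma continuous_snd S T : continuous (@snd S T).
Proof. by move=> z; exact: cvg_snd. Qed.

Lemma continuous_pair S T U (f : S -> T) (g : S -> U) (x : S) :
  {for x, continuous f} -> {for x, continuous g} ->
  {for x, continuous (fun z => (f z, g z))}.
Proof. by move=> cf cg; exact: cvg_pair. Qed.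

Lemma cluster_map S T (f : S -> T) (p q : S) : {for p, continuous f} ->
  {for q, continuous f} -> cluster (nbhs p) q -> cluster (nbhs (f p)) (f q).
Proof.
move=> cp cq pq A B nA nB; have [z [Az Bz]] := pq _ _ (cp _ nA) (cq _ nB).
by exists (f z).
Qed.

Lemma hausdorff_prod S T : hausdorff_space S -> hausdorff_space T ->
  hausdorff_space (S * T)%type.
Proof.
move=> hS hT p q pq; rewrite [p]surjective_pairing [q]surjective_pairing.
congr (_, _); [apply: hS|apply: hT]; apply: cluster_map pq => //;
  by [apply: cvg_fst|apply: cvg_snd].
Qed.

Lemma continuous_prodmap S S' T T' (f : S -> T) (g : S' -> T') :
  continuous f -> continuous g ->
  continuous (fun z : S * S' => (f z.1, g z.2)).
Proof.
move=> cf cg z; apply: (@continuous_pair _ _ _ (f \o fst) (g \o snd)).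
  by apply: continuous_comp; [exact: continuous_fst|exact: cf].
by apply: continuous_comp; [exact: continuous_snd|exact: cg].
Qed.

End Hausdorff.

Lemma borel_pair_cstl (S T : ptopologicalType) (c : S) :
  measurable_fun [set: borel T] ((fun y => (c, y)) : borel T -> borel (S * T)%type).
Proof.
by apply: continuous_borel => y; apply: continuous_pair; [exact: cvg_cst|exact: cvg_id].
Qed.

Lemma borel_pair_cstr (S T : ptopologicalType) (c : T) :
  measurable_fun [set: borel S] ((fun y => (y, c)) : borel S -> borel (S * T)%type).
Proof.
by apply: continuous_borel => y; apply: continuous_pair; [exact: cvg_id|exact: cvg_cst].
Qed.

Lemma borel_prodmap (S S' T T' : ptopologicalType) (f : S -> T) (g : S' -> T') :
  continuous f -> continuous g ->
  measurable_fun [set: borel (S * S')%type]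
    ((fun z => (f z.1, g z.2)) : borel (S * S')%type -> borel (T * T')%type).
Proof. by move=> cf cg; apply: continuous_borel; exact: continuous_prodmap. Qed.

Section Radon.
Context {R : realType}.
Implicit Types S T : ptopologicalType.

Lemma radon_dominated T (mu nu : setfun T R) : hausdorff_space T ->
  radon mu -> finmeas nu -> le_meas nu mu -> radon nu.
Proof.
move=> hT [fm im] fn le; split=> // B mB e e0; have [K [cK KB Ke]] := im _ mB _ e0.
exists K; split=> //; rewrite (le_trans _ Ke)// le//.
by apply: measurableD => //; exact: compact_borel.
Qed.

Lemma restr_radon T (D : set (borel T)) (mu : setfun T R) : hausdorff_space T ->
  radon mu -> measurable D -> radon (restr D mu).
Proof.
move=> hT rm mD; have fm := radon_finmeas rm.
apply: (radon_dominated hT rm); first exact: restr_finmeas.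
move=> A mA; apply: finmeas_le => //; exact: measurableI.
Qed.

Lemma add_radon T (mu nu : setfun T R) : hausdorff_space T ->
  radon mu -> radon nu -> radon (fun A => mu A + nu A)%E.
Proof.
move=> hT [fm im] [fn In]; split; first exact: add_finmeas.
move=> B mB e e0; have e20 : 0 < e / 2 by rewrite divr_gt0.
have [K [cK KB Ke]] := im _ mB _ e20; have [L [cL LB Le]] := In _ mB _ e20.
have mK : measurable (K : set (borel T)) by exact: compact_borel.
have mL : measurable (L : set (borel T)) by exact: compact_borel.
exists (K `|` L); split; first exact: compactU.
  by move=> x []; [exact: KB|exact: LB].
have mD : measurable (B `\` (K `|` L)) by apply: measurableD => //; exact: measurableU.
rewrite [e in e%:E]splitr EFinD leeD//.
  apply: le_trans Ke; apply: finmeas_le => //; first exact: measurableD.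
  by move=> x [Bx KLx]; split=> // Kx; apply: KLx; left.
apply: le_trans Le; apply: finmeas_le => //; first exact: measurableD.
by move=> x [Bx KLx]; split=> // Kx; apply: KLx; right.
Qed.

(** Inner regularity passes to a weighted measure by absolute continuity of the
  integral. *)
Lemma weight_radon T (f : T -> R) (mu : setfun T R) : hausdorff_space T ->
  radon mu -> borel_nonneg f -> (\int[mu]_x (f x)%:E < +oo)%E ->
  radon (weight f mu).
Proof.
move=> hT [fm im] bf foo; split; first exact: weight_finmeas.
case: bf fm => mf f0 [m mE]; rewrite mE in foo im *.
have fi : m.-integrable setT (EFin \o (f : borel T -> R)).
  apply/integrableP; split; first exact/measurable_EFinP.
  by under eq_integral do rewrite gee0_abs ?lee_fin//.
move=> B mB e e0; have [d [d0 dP]] := integral_normr_continuous fi e0.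
have d20 : 0 < d / 2 by rewrite divr_gt0.
have [K [cK KB Kd]] := im _ mB _ d20.
have mBK : measurable (B `\` K) by apply: measurableD => //; exact: compact_borel.
exists K; split=> //.
have /dP : (m (B `\` K) < d%:E)%E.
  by rewrite (le_lt_trans Kd)// lte_fin ltr_pdivrMr// mulr_natr mulr2n ltrDr.
move=> /(_ mBK) /ltW.
rewrite -lee_fin /Rintegral fineK.
  rewrite /weight; under eq_integral do rewrite ger0_norm//.
  by [].
have -> : (\int[m]_(x in B `\` K) `|f x|%:E = weight f m (B `\` K))%E.
  by rewrite /weight; apply: eq_integral => x _; rewrite ger0_norm.
apply: (@finmeas_fin _ _ (weight f m)) => //.
by apply: weight_finmeas => //; exists m.
Qed.

(** The conclusion of Lusin's theorem, which can fail for Borel maps into spaces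
  without a countable base. *)
Definition lusin S T (mu : setfun S R) (f : S -> T) : Prop :=
  forall e : R, 0 < e -> exists K : set S,
    [/\ compact K, {within K, continuous f} & (mu (~` K) <= e%:E)%E].

(** A compact set on which [f] is continuous has a compact image, so inner
  regularity of [mu] passes to the image. *)
Lemma lusin_radon S T (mu : setfun S R) (f : S -> T) :
  hausdorff_space S -> hausdorff_space T -> radon mu ->
  measurable_fun [set: borel S] (f : borel S -> borel T) ->
  lusin mu f -> radon (push f mu).
Proof.
move=> hS hT [fm im] mf lf; split; first exact: push_finmeas.
move=> B mB e e0; have e20 : 0 < e / 2 by rewrite divr_gt0.
have mfB : measurable (f @^-1` B : set (borel S)).
  by rewrite -[X in measurable X]setTI; exact: mf.
have [K [cK KB Ke]] := im _ mfB _ e20; have [L [cL cfL Le]] := lf _ e20.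
have mK : measurable (K : set (borel S)) by exact: compact_borel.
have mL : measurable (L : set (borel S)) by exact: compact_borel.
have cKL : compact (K `&` L).
  by apply: (subclosed_compact _ cK) => //; apply: closedI; exact: compact_closed.
have cfKL : compact (f @` (K `&` L)).
  apply: continuous_compact => //.
  by apply: continuous_subspaceW cfL => x [].
exists (f @` (K `&` L)); split => //; first by move=> _ [x [/KB ? _] <-].
rewrite /push /pushforward.
have mD : measurable (f @^-1` (B `\` f @` (K `&` L)) : set (borel S)).
  rewrite -[X in measurable X]setTI; apply: mf => //.
  by apply: measurableD => //; exact: compact_borel.
case: fm => m mE; rewrite mE in Ke Le *.
apply: (@le_trans _ _ (m ((f @^-1` B `\` K) `|` ~` L))).
  rewrite le_measure ?inE//.
    by apply: measurableU; [exact: measurableD|exact: measurableC].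
  move=> x /= [Bfx nKL]; have [Kx|nKx] := pselect (K x); last by left.
  by right=> Lx; apply: nKL; exists x.
apply: (le_trans (measureU2 _ _ _)); [exact: measurableD|exact: measurableC|].
by rewrite [e in leRHS]splitr EFinD leeD.
Qed.

Lemma lusin_open S T (D : set S) (mu : setfun S R) (f : S -> T) :
  hausdorff_space S -> radon mu -> open D -> mu (~` D) = 0%E ->
  (forall x, D x -> {for x, continuous f}) -> lusin mu f.
Proof.
move=> hS [fm im] oD D0 cf e e0; have mD := open_borel oD.
have [K [cK KD Ke]] := im _ mD _ e0.
have mK : measurable (K : set (borel S)) by exact: compact_borel.
exists K; split=> //.
  apply/subspace_continuousP => x Kx; apply: cvg_trans (cf _ (KD _ Kx)).
  by apply: cvg_app; exact: cvg_within.
case: fm => m mE; rewrite mE in D0 Ke *.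
apply: (@le_trans _ _ (m ((D `\` K) `|` ~` D))).
  rewrite le_measure ?inE//; first exact: measurableC.
    by apply: measurableU; [exact: measurableD|exact: measurableC].
  by move=> x nKx; have [Dx|nDx] := pselect (D x); [left|right].
apply: (le_trans (measureU2 _ _ _)); [exact: measurableD|exact: measurableC|].
by rewrite -[leRHS]adde0; apply: leeD => //; rewrite -D0.
Qed.

(** The restriction to [D] makes the values of [f] off [D] irrelevant. *)
Lemma push_restr S T (D : set S) (f g : S -> T) (mu : setfun S R) :
  (forall x, D x -> f x = g x) -> push f (restr D mu) = push g (restr D mu).
Proof.
move=> fg; apply/funext => A; rewrite /push /pushforward /restr; congr (mu _).
by apply/seteqP; split=> x /= [Ax Dx]; split=> //; move: Ax; rewrite fg.
Qed.

(** A map made constant off [D]; the restriction to [D] of a measure does not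
  see the difference, and the modified map is Borel if [f] is continuous on the
  open set [D]. *)
Definition const_off S T (D : set S) (f : S -> T) (x : S) : T :=
  if x \in D then f x else point.

Section PushRestr.
Variables (S T : ptopologicalType) (D : set S) (f : S -> T) (mu : setfun S R).
Hypotheses (hS : hausdorff_space S) (rm : radon mu) (oD : open D).
Hypothesis cf : forall x, D x -> {for x, continuous f}.

Let g := const_off D f.

Let fg x : D x -> f x = g x. Proof. by move=> Dx; rewrite /g /const_off mem_set. Qed.

Let cg x : D x -> {for x, continuous g}.
Proof.
move=> Dx; have nD : nbhs x D := open_nbhs_nbhs (conj oD Dx).
move=> A; rewrite -(fg Dx) => /(cf Dx) nA.
by apply: filterS (filterI nD nA) => y [Dy Ay]; rewrite /= -fg.
Qed.

Lemma const_off_borel : measurable_fun [set: borel S] (const_off D f : borel S -> borel T).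
Proof.
apply: (@borel_fun_glue _ _ _ _ (cst point) oD) => //.
by move=> x nDx; rewrite /const_off memNset.
Qed.

Lemma push_restr_const_off :
  push f (restr D mu) = push (const_off D f) (restr D mu).
Proof. exact: push_restr fg. Qed.

Lemma push_restr_radon : hausdorff_space T -> radon (push f (restr D mu)).
Proof.
move=> hT; rewrite push_restr_const_off.
have rD : radon (restr D mu) by apply: restr_radon => //; exact: open_borel.
apply: lusin_radon => //; first exact: const_off_borel.
apply: (lusin_open hS rD oD _ cg).
by rewrite /restr setICl; case: rm => [[m ->] _]; exact: measure0.
Qed.

Lemma push_restr_integral (h : T -> \bar R) :
  measurable_fun [set: borel T] (h : borel T -> \bar R) -> (forall y, 0 <= h y)%E ->
  (\int[push f (restr D mu)]_y h y =
   \int[mu]_x ((\1_D x)%:E * h (const_off D f x)))%E.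
Proof.
move=> mh h0; have fm := radon_finmeas rm; have mD := open_borel oD.
have fr : finmeas (restr D mu) by exact: restr_finmeas.
rewrite push_restr_const_off push_integral//; last exact: const_off_borel.
rewrite restr_integral_ind//; exact: borel_comp mh const_off_borel.
Qed.

End PushRestr.

Lemma lusin_continuous S T (mu : setfun S R) (f : S -> T) :
  hausdorff_space S -> radon mu -> continuous f -> lusin mu f.
Proof.
move=> hS rm cf; apply: (@lusin_open _ _ setT) => //.
- exact: openT.
- by rewrite setCT; case: rm => [[m ->] _]; rewrite measure0.
- by move=> x _; exact: cf.
Qed.

Lemma lusin_pair S T T' (mu : setfun S R) (f : S -> T) (g : S -> T') :
  hausdorff_space S -> radon mu -> lusin mu f -> lusin mu g ->
  lusin mu (fun x => (f x, g x)).
Proof.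
move=> hS [fm im] lf lg e e0; have e20 : 0 < e / 2 by rewrite divr_gt0.
have [K [cK cfK Ke]] := lf _ e20; have [L [cL cfL Le]] := lg _ e20.
have mK : measurable (K : set (borel S)) by exact: compact_borel.
have mL : measurable (L : set (borel S)) by exact: compact_borel.
exists (K `&` L); split.
- by apply: (subclosed_compact _ cK) => //; apply: closedI; exact: compact_closed.
- apply/subspace_continuousP => x [Kx Lx].
  apply: cvg_pair.
    have : {within K `&` L, continuous f} by apply: continuous_subspaceW cfK => y [].
    by move=> /subspace_continuousP; apply.
  have : {within K `&` L, continuous g} by apply: continuous_subspaceW cfL => y [].
  by move=> /subspace_continuousP; apply.
case: fm => m mE; rewrite mE in Ke Le *.
rewrite setCI; apply: (le_trans (measureU2 _ _ _)); [exact: measurableC..|].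
by rewrite [e in leRHS]splitr EFinD leeD.
Qed.

(** The outer map may be discontinuous on a closed set that the image does not
  charge. *)
Lemma lusin_comp S T T' (D : set T) (mu : setfun S R) (f : S -> T) (h : T -> T') :
  hausdorff_space S -> radon mu -> lusin mu f ->
  measurable_fun [set: borel S] (f : borel S -> borel T) ->
  open D -> mu (f @^-1` ~` D) = 0%E ->
  (forall y, D y -> {for y, continuous h}) -> lusin mu (h \o f).
Proof.
move=> hS [fm im] lf mf oD D0 ch e e0; have e20 : 0 < e / 2 by rewrite divr_gt0.
have mfD : measurable (f @^-1` D : set (borel S)).
  by rewrite -[X in measurable X]setTI; apply: mf => //; exact: open_borel.
have [K [cK KD Ke]] := im _ mfD _ e20; have [L [cL cfL Le]] := lf _ e20.
have mK : measurable (K : set (borel S)) by exact: compact_borel.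
have mL : measurable (L : set (borel S)) by exact: compact_borel.
exists (K `&` L); split.
- by apply: (subclosed_compact _ cK) => //; apply: closedI; exact: compact_closed.
- have cf : {within K `&` L, continuous f} by apply: continuous_subspaceW cfL => y [].
  apply/subspace_continuousP => x [Kx Lx].
  move/subspace_continuousP : cf => /(_ x (conj Kx Lx)) fx.
  exact: (cvg_comp _ _ fx (ch _ (KD _ Kx))).
case: fm => m mE; rewrite mE in D0 Ke Le *.
apply: (@le_trans _ _ (m ((f @^-1` D `\` K) `|` (f @^-1` (~` D) `|` ~` L)))).
  rewrite le_measure ?inE//; first by apply: measurableC; exact: measurableI.
    apply: measurableU; first exact: measurableD.
    by apply: measurableU; [rewrite preimage_setC|]; exact: measurableC.
  move=> x /= /not_andP[nKx|nLx]; last by right; right.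
  by have [Dx|nDx] := pselect (D (f x)); [left|right; left].
apply: (le_trans (measureU2 _ _ _)); [exact: measurableD| |].
  by apply: measurableU; [rewrite preimage_setC|]; exact: measurableC.
rewrite [e in leRHS]splitr EFinD leeD//.
apply: (le_trans (measureU2 _ _ _)); [rewrite preimage_setC| |];
  try exact: measurableC.
by rewrite -[leRHS]add0e; apply: leeD => //; rewrite -D0.
Qed.

(** Lusin's theorem. For each interval of the base, both its preimage and the
  complement are approximated by compact sets up to [e / 2 ^ n.+1]; on the
  intersection of the unions of these two compact sets, [f] is continuous. *)
Lemma lusin_real S (mu : setfun S R) (f : S -> R) : hausdorff_space S ->
  radon mu -> measurable_fun [set: borel S] (f : borel S -> R) ->
  lusin mu f.
Proof.
move=> hS [fm im] mf e e0.
pose A n : set (borel S) := f @^-1` (@rat_itv R n).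
have mA n : measurable (A n).
  by rewrite -[X in measurable X]setTI; apply: mf => //; exact: rat_itv_measurable.
pose ep n : R := e / (2 ^ n.+1)%:R.
have ep0 n : 0 < ep n / 2 by rewrite !divr_gt0// ltr0n expn_gt0.
have /choice[K KP] n : exists K : set S,
    [/\ compact K, K `<=` A n & (mu (A n `\` K) <= (ep n / 2)%:E)%E] by exact: im.
have /choice[L LP] n : exists K : set S,
    [/\ compact K, K `<=` ~` A n & (mu (~` A n `\` K) <= (ep n / 2)%:E)%E].
  by apply: im => //; exact: measurableC.
have mK n : measurable (K n : set (borel S)) by apply: compact_borel; have [] := KP n.
have mL n : measurable (L n : set (borel S)) by apply: compact_borel; have [] := LP n.
have cKL n : compact (K n `|` L n) by apply: compactU; [have [] := KP n|have [] := LP n].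
pose C := \bigcap_n (K n `|` L n).
have clC : closed C by apply: closed_bigI => n _; exact: compact_closed.
exists C; split.
- by apply: (subclosed_compact clC (cKL 0%N)) => x /(_ 0%N I).
- apply/subspace_continuousP => x Cx V nV.
  have [n [xn nV']] := rat_itv_basis nV.
  have oL : open (~` L n) by apply: closed_openC; apply: compact_closed => //; have [] := LP n.
  have nLx : (~` L n) x by move=> Lx; have [_ /(_ _ Lx) + _] := LP n; apply.
  rewrite /= nbhs_simpl /within /=.
  have : nbhs x (~` L n) by exact: open_nbhs_nbhs (conj oL nLx).
  apply: filterS => y nLy Cy; apply: nV'.
  by have [Ky|//] := Cy n I; have [_ /(_ _ Ky) + _] := KP n.
case: fm => m mE.
have mC n : measurable (~` (K n `|` L n) : set (borel S)).
  by apply: measurableC; exact: measurableU.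
rewrite mE /C setC_bigcap; apply: (@le_trans _ _ (\sum_(n <oo) m (~` (K n `|` L n)))%E).
  by apply: measure_sigma_subadditive => //; exact: bigcup_measurable.
apply: (le_trans _ (epsilon_trick0 xpredT (ltW e0))).
apply: lee_nneseries => [n _ _|n _]; first exact: measure_ge0.
rewrite (@le_trans _ _ (m ((A n `\` K n) `|` (~` A n `\` L n))))//.
  rewrite le_measure ?inE//.
    by apply: measurableU; apply: measurableD => //; exact: measurableC.
  move=> x /= /not_orP[nKx nLx].
  by have [Ax|nAx] := pselect (A n x); [left|right].
apply: (le_trans (measureU2 _ _ _)); try (apply: measurableD => //; exact: measurableC).
have [_ _] := KP n; have [_ _] := LP n; rewrite mE => hL hK.
by rewrite [X in X%:E]splitr EFinD leeD.
Qed.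

End Radon.

(** * Topology of the cone *)

Section ConeTopology.
Context {R : realType} {X : ptopologicalType}.
Hypothesis hX : hausdorff_space X.
Local Notation Y := (Yspace R X).
Local Notation C := (cone R X).

Lemma hval_ge0 (r : halfline R) : 0 <= hval r.
Proof. by rewrite /hval. Qed.

Lemma hval_inj : injective (@hval R).
Proof. by move=> r s rs; apply: (@val_inj _ _ {nonneg R}). Qed.

Lemma cvg_halfline (T : topologicalType) (f : T -> halfline R) (x : T) :
  {for x, continuous (@hval R \o f)} -> {for x, continuous f}.
Proof.
move=> cf A [_ [[B oB <-] Bfx BA]].
have nB : nbhs (hval (f x)) B := open_nbhs_nbhs (conj oB Bfx).
have h : nbhs x ((@hval R \o f) @^-1` B) := cf _ nB.
change (nbhs x (f @^-1` A)); move: h.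
by apply: filterS => y; exact: BA.
Qed.

Lemma halfline_hausdorff : hausdorff_space (halfline R).
Proof.
move=> p q pq; apply: hval_inj; apply: (@Rhausdorff R).
by apply: cluster_map pq; exact: hval_continuous.
Qed.

Lemma Y_hausdorff : hausdorff_space Y.
Proof. by apply: hausdorff_prod => //; exact: halfline_hausdorff. Qed.

Lemma cone_r_ge0 (c : C) : 0 <= cone_r c.
Proof. exact: hval_ge0. Qed.

Lemma cone_r_vertex : cone_r (vertex R X) = 0.
Proof. by rewrite cone_r_proj. Qed.

Lemma cone_projK (c : C) : cone_proj (cone_repr c) = c.
Proof. by rewrite /cone_proj /cone_repr reprK. Qed.

Lemma cone_yK : cancel (@cone_y R X) (@cone_proj R X).
Proof.
move=> c; rewrite -[RHS]cone_projK; apply/cone_proj_eq.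
rewrite /cone_y /cone_x; case: ifPn => [r0|]; first by left; case: (cone_repr c).
by rewrite -leNgt => r0; right; split; apply/eqP; rewrite eq_le hval_ge0 andbT.
Qed.

Lemma cone_y_proj (y : Y) : 0 < hval y.2 -> cone_y (cone_proj y) = y.
Proof.
move=> y0; rewrite [RHS]surjective_pairing /cone_y cone_x_proj//; congr (_, _).
by apply: hval_inj; rewrite -[LHS]/(cone_r _) cone_r_proj.
Qed.

Lemma cone_r_eq0 (c : C) : cone_r c = 0 <-> c = vertex R X.
Proof.
split=> [r0|->]; last exact: cone_r_vertex.
rewrite -(cone_projK c); apply/cone_proj_eq; right; split => //.
Qed.

Lemma cone_r_gt0 (c : C) : 0 < cone_r c <-> c <> vertex R X.
Proof.
rewrite lt_neqAle eq_sym cone_r_ge0 andbT; split.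
  by move=> /eqP r0 cv; apply: r0; exact/cone_r_eq0.
by move=> cv; apply/eqP => r0; apply: cv; exact/cone_r_eq0.
Qed.

(** Near the vertex, an open set contains a ball of the radius function. *)
Lemma cone_proj_continuous : continuous (@cone_proj R X).
Proof.
apply/continuousP => U; rewrite cone_openE => -[oU vU].
have [Uv|nUv] := pselect (U (vertex R X)).
  have [e e0 eU] := vU Uv.
  rewrite (_ : _ @^-1` U = [set y : Y | 0 < hval y.2 /\ U (cone_proj y)]
      `|` (@hval R \o snd) @^-1` [set x | x < e]).
    apply: openU => //; apply: open_comp; last exact: open_lt.
    move=> y _; apply: continuous_comp; first exact: cvg_snd.
    exact: hval_continuous.
  apply/seteqP; split=> y /=; last first.
    by case=> [[]//|ye]; apply: eU; rewrite /= cone_r_proj.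
  move=> Uy; have [y0|] := ltP 0 (hval y.2); first by left.
  by move=> y0; right; rewrite (le_lt_trans y0).
rewrite (_ : _ @^-1` U = [set y : Y | 0 < hval y.2 /\ U (cone_proj y)])//.
apply/seteqP; split=> y /=; last by case.
move=> Uy; split => //; rewrite lt_neqAle eq_sym hval_ge0 andbT.
apply/eqP => y0; apply: nUv; rewrite (_ : vertex R X = cone_proj y)//.
by apply/cone_proj_eq; right.
Qed.

Lemma cone_r_continuous : continuous (@cone_r R X).
Proof.
apply/continuousP => U oU; rewrite cone_openE; split.
  rewrite (_ : [set y | _] = [set y : Y | 0 < hval y.2]
      `&` (@hval R \o snd) @^-1` U).
    apply: openI; first exact: open_hval_gt0.
    apply: open_comp => // y _; apply: continuous_comp; first exact: cvg_snd.
    exact: hval_continuous.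
  by apply/seteqP; split=> y /= []; rewrite cone_r_proj.
rewrite /= cone_r_vertex => U0.
have /nbhs_ballP[e /= e0 eU] : nbhs 0 U := open_nbhs_nbhs (conj oU U0).
exists e => // c ce; apply: eU; rewrite /ball /= sub0r normrN.
by rewrite ger0_norm// cone_r_ge0.
Qed.

Lemma cone_y_continuous (c : C) : c <> vertex R X ->
  {for c, continuous (@cone_y R X)}.
Proof.
move=> cv A nA; have r0 : 0 < cone_r c by exact/cone_r_gt0.
move: nA; rewrite nbhsE => -[B [oB Bc] BA].
pose U : set C := [set c | 0 < cone_r c /\ B (cone_y c)].
have oU : open U.
  rewrite cone_openE; split; last by rewrite /U /= cone_r_vertex ltxx => -[].
  rewrite (_ : [set y | _] = [set y : Y | 0 < hval y.2] `&` B).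
    by apply: openI => //; exact: open_hval_gt0.
  apply/seteqP; split=> y /=; rewrite /U /= cone_r_proj.
    by move=> [y0 []]; rewrite cone_y_proj.
  by move=> [y0 By]; rewrite cone_y_proj.
have nU : nbhs c U := open_nbhs_nbhs (conj oU (conj r0 Bc)).
by apply: filterS nU => z [_ Bz]; exact: BA.
Qed.

Lemma cone_x_continuous (c : C) : c <> vertex R X ->
  {for c, continuous (@cone_x R X)}.
Proof.
move=> cv; have := cone_y_continuous cv => cy.
exact: (continuous_comp cy (@cvg_fst _ _ _ _ _)).
Qed.

(** Distinct cone points are separated by the radius, or, if the radii agree, by
  their coordinates, which are continuous off the vertex. *)
Lemma cone_hausdorff : hausdorff_space C.
Proof.
move=> p q pq.
have rpq : cone_r p = cone_r q.
  by apply: (@Rhausdorff R); apply: cluster_map pq; exact: cone_r_continuous.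
have [p0|p0] := pselect (p = vertex R X).
  by rewrite p0; apply/esym/cone_r_eq0; rewrite -rpq p0 cone_r_vertex.
have q0 : q <> vertex R X.
  by move=> q0; apply: p0; apply/cone_r_eq0; rewrite rpq q0 cone_r_vertex.
rewrite -(cone_yK p) -(cone_yK q); congr cone_proj; apply: Y_hausdorff.
by apply: cluster_map pq; exact: cone_y_continuous.
Qed.

Lemma open_off_vertex : open [set c : C | c <> vertex R X].
Proof.
rewrite (_ : [set _ | _] = @cone_r R X @^-1` [set x | 0 < x]).
  by apply: open_comp; [move=> x _; exact: cone_r_continuous|exact: open_gt].
by apply/seteqP; split=> c /=; rewrite cone_r_gt0.
Qed.

Lemma open_offvertex2 : open (@offvertex2 R X).
Proof.
rewrite (_ : @offvertex2 R X = fst @^-1` [set c | c <> vertex R X]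
    `&` snd @^-1` [set c | c <> vertex R X])//.
apply: openI; (apply: open_comp; last exact: open_off_vertex) => z _.
  exact: cvg_fst.
exact: cvg_snd.
Qed.

Lemma cone_y2_continuous (z : C * C) : offvertex2 z ->
  {for z, continuous (@cone_y2 R X)}.
Proof.
move=> [z10 z20]; apply: continuous_pair.
  exact: (continuous_comp (@continuous_fst _ _ z) (cone_y_continuous z10)).
exact: (continuous_comp (@continuous_snd _ _ z) (cone_y_continuous z20)).
Qed.

Lemma cone_x_borel : measurable_fun [set: borel C] (@cone_x R X : borel C -> borel X).
Proof.
apply: (@borel_fun_glue C X _ _ (cst (cone_x (vertex R X))) open_off_vertex).
- by move=> c; exact: cone_x_continuous.
- exact: measurable_cst.
- by move=> c /contrapT ->.
Qed.

Lemma cone_x2_continuous (z : C * C) : offvertex2 z ->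
  {for z, continuous (@cone_x2 R X)}.
Proof.
move=> [z10 z20]; apply: continuous_pair.
  exact: (continuous_comp (@continuous_fst _ _ z) (cone_x_continuous z10)).
exact: (continuous_comp (@continuous_snd _ _ z) (cone_x_continuous z20)).
Qed.

(** Where one of the cone points is the vertex, one of the two projections is
  constant, so the map is Borel there, as a pair of a Borel map and a constant. *)
Lemma cone_x2_borel : measurable_fun [set: borel (C * C)%type]
  (@cone_x2 R X : borel (C * C)%type -> borel (X * X)%type).
Proof.
pose x0 := cone_x (vertex R X).
pose D1 : set (C * C) := [set z | z.1 <> vertex R X].
have oD1 : open D1.
  apply: (@open_comp _ _ fst _ _ open_off_vertex) => z _; exact: cvg_fst.
have m1 : measurable_fun [set: borel (C * C)%type]
    ((fun z => (x0, cone_x z.2)) : borel (C * C)%type -> borel (X * X)%type).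
  apply: (@borel_comp _ X _ (borel (X * X)%type) _ _ (@borel_pair_cstl X X x0)).
  exact: borel_comp cone_x_borel (@borel_snd C C).
have m2 : measurable_fun [set: borel (C * C)%type]
    ((fun z => (cone_x z.1, x0)) : borel (C * C)%type -> borel (X * X)%type).
  apply: (@borel_comp _ X _ (borel (X * X)%type) _ _ (@borel_pair_cstr X X x0)).
  exact: borel_comp cone_x_borel (@borel_fst C C).
pose g z : X * X := if z \in D1 then (cone_x z.1, x0) else (x0, cone_x z.2).
apply: (@borel_fun_glue _ _ _ _ g open_offvertex2).
- by move=> z; exact: cone_x2_continuous.
- apply: borel_fun_open => U oU; have mD1 := open_borel oD1.
  rewrite (_ : g @^-1` U =
      (D1 `&` (fun z => (cone_x z.1, x0)) @^-1` U) `|`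
      (~` D1 `&` (fun z => (x0, cone_x z.2)) @^-1` U)).
    apply: measurableU; apply: measurableI => //.
    - exact: (borel_preimage_open m2 oU).
    - exact: measurableC.
    - exact: (borel_preimage_open m1 oU).
  apply/seteqP; split=> z; rewrite /g /=.
    by case: ifPn => [/set_mem|/negP zD]; [left|right; split=> // /mem_set].
  by case=> -[zD]; [rewrite mem_set|rewrite memNset].
- move=> [z1 z2] /not_andP[/contrapT /= z10|/contrapT /= z20].
    by rewrite /g memNset /D1 /cone_x2 /= ?z10//; apply.
  rewrite /g /cone_x2 /=; case: ifPn => [_|/negP nz]; first by rewrite z20.
  by rewrite (_ : z1 = vertex R X)//; apply: contrapT => z1v; apply: nz; rewrite mem_set.
Qed.

End ConeTopology.

(** * Borel maps into pairs of cone points *)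

Lemma measurable_invr (R : realType) :
  measurable_fun [set: R] (fun x : R => x^-1).
Proof.
have m0 : measurable ([set 0] : set R) by exact: measurable_set1.
rewrite -(setUv [set (0 : R)]).
apply/(measurable_funU _ m0 (measurableC m0)); split.
  apply: (@eq_measurable_fun _ _ R R [set 0] (cst 0)) => //.
  by move=> x /set_mem ->; rewrite invr0.
apply: open_continuous_measurable_fun.
  apply: closed_openC; apply: accessible_closed_set1.
  exact/hausdorff_accessible/Rhausdorff.
by move=> x /set_mem /= /eqP x0; exact: inv_continuous.
Qed.

Section ConeMaps.
Context {R : realType} {X : ptopologicalType}.
Local Notation C := (cone R X).

Definition nneg (x : R) : halfline R := (`|x|%:nng : {nonneg R}).

Lemma hval_nneg (x : R) : hval (nneg x) = `|x|.
Proof. by []. Qed.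

Lemma nneg_continuous : continuous nneg.
Proof. by move=> x; apply: cvg_halfline; exact: norm_continuous. Qed.

(** The coordinates are continuous here, the absolute value making the radii
  admissible. Dilations and lifts are compositions of this map with maps into
  [X * X], continuous off a null set, and real Borel functions; so both preserve
  Radon measures. *)
Definition cone2_map (z : (X * X) * R * R) : C * C :=
  (cone_proj (z.1.1.1, nneg z.1.2), cone_proj (z.1.1.2, nneg z.2)).

Lemma continuous_scaled (T : topologicalType) (x : T -> X) (r : T -> R) (z : T) :
  {for z, continuous x} -> {for z, continuous r} ->
  {for z, continuous (fun z => cone_proj (x z, nneg (r z)) : C)}.
Proof.
move=> cx cr; have cn : {for z, continuous (nneg \o r)}.
  by apply: continuous_comp cr _; exact: nneg_continuous.
have cp := continuous_pair cx cn.
by apply: continuous_comp cp _; exact: cone_proj_continuous.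
Qed.

Lemma cone2_map_continuous : continuous cone2_map.
Proof.
move=> z.
have c0 : {for z, continuous (fun z : (X * X) * R * R => z.1.2)}.
  exact: (continuous_comp (@continuous_fst _ _ z) (@continuous_snd _ _ z.1)).
have c1 : {for z, continuous (fun z : (X * X) * R * R => z.1.1)}.
  exact: (continuous_comp (@continuous_fst _ _ z) (@continuous_fst _ _ z.1)).
apply: (@continuous_pair _ _ _
  (fun z : (X * X) * R * R => cone_proj (z.1.1.1, nneg z.1.2))
  (fun z : (X * X) * R * R => cone_proj (z.1.1.2, nneg z.2))).
- apply: continuous_scaled => //.
  exact: (continuous_comp c1 (@continuous_fst _ _ _)).
- apply: continuous_scaled; last exact: continuous_snd.
  exact: (continuous_comp c1 (@continuous_snd _ _ _)).
Qed.

Section Cone2Map.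
Hypothesis hX : hausdorff_space X.
Context {Z : ptopologicalType}.
Variables (p : Z -> X * X) (s1 s2 : Z -> R).
Hypothesis mp : measurable_fun [set: borel Z] (p : borel Z -> borel (X * X)%type).
Hypothesis ms1 : measurable_fun [set: borel Z] (s1 : borel Z -> R).
Hypothesis ms2 : measurable_fun [set: borel Z] (s2 : borel Z -> R).

Let mf : measurable_fun [set: borel Z]
  ((fun z => (p z, s1 z, s2 z)) : borel Z -> borel ((X * X) * R * R)%type).
Proof. by apply: borel_pair_real => //; exact: borel_pair_real. Qed.

Lemma cone2_map_borel : measurable_fun [set: borel Z]
  ((fun z => cone2_map (p z, s1 z, s2 z)) : borel Z -> borel (C * C)%type).
Proof.
apply: (@borel_comp Z ((X * X) * R * R)%type _ (borel (C * C)%type) cone2_map) => //.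
apply: continuous_borel; exact: cone2_map_continuous.
Qed.

Lemma cone2_map_radon (a : setfun Z R) : hausdorff_space Z ->
  radon a -> lusin a p -> radon (push (fun z => cone2_map (p z, s1 z, s2 z)) a).
Proof.
move=> hZ ra lp; apply: lusin_radon => //.
- by apply: hausdorff_prod; exact: cone_hausdorff.
- exact: cone2_map_borel.
apply: (@lusin_comp _ Z ((X * X) * R * R)%type (C * C)%type setT a
  (fun z => (p z, s1 z, s2 z)) cone2_map hZ ra).
- apply: lusin_pair => //; last exact: lusin_real.
  by apply: lusin_pair => //; exact: lusin_real.
- exact: mf.
- exact: openT.
- by rewrite setCT preimage_set0; case: ra => [[m ->] _]; exact: measure0.
- by move=> z _; exact: cone2_map_continuous.
Qed.

End Cone2Map.

Lemma sqrt_liftE (rho1 rho2 : X -> R) :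
  sqrt_lift rho1 rho2 =
  (fun p => cone2_map (p, Num.sqrt (rho1 p.1), Num.sqrt (rho2 p.2))).
Proof.
apply/funext => p; rewrite /sqrt_lift /cone2_map /=.
congr (cone_proj (_, _), cone_proj (_, _));
  by apply: hval_inj; rewrite hval_nneg ger0_norm// sqrtr_ge0.
Qed.

Lemma prdE (theta : C * C -> {nonneg R}) :
  prd theta = (fun z => cone2_map (cone_x2 z,
    cone_r z.1 * ((theta z)%:num)^-1, cone_r z.2 * ((theta z)%:num)^-1)).
Proof.
apply/funext => z; rewrite /prd /cone2_map /=.
congr (cone_proj (_, _), cone_proj (_, _));
  by apply: hval_inj; rewrite hval_nneg ger0_norm// divr_ge0// hval_ge0.
Qed.

Lemma cone_r1_borel :
  measurable_fun [set: borel (C * C)%type] ((fun z => cone_r z.1) : borel (C * C)%type -> R).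
Proof.
exact: (borel_comp (continuous_real (@cone_r_continuous R X)) (@borel_fst C C)).
Qed.

Lemma cone_r2_borel :
  measurable_fun [set: borel (C * C)%type] ((fun z => cone_r z.2) : borel (C * C)%type -> R).
Proof.
exact: (borel_comp (continuous_real (@cone_r_continuous R X)) (@borel_snd C C)).
Qed.

Section Applications.
Hypothesis hX : hausdorff_space X.

Section Prd.
Variable theta : C * C -> {nonneg R}.
Hypothesis mt : measurable_fun [set: borel (C * C)%type]
    ((fun z => (theta z)%:num) : borel (C * C)%type -> R).

Let ms1 : measurable_fun [set: borel (C * C)%type]
  ((fun z => cone_r z.1 * ((theta z)%:num)^-1) : borel (C * C)%type -> R).
Proof.
apply: measurable_funM; first exact: cone_r1_borel.
exact: measurableT_comp (@measurable_invr R) mt.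
Qed.

Let ms2 : measurable_fun [set: borel (C * C)%type]
  ((fun z => cone_r z.2 * ((theta z)%:num)^-1) : borel (C * C)%type -> R).
Proof.
apply: measurable_funM; first exact: cone_r2_borel.
exact: measurableT_comp (@measurable_invr R) mt.
Qed.

Lemma prd_borel : measurable_fun [set: borel (C * C)%type]
    (prd theta : borel (C * C)%type -> borel (C * C)%type).
Proof. by rewrite prdE; exact: (cone2_map_borel cone_x2_borel ms1 ms2). Qed.

Lemma prd_radon (a : setfun (C * C)%type R) :
  radon a -> a (~` @offvertex2 R X) = 0%E -> radon (push (prd theta) a).
Proof.
move=> ra a0; have hCC : hausdorff_space (C * C)%type.
  by apply: hausdorff_prod; exact: cone_hausdorff.
rewrite prdE; apply: (cone2_map_radon hX cone_x2_borel ms1 ms2 hCC ra).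
by apply: (lusin_open hCC ra open_offvertex2 a0) => z; exact: cone_x2_continuous.
Qed.

End Prd.

Section SqrtLift.
Variables (rho1 rho2 : X -> R).
Hypotheses (b1 : borel_nonneg rho1) (b2 : borel_nonneg rho2).

Let ms1 : measurable_fun [set: borel (X * X)%type]
  ((fun p => Num.sqrt (rho1 p.1)) : borel (X * X)%type -> R).
Proof.
apply: measurableT_comp.
  exact: continuous_measurable_fun (@sqrt_continuous R).
by case: b1 => m _; exact: borel_comp m (@borel_fst X X).
Qed.

Let ms2 : measurable_fun [set: borel (X * X)%type]
  ((fun p => Num.sqrt (rho2 p.2)) : borel (X * X)%type -> R).
Proof.
apply: measurableT_comp.
  exact: continuous_measurable_fun (@sqrt_continuous R).
by case: b2 => m _; exact: borel_comp m (@borel_snd X X).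
Qed.

Lemma sqrt_lift_borel : measurable_fun [set: borel (X * X)%type]
    (sqrt_lift rho1 rho2 : borel (X * X)%type -> borel (C * C)%type).
Proof.
by rewrite sqrt_liftE; exact: (cone2_map_borel (@measurable_id _ _ setT) ms1 ms2).
Qed.

Lemma sqrt_lift_radon (g : setfun (X * X)%type R) :
  radon g -> radon (push (sqrt_lift rho1 rho2) g).
Proof.
move=> rg; have hXX := hausdorff_prod hX hX.
rewrite sqrt_liftE.
apply: (cone2_map_radon hX (@measurable_id _ _ setT) ms1 ms2 hXX rg).
by apply: lusin_continuous => // x; exact: cvg_id.
Qed.

End SqrtLift.
End Applications.
End ConeMaps.

(** * Almost everywhere inequalities and homogeneous marginals *)

Section AlmostEverywhere.
Context {R : realType} {T : ptopologicalType}.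
Implicit Types (mu : setfun T R) (f g : T -> \bar R).
Local Open Scope ereal_scope.

Lemma finmeas_ae mu : finmeas mu -> Filter (almost_everywhere mu).
Proof. by move=> [m ->]; exact: ae_filter_ringOfSetsType. Qed.

Lemma ae_le_integral mu f g : finmeas mu ->
  measurable_fun [set: borel T] (f : borel T -> \bar R) ->
  measurable_fun [set: borel T] (g : borel T -> \bar R) ->
  (forall x, 0 <= f x) -> (forall x, 0 <= g x) ->
  {ae mu, forall x, f x <= g x} -> \int[mu]_x f x <= \int[mu]_x g x.
Proof.
move=> fm mf mg f0 g0 fg; have FF := finmeas_ae fm.
case: fm FF fg => m -> FF fg; apply: ae_ge0_le_integral => //.
by apply: filterS fg => x fgx _.
Qed.

(** The form in which all equality cases are used: a pointwise inequality whose
  integrals agree and are finite is an equality almost everywhere. *)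
Lemma ae_eq_of_integral_le mu f g : finmeas mu ->
  measurable_fun [set: borel T] (f : borel T -> \bar R) ->
  measurable_fun [set: borel T] (g : borel T -> \bar R) ->
  (forall x, 0 <= f x) -> (forall x, 0 <= g x) ->
  {ae mu, forall x, f x <= g x} ->
  \int[mu]_x g x <= \int[mu]_x f x -> \int[mu]_x f x < +oo ->
  {ae mu, forall x, f x = g x}.
Proof.
move=> fm mf mg f0 g0 fg gf foo; have FF := finmeas_ae fm.
case: fm FF fg gf foo => m -> FF fg gf foo.
have fi : m.-integrable [set: borel T] f.
  apply/integrableP; split=> //.
  by under eq_integral do rewrite gee0_abs//.
have goo : \int[m]_x g x < +oo by exact: le_lt_trans foo.
have gi : m.-integrable [set: borel T] g.
  apply/integrableP; split=> //.
  by under eq_integral do rewrite gee0_abs//.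
have le E : measurable E -> \int[m]_(x in E) f x <= \int[m]_(x in E) g x.
  move=> mE; apply: ae_ge0_le_integral => //; try exact: measurable_funTS.
  by apply: filterS fg => x fgx _.
suff : ae_eq m setT f g by apply: filterS => x; apply.
apply: integral_ae_eq => // E _ mE; apply/eqP; rewrite eq_le le//=.
have split_ h : measurable_fun [set: borel T] h -> (forall x, 0 <= h x) ->
    \int[m]_x h x = \int[m]_(x in E) h x + \int[m]_(x in ~` E) h x.
  move=> mh h0; rewrite -(setUv E) ge0_integral_setU//.
  - exact: measurableC.
  - by rewrite setUv.
  - by apply/disj_set2P; rewrite setICr.
move: gf; rewrite (split_ f)// (split_ g)// => gf.
have fin h F : m.-integrable [set: borel T] h -> measurable F ->
    \int[m]_(x in F) h x \is a fin_num.
  move=> hi mF; apply: integrable_fin_num => //.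
  exact: (integrableS measurableT).
have mC := measurableC mE.
have leC := le _ mC; move: gf leC.
have fE := fin f E fi mE; have fC := fin f _ fi mC.
have gE := fin g E gi mE; have gC := fin g _ gi mC.
rewrite -(fineK fE) -(fineK fC) -(fineK gE) -(fineK gC).
rewrite -!EFinD !lee_fin; lra.
Qed.

Lemma null_integral mu f : finmeas mu ->
  measurable_fun [set: borel T] (f : borel T -> \bar R) ->
  (forall x, 0 <= f x) -> \int[mu]_x f x = 0 ->
  mu [set x | f x != 0] = 0.
Proof.
move=> fm mf f0 i0.
have i00 : \int[mu]_x cst 0 x = 0 by case: fm => m ->; exact: integral0.
have : {ae mu, forall x, cst 0 x = f x}.
  apply: ae_eq_of_integral_le => //.
  - case: fm => m ->; apply: aeW => x; exact: f0.
  - by rewrite i0 i00.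
  - by rewrite i00.
case: fm => m -> ae.
have mS : measurable ([set x | f x != 0] : set (borel T)).
  by rewrite -[X in measurable X]setTI; exact: measurable_neqe.
apply/negligibleP => //; apply: negligibleS ae => x /= fx0 fx.
by rewrite -fx eqxx in fx0.
Qed.

End AlmostEverywhere.

(** The integral is taken against a set function that need not be a measure. *)
Lemma eq_integralT (R : realType) (T : ptopologicalType) (mu : setfun T R)
    (f g : T -> \bar R) : f =1 g -> (\int[mu]_x f x = \int[mu]_x g x)%E.
Proof. by move=> /funext ->. Qed.

Section HomogeneousMarginals.
Context {R : realType} {X Z : ptopologicalType}.
Variables (x : Z -> X) (r : Z -> R).
Hypothesis mx : measurable_fun [set: borel Z] (x : borel Z -> borel X).
Hypothesis mr : measurable_fun [set: borel Z] (r : borel Z -> R).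
Local Open Scope ereal_scope.

Let br : borel_nonneg (fun z => (r z ^+ 2)%R).
Proof. by split=> [|z]; [exact: measurable_funX|exact: sqr_ge0]. Qed.

Lemma hmarg_finmeas (a : setfun Z R) : finmeas a ->
  \int[a]_z ((r z ^+ 2)%R)%:E < +oo -> finmeas (hmarg x r a).
Proof. by move=> fa aoo; apply: push_finmeas => //; exact: weight_finmeas. Qed.

Lemma hmarg_integral (a : setfun Z R) (g : X -> \bar R) : finmeas a ->
  \int[a]_z ((r z ^+ 2)%R)%:E < +oo ->
  measurable_fun [set: borel X] (g : borel X -> \bar R) -> (forall p, 0 <= g p) ->
  \int[hmarg x r a]_p g p = \int[a]_z (((r z ^+ 2)%R)%:E * g (x z)).
Proof.
move=> fa aoo mg g0; rewrite push_integral//; last exact: weight_finmeas.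
by rewrite weight_integral//; exact: borel_comp mg mx.
Qed.

Lemma hmargE (a : setfun Z R) (A : set (borel X)) : finmeas a ->
  \int[a]_z ((r z ^+ 2)%R)%:E < +oo -> measurable A ->
  hmarg x r a A = \int[a]_z ((r z ^+ 2 * \1_A (x z))%R)%:E.
Proof.
move=> fa aoo mA; rewrite (eq_integralT _ (fun z => EFinM _ _)).
rewrite -(hmarg_integral (g := fun p => (\1_A p)%:E))//.
- have [m ->] := hmarg_finmeas fa aoo.
  by rewrite integral_indic// setIT.
- by apply/measurable_EFinP; exact: measurable_indic.
Qed.

Lemma hmargT (a : setfun Z R) : hmarg x r a setT = \int[a]_z ((r z ^+ 2)%R)%:E.
Proof. by []. Qed.

(** If [A] is null for [mu], then [r ^ 2] vanishes almost everywhere on the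
  preimage of [A]. *)
Lemma hmarg_dominates (b : setfun Z R) (mu : setfun X R) : finmeas b -> finmeas mu ->
  \int[b]_z ((r z ^+ 2)%R)%:E < +oo -> {ae b, forall z, r z != 0%R} ->
  le_meas (hmarg x r b) mu -> push x b `<< mu.
Proof.
move=> fb fmu boo rn0 h; case: fmu h => m -> h.
apply/null_content_dominatesP => A mA mA0.
pose f z := ((r z ^+ 2 * \1_A (x z))%R)%:E.
have mf : measurable_fun [set: borel Z] (f : borel Z -> \bar R).
  apply/measurable_EFinP; apply: measurable_funM; first exact: measurable_funX.
  exact: (@borel_comp _ _ _ _ (\1_A : X -> R)).
have f0 z : 0 <= f z by rewrite lee_fin mulr_ge0// sqr_ge0.
have : \int[b]_z f z = 0.
  apply/eqP; rewrite eq_le -(hmargE fb boo mA) -{1}mA0 (h A mA) /=.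
  exact: finmeas_ge0 (hmarg_finmeas fb boo).
move=> /(null_integral fb mf f0) bf0.
have mxA : measurable (x @^-1` A : set (borel Z)).
  by rewrite -[X in measurable X]setTI; exact: mx.
have mS : measurable ([set z | f z != 0] : set (borel Z)).
  by rewrite -[X in measurable X]setTI; exact: measurable_neqe.
rewrite /push /pushforward; case: fb rn0 bf0 => n -> rn0 n0.
apply/negligibleP => //.
have nS : n.-negligible [set z | f z != 0] by apply/negligibleP.
apply: negligibleS (negligibleU rn0 nS) => z Axz.
have [rz|rz] := boolP (r z != 0%R); last by left; apply/negP.
by right; rewrite /= /f indicE mem_set// mulr1 eqe sqrf_eq0.
Qed.

End HomogeneousMarginals.

(** * Truncated cosines and the cross term *)

Lemma measurable_ltr (R : realType) d (T : measurableType d) (f g : T -> R) :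
  measurable_fun setT f -> measurable_fun setT g ->
  measurable [set x | f x < g x].
Proof.
move=> mf mg; have h := measurable_fun_ltr mf mg.
rewrite (_ : [set _ | _] = setT `&` (fun x => f x < g x) @^-1` [set true]) ?setTI//.
by rewrite -[X in measurable X]setTI; exact: h.
Qed.

Section Distance.
Context {R : realType} {X : ptopologicalType}.
Variable d : X -> X -> \bar R.
Hypothesis hd : extended_metric_topological d.
Local Notation C := (cone R X).

Lemma emt_hausdorff : hausdorff_space X. Proof. by case: hd. Qed.

Lemma dist_ge0 x y : (0 <= d x y)%E. Proof. by case: hd => _ [+ _ _ _] _; apply. Qed.

Definition cosd (a : R) (p : X * X) : R := cos (trunc_dist d a p.1 p.2).

Lemma dist_borel : measurable_fun [set: borel (X * X)%type]
  ((fun p => d p.1 p.2) : borel (X * X)%type -> \bar R).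
Proof.
apply: (measurability _ (ErealGenOInfty.measurableE R)).
move=> /= _ [_ [a ->]] <-; rewrite setTI; apply: open_borel.
rewrite preimage_itvoy; case: hd => _ _ /lower_semicontinuousP; exact.
Qed.

Lemma cosd_borel (a : R) : measurable_fun [set: borel (X * X)%type]
  (cosd a : borel (X * X)%type -> R).
Proof.
apply: measurableT_comp; first exact: continuous_measurable_fun (@continuous_cos R).
apply: (measurableT_comp (fine_measurable _)) => //.
by apply: measurable_mine => //; exact: dist_borel.
Qed.

Lemma trunc_dist_lt (a : R) x y : (d x y < a%:E)%E ->
  trunc_dist d a x y = fine (d x y) /\ 0 <= fine (d x y) < a.
Proof.
move=> da; rewrite /trunc_dist min_l ?(ltW da)//; split => //.
have d0 := dist_ge0 x y.
have df : d x y \is a fin_num by rewrite ge0_fin_numE// (lt_trans da)// ltry.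
by rewrite -lee_fin -lte_fin fineK// d0 da.
Qed.

Lemma trunc_dist_ge (a : R) x y : (a%:E <= d x y)%E -> trunc_dist d a x y = a.
Proof. by move=> da; rewrite /trunc_dist min_r. Qed.

Lemma trunc_dist_itv (a : R) x y : 0 <= a -> 0 <= trunc_dist d a x y <= a.
Proof.
move=> a0; have [da|da] := ltP (d x y) a%:E.
  by have [-> /andP[-> /ltW ->]] := trunc_dist_lt da.
by rewrite trunc_dist_ge// a0 lexx.
Qed.

Let pi2 : R := pi / 2.
Let pi2_gt0 : 0 < pi2. Proof. by have /andP[] := pihalf_02 R. Qed.
Let pi2_ltpi : pi2 < pi.
Proof. by rewrite /pi2 ltr_pdivrMr// mulr_natr mulr2n ltrDl pi_gt0. Qed.

Lemma cosd_half_ge0 p : 0 <= cosd (pi / 2) p.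
Proof.
rewrite /cosd; have /andP[t0 t1] := @trunc_dist_itv (pi / 2) p.1 p.2 (ltW pi2_gt0).
apply: cos_ge0_pihalf; rewrite t1 andbT (le_trans _ t0)// oppr_le0.
exact: ltW pi2_gt0.
Qed.

Lemma cosd_half_gt0 p : 0 < cosd (pi / 2) p <-> (d p.1 p.2 < (pi / 2)%:E)%E.
Proof.
split=> [|dp].
  have [//|dp] := ltP (d p.1 p.2) (pi / 2)%:E.
  by rewrite /cosd trunc_dist_ge// cos_pihalf ltxx.
rewrite /cosd; have [-> /andP[d0 d1]] := trunc_dist_lt dp.
apply: cos_gt0_pihalf; rewrite d1 andbT (lt_le_trans _ d0)// oppr_lt0.
exact: pi2_gt0.
Qed.

Lemma cosd_pi_eq p : (d p.1 p.2 <= (pi / 2)%:E)%E -> cosd pi p = cosd (pi / 2) p.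
Proof.
move=> dp; have dpi : (d p.1 p.2 < pi%:E)%E.
  by rewrite (le_lt_trans dp)// lte_fin; exact: pi2_ltpi.
rewrite /cosd; have [-> _] := trunc_dist_lt dpi.
by rewrite /trunc_dist min_l.
Qed.

Lemma cosd_pi_lt p : ((pi / 2)%:E < d p.1 p.2)%E -> cosd pi p < cosd (pi / 2) p.
Proof.
move=> dp; have e2 : cosd (pi / 2) p = cos (pi / 2).
  by rewrite /cosd trunc_dist_ge// ltW.
rewrite e2 /cosd ltr_cos; last 2 first.
- by rewrite in_itv /= (ltW pi2_gt0) (ltW pi2_ltpi).
- by rewrite in_itv /=; apply: trunc_dist_itv; exact: pi_ge0.
have [dpi|dpi] := ltP (d p.1 p.2) pi%:E.
  have [-> _] := trunc_dist_lt dpi; rewrite -lte_fin fineK//.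
  by rewrite ge0_fin_numE ?dist_ge0// (lt_trans dpi)// ltry.
by rewrite trunc_dist_ge.
Qed.

Lemma cosd_pi_le p : cosd pi p <= cosd (pi / 2) p.
Proof.
by have [/cosd_pi_eq ->//|/cosd_pi_lt/ltW] := leP (d p.1 p.2) (pi / 2)%:E.
Qed.

Lemma cosd_le1 a p : cosd a p <= 1. Proof. exact: cos_le1. Qed.

Lemma ell_lt p : 0 < cosd (pi / 2) p ->
  ell (d p.1 p.2) = (- ln (cosd (pi / 2) p ^+ 2))%:E.
Proof.
move=> /cosd_half_gt0 dp; rewrite /ell dp /cosd.
by have [-> _] := trunc_dist_lt dp.
Qed.

Lemma ell_ge p : ~ 0 < cosd (pi / 2) p -> ell (d p.1 p.2) = +oo%E.
Proof.
move=> np; rewrite /ell; case: ifPn => // dp.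
by exfalso; apply: np; exact/cosd_half_gt0.
Qed.

Lemma ell_ge0 p : (0 <= ell (d p.1 p.2))%E.
Proof.
have [c0|/negP/ell_ge ->] := boolP (0 < cosd (pi / 2) p); last by rewrite leey.
rewrite ell_lt// lee_fin oppr_ge0 ln_le0//.
by rewrite expr_le1// ?cosd_half_ge0// cosd_le1.
Qed.

Lemma ell_borel : measurable_fun [set: borel (X * X)%type]
  ((fun p => ell (d p.1 p.2)) : borel (X * X)%type -> \bar R).
Proof.
rewrite (_ : (fun _ => _) = (fun p => if 0 < cosd (pi / 2) p then
   (- ln (cosd (pi / 2) p ^+ 2))%:E else +oo%E)); last first.
  by apply/funext => p; case: ifPn => [/ell_lt|/negP/ell_ge].
apply: measurable_fun_ifT => //.
- by apply: measurable_fun_ltr => //; exact: cosd_borel.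
- apply/measurable_EFinP; apply: measurableT_comp => //.
  by apply: measurableT_comp => //; apply: measurable_funX; exact: cosd_borel.
Qed.

Lemma crossE (z : C * C) :
  cross d z = cone_r z.1 * cone_r z.2 * cosd (pi / 2) (cone_x2 z).
Proof. by []. Qed.

Lemma cross_ge0 (z : C * C) : 0 <= cross d z.
Proof. by rewrite crossE !mulr_ge0 ?cosd_half_ge0 ?cone_r_ge0. Qed.

Lemma cross_borel : measurable_fun [set: borel (C * C)%type]
  (cross d : borel (C * C)%type -> R).
Proof.
rewrite (funext crossE); apply: measurable_funM.
  by apply: measurable_funM; [exact: cone_r1_borel|exact: cone_r2_borel].
exact: (borel_comp (cosd_borel _) cone_x2_borel).
Qed.

Lemma cone_dist_sq_borel : measurable_fun [set: borel (C * C)%type]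
  ((fun z => cone_dist_sq d z.1 z.2) : borel (C * C)%type -> R).
Proof.
have m1 := @cone_r1_borel R X; have m2 := @cone_r2_borel R X.
apply: measurable_funB.
  by apply: measurable_funD; apply: measurable_funX.
apply: measurable_funM; last exact: (borel_comp (cosd_borel pi) cone_x2_borel).
by apply: measurable_funM => //; exact: measurable_funM.
Qed.

Lemma cone_cost_ge0 a x1 (r1 : R) x2 (r2 : R) : 0 <= r1 -> 0 <= r2 ->
  0 <= cone_cost d a x1 r1 x2 r2.
Proof.
move=> r10 r20; rewrite /cone_cost.
have := cos_le1 (trunc_dist d a x1 x2); set c := cos _ => c1.
have : r1 * r2 * c <= r1 * r2 by rewrite ler_piMr// mulr_ge0.
have := sqr_ge0 (r1 - r2); nra.
Qed.

(** Equality fails exactly on [far_set], where [cos (d_pi)] is negative and the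
  cross term is zero. *)
Lemma cone_dist_sq_cross (z : C * C) :
  cone_r z.1 ^+ 2 + cone_r z.2 ^+ 2 <= cone_dist_sq d z.1 z.2 + 2 * cross d z
  ?= iff ~~ `[< far_set d z >].
Proof.
have p := cosd_pi_le (cone_x2 z).
have r1 := cone_r_ge0 z.1; have r2 := cone_r_ge0 z.2.
have -> : cone_dist_sq d z.1 z.2 + 2 * cross d z =
   cone_r z.1 ^+ 2 + cone_r z.2 ^+ 2 +
   2 * (cone_r z.1 * cone_r z.2) * (cosd (pi / 2) (cone_x2 z) - cosd pi (cone_x2 z)).
  by rewrite crossE /cone_dist_sq /cone_cost -/(cosd pi (cone_x2 z)); ring.
split; first by rewrite lerDl !mulr_ge0// subr_ge0.
rewrite -[X in X == _]addr0 (inj_eq (addrI _)) eq_sym !mulf_eq0 pnatr_eq0 /= subr_eq0.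
apply/idP/idP.
  move=> h; apply/asboolPn => -[[/= z1 z2] far].
  have c1 : 0 < cone_r z.1 by apply/cone_r_gt0.
  have c2 : 0 < cone_r z.2 by apply/cone_r_gt0.
  have c3 := @cosd_pi_lt (cone_x2 z) far.
  by move: h; rewrite (gt_eqF c1) (gt_eqF c2) (gt_eqF c3).
move=> /asboolPn nf.
have [//|z1] := eqVneq (cone_r z.1) 0; have [//|z2] := eqVneq (cone_r z.2) 0.
rewrite /= eq_sym cosd_pi_eq// leNgt; apply/negP => far; apply: nf; split => //.
by split; apply/cone_r_gt0; rewrite lt_neqAle eq_sym ?z1 ?z2.
Qed.

(** In this form [far_set] is seen to be Borel and becomes the equality case of
  the cost estimate. *)
Lemma far_setE : far_set d = [set z : C * C |
  cone_r z.1 ^+ 2 + cone_r z.2 ^+ 2 < cone_dist_sq d z.1 z.2 + 2 * cross d z].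
Proof.
apply/seteqP; split=> z; have [le eq] := cone_dist_sq_cross z.
  by move=> fz /=; rewrite lt_neqAle le andbT eq negbK; exact/asboolP.
by rewrite /= lt_neqAle eq negbK => /andP[/asboolP].
Qed.

Lemma far_set_borel : measurable (far_set d : set (borel (C * C)%type)).
Proof.
rewrite far_setE; have m1 := @cone_r1_borel R X; have m2 := @cone_r2_borel R X.
apply: measurable_ltr.
  by apply: measurable_funD; exact: measurable_funX.
apply: measurable_funD; first exact: cone_dist_sq_borel.
by apply: measurable_funM => //; exact: cross_borel.
Qed.

Lemma good_setE : good_set d = [set z : C * C | 0 < cross d z].
Proof.
apply/seteqP; split=> z; rewrite /good_set /= crossE.
  move=> [/eqP r0 /(@cosd_half_gt0 (cone_x2 z)) c0]; rewrite pmulr_lgt0//.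
  by rewrite lt_neqAle eq_sym r0 mulr_ge0 ?cone_r_ge0.
move=> c0; have cx := cosd_half_ge0 (cone_x2 z).
split; first by move=> r0; rewrite r0 mul0r ltxx in c0.
apply/(@cosd_half_gt0 (cone_x2 z)).
rewrite lt_neqAle cx andbT; apply/eqP => e0; by rewrite -e0 mulr0 ltxx in c0.
Qed.

Lemma good_set_borel : measurable (good_set d : set (borel (C * C)%type)).
Proof.
rewrite good_setE; apply: measurable_ltr; [exact: measurable_cst|exact: cross_borel].
Qed.

Lemma good_offvertex : good_set d `<=` @offvertex2 R X.
Proof.
move=> z [r0 _]; split=> z0; apply: r0; rewrite z0 cone_r_vertex ?mul0r ?mulr0//.
Qed.

End Distance.

(** * Plans in arbitrary coordinates *)

Section Plans.
Context {R : realType} {X : ptopologicalType}.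
Variable d : X -> X -> \bar R.
Hypothesis hd : extended_metric_topological d.
Variables (mu1 mu2 : setfun X R).
Hypotheses (fmu1 : finmeas mu1) (fmu2 : finmeas mu2).

(** A lower bound for the cost of a plan whose cross term has integral [u],
  attained when the plan does not charge [far_set]. *)
Definition value (u : R) : \bar R :=
  (fine (mu1 setT) + fine (mu2 setT) - 2 * u)%:E.

Lemma value_le u v : (value u <= value v)%E <-> v <= u.
Proof. by rewrite lee_fin; split=> ?; lra. Qed.

Section Coordinates.
Context {Z : ptopologicalType}.
Variables (p : Z -> X * X) (r1 r2 : Z -> R).
Hypothesis mp : measurable_fun [set: borel Z] (p : borel Z -> borel (X * X)%type).
Hypothesis mr1 : measurable_fun [set: borel Z] (r1 : borel Z -> R).
Hypothesis mr2 : measurable_fun [set: borel Z] (r2 : borel Z -> R).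
Hypothesis r1_ge0 : forall z, 0 <= r1 z.
Hypothesis r2_ge0 : forall z, 0 <= r2 z.

(** Points and radii are arbitrary functions on [Z], so that [Z] can be the
  square of the cone, the square of its cover, or [X * X] with prescribed
  radii. *)
Definition gcross (z : Z) : R := r1 z * r2 z * cosd d (pi / 2) (p z).

Definition gplan (a : setfun Z R) : Prop :=
  [/\ radon a /\ (\int[a]_z (r1 z ^+ 2 + r2 z ^+ 2)%:E < +oo)%E,
      le_meas (hmarg (fun z => (p z).1) r1 a) mu1 &
      le_meas (hmarg (fun z => (p z).2) r2 a) mu2].

Lemma gcross_ge0 z : 0 <= gcross z.
Proof. by rewrite /gcross !mulr_ge0// cosd_half_ge0. Qed.

Lemma gcross_borel : measurable_fun [set: borel Z] (gcross : borel Z -> R).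
Proof.
apply: measurable_funM; first exact: measurable_funM.
exact: borel_comp (cosd_borel hd _) mp.
Qed.

Lemma gcross_le z : 2 * gcross z <= r1 z ^+ 2 + r2 z ^+ 2.
Proof.
have c0 := cosd_half_ge0 hd (p z); have c1 := cosd_le1 d (pi / 2) (p z).
have : r1 z * r2 z * cosd d (pi / 2) (p z) <= r1 z * r2 z.
  by rewrite ler_piMr// mulr_ge0.
rewrite /gcross; have := sqr_ge0 (r1 z - r2 z); nra.
Qed.

Let ms1 : measurable_fun [set: borel Z] ((fun z => (r1 z ^+ 2)%:E) : borel Z -> \bar R).
Proof. by apply/measurable_EFinP; exact: measurable_funX. Qed.

Let ms2 : measurable_fun [set: borel Z] ((fun z => (r2 z ^+ 2)%:E) : borel Z -> \bar R).
Proof. by apply/measurable_EFinP; exact: measurable_funX. Qed.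

Lemma sqr_lty (a : setfun Z R) : finmeas a ->
  (\int[a]_z (r1 z ^+ 2 + r2 z ^+ 2)%:E < +oo)%E ->
  (\int[a]_z (r1 z ^+ 2)%:E < +oo)%E /\ (\int[a]_z (r2 z ^+ 2)%:E < +oo)%E.
Proof.
move=> [m ->] aoo.
have ms : measurable_fun [set: borel Z]
    ((fun z => (r1 z ^+ 2 + r2 z ^+ 2)%:E) : borel Z -> \bar R).
  by apply/measurable_EFinP; apply: measurable_funD; exact: measurable_funX.
split; apply: le_lt_trans aoo; apply: ge0_le_integral => //;
  by move=> z _; rewrite ?lee_fin ?lerDl ?lerDr ?addr_ge0 ?sqr_ge0.
Qed.

Lemma sqr_integralD (a : setfun Z R) : finmeas a ->
  (\int[a]_z (r1 z ^+ 2 + r2 z ^+ 2)%:E =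
   \int[a]_z (r1 z ^+ 2)%:E + \int[a]_z (r2 z ^+ 2)%:E)%E.
Proof.
move=> [m ->]; under eq_integral do rewrite EFinD.
by rewrite ge0_integralD// => z _; rewrite lee_fin sqr_ge0.
Qed.

(** Since [h_i a] has mass [\int r_i ^+ 2], the penalties complete
  [- \int (r1 ^+ 2 + r2 ^+ 2)] to [mu1 setT + mu2 setT]; comparing [F] with
  [r1 ^+ 2 + r2 ^+ 2 - 2 gcross] leaves [value u]. The upper bound on [F] only
  serves to make all integrals finite. *)
Lemma total_cost (a : setfun Z R) (F : Z -> R) : gplan a ->
  measurable_fun [set: borel Z] (F : borel Z -> R) -> (forall z, 0 <= F z) ->
  (forall z, F z <= 2 * (r1 z ^+ 2 + r2 z ^+ 2)) ->
  (forall z, r1 z ^+ 2 + r2 z ^+ 2 <= F z + 2 * gcross z) ->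
  let c := (\int[a]_z (F z)%:E
    + (mu1 setT - hmarg (fun z => (p z).1) r1 a setT)
    + (mu2 setT - hmarg (fun z => (p z).2) r2 a setT))%E in
  exists u, [/\ (\int[a]_z (gcross z)%:E)%E = u%:E, (value u <= c)%E &
    (c <= value u)%E <->
      a [set z | r1 z ^+ 2 + r2 z ^+ 2 < F z + 2 * gcross z] = 0%E].
Proof.
move=> [[ra aoo] h1 h2] mF F0 Fle leF; have fa := radon_finmeas ra.
have [a1 a2] := sqr_lty fa aoo.
rewrite !hmargT.
have /(h1 setT) := @measurableT _ (borel X); rewrite hmargT => h1T.
have /(h2 setT) := @measurableT _ (borel X); rewrite hmargT => h2T.
have fM1 := finmeas_fin fmu1 (@measurableT _ (borel X)).
have fM2 := finmeas_fin fmu2 (@measurableT _ (borel X)).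
have mFE : measurable_fun [set: borel Z] ((fun z => (F z)%:E) : borel Z -> \bar R).
  exact/measurable_EFinP.
have mG : measurable_fun [set: borel Z] ((fun z => (2 * gcross z)%:E) : borel Z -> \bar R).
  by apply/measurable_EFinP; apply: measurable_funM => //; exact: gcross_borel.
have mg : measurable_fun [set: borel Z] ((fun z => (gcross z)%:E) : borel Z -> \bar R).
  by apply/measurable_EFinP; exact: gcross_borel.
have ms : measurable_fun [set: borel Z]
    ((fun z => (r1 z ^+ 2 + r2 z ^+ 2)%:E) : borel Z -> \bar R).
  by apply/measurable_EFinP; apply: measurable_funD; exact: measurable_funX.
have s0 z : 0 <= r1 z ^+ 2 + r2 z ^+ 2 by rewrite addr_ge0// sqr_ge0.
have mFG : measurable_fun [set: borel Z] ((fun z => (F z + 2 * gcross z)%:E) : borel Z -> \bar R).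
  under eq_fun do rewrite EFinD.
  exact: emeasurable_funD.
have sE := sqr_integralD fa.
have GE : (\int[a]_z (2 * gcross z)%:E = 2%:E * \int[a]_z (gcross z)%:E)%E.
  case: fa => m ->; under eq_integral do rewrite EFinM.
  by rewrite ge0_integralZl_EFin// => z _; rewrite lee_fin gcross_ge0.
have FGE : (\int[a]_z (F z + 2 * gcross z)%:E =
    \int[a]_z (F z)%:E + 2%:E * \int[a]_z (gcross z)%:E)%E.
  rewrite -GE; case: fa => m ->; under eq_integral do rewrite EFinD.
  rewrite ge0_integralD// => z _; rewrite lee_fin; first exact: F0.
  by rewrite mulr_ge0// gcross_ge0.
have int0 f : (forall z, 0 <= f z) -> (0 <= \int[a]_z (f z)%:E)%E.
  move=> f0; case: fa => m ->; apply: integral_ge0 => z _; by rewrite lee_fin.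
have le f g : measurable_fun [set: borel Z] ((fun z => (f z)%:E) : borel Z -> \bar R) ->
    measurable_fun [set: borel Z] ((fun z => (g z)%:E) : borel Z -> \bar R) ->
    (forall z, 0 <= f z) -> (forall z, f z <= g z) ->
    (\int[a]_z (f z)%:E <= \int[a]_z (g z)%:E)%E.
  move=> mf mg' f0 fg; case: fa => m ->; apply: ge0_le_integral => // z _;
    by rewrite lee_fin.
have finF : (\int[a]_z (F z)%:E)%E \is a fin_num.
  rewrite ge0_fin_numE ?int0//.
  apply: le_lt_trans (_ : (2%:E * \int[a]_z (r1 z ^+ 2 + r2 z ^+ 2)%:E < +oo)%E).
    have -> : (2%:E * \int[a]_z (r1 z ^+ 2 + r2 z ^+ 2)%:E =
      \int[a]_z (2 * (r1 z ^+ 2 + r2 z ^+ 2))%:E)%E.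
      case: fa => m ->; rewrite -ge0_integralZl_EFin//.
      by move=> z _; rewrite lee_fin.
    apply: le => //; apply/measurable_EFinP; apply: measurable_funM => //.
    exact/measurable_EFinP.
  by rewrite lte_mul_pinfty// ?int0.
have fing : (\int[a]_z (gcross z)%:E)%E \is a fin_num.
  rewrite ge0_fin_numE ?int0//; last exact: gcross_ge0.
  apply: le_lt_trans aoo; apply: le => //; first exact: gcross_ge0.
  by move=> z; have := gcross_le z; have := gcross_ge0 z; lra.
have fin1 : (\int[a]_z (r1 z ^+ 2)%:E)%E \is a fin_num.
  by rewrite ge0_fin_numE// int0// => z; exact: sqr_ge0.
have fin2 : (\int[a]_z (r2 z ^+ 2)%:E)%E \is a fin_num.
  by rewrite ge0_fin_numE// int0// => z; exact: sqr_ge0.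
have leS : (\int[a]_z (r1 z ^+ 2 + r2 z ^+ 2)%:E <= \int[a]_z (F z + 2 * gcross z)%:E)%E.
  exact: le.
have eqS : (\int[a]_z (F z + 2 * gcross z)%:E <= \int[a]_z (r1 z ^+ 2 + r2 z ^+ 2)%:E)%E
    <-> a [set z | r1 z ^+ 2 + r2 z ^+ 2 < F z + 2 * gcross z] = 0%E.
  have mS : measurable ([set z | r1 z ^+ 2 + r2 z ^+ 2 < F z + 2 * gcross z] : set (borel Z)).
    by apply: measurable_ltr; apply/measurable_EFinP.
  have FF := finmeas_ae fa.
  split=> [ge|a0].
    have : {ae a, forall z, (r1 z ^+ 2 + r2 z ^+ 2)%:E = (F z + 2 * gcross z)%:E}.
      apply: ae_eq_of_integral_le => //.
      - by move=> z; rewrite lee_fin addr_ge0// mulr_ge0// gcross_ge0.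
      - by apply: filterE => z; rewrite lee_fin.
    case: fa mS => m -> mS ae; apply/negligibleP => //.
    by apply: negligibleS ae => z /= lt [] eq; rewrite eq ltxx in lt.
  have ae : {ae a, forall z, (F z + 2 * gcross z)%:E <= (r1 z ^+ 2 + r2 z ^+ 2)%:E}%E.
    case: fa mS a0 => m -> mS a0; exists [set z | r1 z ^+ 2 + r2 z ^+ 2 < F z + 2 * gcross z].
    by split=> // z /= /negP; rewrite lee_fin -ltNge.
  apply: ae_le_integral => //.
  by move=> z; rewrite lee_fin addr_ge0// mulr_ge0// gcross_ge0.
exists (fine (\int[a]_z (gcross z)%:E)%E); split; first by rewrite fineK.
- move: leS; rewrite sE FGE /value.
  rewrite -(fineK finF) -(fineK fing) -(fineK fin1) -(fineK fin2) -(fineK fM1) -(fineK fM2).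
  by rewrite -?(EFinM, EFinD, EFinN, EFinB) !lee_fin /=; lra.
- rewrite -eqS sE FGE /value.
  rewrite -(fineK finF) -(fineK fing) -(fineK fin1) -(fineK fin2) -(fineK fM1) -(fineK fM2).
  by rewrite -?(EFinM, EFinD, EFinN, EFinB) !lee_fin /=; split=> ?; lra.
Qed.

Lemma gplan_fin1 (a : setfun Z R) : gplan a ->
  (\int[a]_z (r1 z ^+ 2)%:E < +oo)%E /\ (\int[a]_z (r2 z ^+ 2)%:E < +oo)%E.
Proof. by move=> [[ra aoo] _ _]; exact: sqr_lty (radon_finmeas ra) aoo. Qed.

End Coordinates.
End Plans.

(** [b] is the image under [f] of the measure with density [w] with respect to [a],
  expressed through integrals. The homogeneous marginals only see [w * r' ^+ 2],
  and the point is irrelevant where this weight is zero. *)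
Section ImageMarginals.
Context {R : realType} {X Z Z' : ptopologicalType}.
Variables (a : setfun Z R) (b : setfun Z' R) (w : Z -> R) (f : Z -> Z').
Hypotheses (fa : finmeas a) (fb : finmeas b).
Hypothesis bint : forall h : Z' -> \bar R,
  measurable_fun [set: borel Z'] (h : borel Z' -> \bar R) -> (forall y, 0 <= h y)%E ->
  (\int[b]_y h y = \int[a]_z ((w z)%:E * h (f z)))%E.
Hypothesis w_ge0 : forall z, 0 <= w z.
Hypothesis mw : measurable_fun [set: borel Z] (w : borel Z -> R).
Hypothesis mf : measurable_fun [set: borel Z] (f : borel Z -> borel Z').
Variables (x : Z -> X) (r : Z -> R) (x' : Z' -> X) (r' : Z' -> R).
Hypothesis mx : measurable_fun [set: borel Z] (x : borel Z -> borel X).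
Hypothesis mr : measurable_fun [set: borel Z] (r : borel Z -> R).
Hypothesis mx' : measurable_fun [set: borel Z'] (x' : borel Z' -> borel X).
Hypothesis mr' : measurable_fun [set: borel Z'] (r' : borel Z' -> R).
Hypothesis aoo : (\int[a]_z (r z ^+ 2)%:E < +oo)%E.

Let mf' : measurable_fun [set: borel Z]
  ((fun z => (w z * r' (f z) ^+ 2)%:E) : borel Z -> \bar R).
Proof.
apply/measurable_EFinP; apply: measurable_funM => //.
by apply: measurable_funX; exact: borel_comp mr' mf.
Qed.

Let le_int (g h : Z -> R) :
  measurable_fun [set: borel Z] (g : borel Z -> R) ->
  measurable_fun [set: borel Z] (h : borel Z -> R) ->
  (forall z, 0 <= g z <= h z) ->
  (\int[a]_z (g z)%:E <= \int[a]_z (h z)%:E)%E.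
Proof.
move=> mg mh gh; case: fa => m ->; apply: ge0_le_integral => //.
- by move=> z _; rewrite lee_fin; have /andP[] := gh z.
- exact/measurable_EFinP.
- exact/measurable_EFinP.
- by move=> z _; rewrite lee_fin; have /andP[] := gh z.
Qed.

Lemma image_sqr_integral :
  (\int[b]_y (r' y ^+ 2)%:E = \int[a]_z (w z * r' (f z) ^+ 2)%:E)%E.
Proof.
rewrite bint//; last by move=> y; rewrite lee_fin sqr_ge0.
by apply/measurable_EFinP; exact: measurable_funX.
Qed.

Let mind (T : ptopologicalType) (y : T -> X) (A : set (borel X)) :
  measurable_fun [set: borel T] (y : borel T -> borel X) -> measurable A ->
  measurable_fun [set: borel T] ((fun t => \1_A (y t)) : borel T -> R).
Proof.
by move=> my mA; apply: (@borel_comp _ _ _ _ (\1_A : X -> R)).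
Qed.

Section Le.
Hypothesis le : forall z, w z * r' (f z) ^+ 2 <= r z ^+ 2.
Hypothesis xx : forall z, 0 < w z * r' (f z) ^+ 2 -> x' (f z) = x z.

Lemma image_sqr_lty : (\int[b]_y (r' y ^+ 2)%:E < +oo)%E.
Proof.
rewrite image_sqr_integral; apply: le_lt_trans aoo; apply: le_int.
- exact/measurable_EFinP.
- exact: measurable_funX.
- by move=> z; rewrite le mulr_ge0// sqr_ge0.
Qed.

Lemma hmarg_imageE (A : set (borel X)) : measurable A ->
  hmarg x' r' b A = (\int[a]_z (w z * r' (f z) ^+ 2 * \1_A (x z))%:E)%E.
Proof.
move=> mA; rewrite hmargE//; last exact: image_sqr_lty.
rewrite bint; last 2 first.
- apply/measurable_EFinP; apply: measurable_funM; last exact: mind.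
  exact: measurable_funX.
- by move=> y; rewrite lee_fin mulr_ge0// sqr_ge0.
apply: eq_integralT => z; rewrite -EFinM mulrA; congr (_%:E).
have [->|n0] := eqVneq (w z * r' (f z) ^+ 2) 0; first by rewrite !mul0r.
by rewrite xx// lt_neqAle eq_sym n0 mulr_ge0// sqr_ge0.
Qed.

Lemma hmarg_image_le : le_meas (hmarg x' r' b) (hmarg x r a).
Proof.
move=> A mA; rewrite hmarg_imageE// hmargE//; apply: le_int.
- apply: measurable_funM; last exact: mind.
  exact/measurable_EFinP.
- by apply: measurable_funM; [exact: measurable_funX|exact: mind].
- move=> z; apply/andP; split; last by rewrite ler_wpM2r.
  by apply: mulr_ge0 => //; rewrite mulr_ge0// sqr_ge0.
Qed.

End Le.

Lemma hmarg_image_eq : (forall z, w z * r' (f z) ^+ 2 = r z ^+ 2) ->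
  (forall z, 0 < r z ^+ 2 -> x' (f z) = x z) ->
  eq_meas (hmarg x' r' b) (hmarg x r a).
Proof.
move=> eq xx A mA; rewrite hmarg_imageE//.
- by rewrite hmargE//; apply: eq_integralT => z; rewrite eq.
- by move=> z; rewrite eq.
- by move=> z; rewrite eq; exact: xx.
Qed.

End ImageMarginals.

(** Plans are carried from one coordinate space to another by a map that keeps
  both points and increases neither weight [r ^+ 2]; the density [w] stands for a
  restriction or for the weight of a dilation. *)
Section ImagePlans.
Context {R : realType} {X Z Z' : ptopologicalType}.
Variable d : X -> X -> \bar R.
Hypothesis hd : extended_metric_topological d.
Variables (mu1 mu2 : setfun X R).
Variables (p : Z -> X * X) (r1 r2 : Z -> R).
Hypothesis mp : measurable_fun [set: borel Z] (p : borel Z -> borel (X * X)%type).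
Hypothesis mr1 : measurable_fun [set: borel Z] (r1 : borel Z -> R).
Hypothesis mr2 : measurable_fun [set: borel Z] (r2 : borel Z -> R).
Variables (p' : Z' -> X * X) (r1' r2' : Z' -> R).
Hypothesis mp' : measurable_fun [set: borel Z'] (p' : borel Z' -> borel (X * X)%type).
Hypothesis mr1' : measurable_fun [set: borel Z'] (r1' : borel Z' -> R).
Hypothesis mr2' : measurable_fun [set: borel Z'] (r2' : borel Z' -> R).
Hypothesis r1_ge0 : forall y, 0 <= r1' y.
Hypothesis r2_ge0 : forall y, 0 <= r2' y.
Variables (a : setfun Z R) (b : setfun Z' R) (w : Z -> R) (f : Z -> Z').
Hypothesis bint : forall h : Z' -> \bar R,
  measurable_fun [set: borel Z'] (h : borel Z' -> \bar R) -> (forall y, 0 <= h y)%E ->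
  (\int[b]_y h y = \int[a]_z ((w z)%:E * h (f z)))%E.
Hypothesis w_ge0 : forall z, 0 <= w z.
Hypothesis mw : measurable_fun [set: borel Z] (w : borel Z -> R).
Hypothesis mf : measurable_fun [set: borel Z] (f : borel Z -> borel Z').

Lemma gplan_image : gplan mu1 mu2 p r1 r2 a -> radon b ->
  (forall z, w z * r1' (f z) ^+ 2 <= r1 z ^+ 2) ->
  (forall z, w z * r2' (f z) ^+ 2 <= r2 z ^+ 2) ->
  (forall z, 0 < w z * r1' (f z) ^+ 2 -> (p' (f z)).1 = (p z).1) ->
  (forall z, 0 < w z * r2' (f z) ^+ 2 -> (p' (f z)).2 = (p z).2) ->
  gplan mu1 mu2 p' r1' r2' b.
Proof.
move=> pa rb le1 le2 x1 x2; have [a1 a2] := gplan_fin1 mr1 mr2 pa.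
case: pa => -[ra aoo] h1 h2; have fa := radon_finmeas ra; have fb := radon_finmeas rb.
have mp1 : measurable_fun [set: borel Z] ((fun z => (p z).1) : borel Z -> borel X).
  exact: borel_comp (@borel_fst X X) mp.
have mp2 : measurable_fun [set: borel Z] ((fun z => (p z).2) : borel Z -> borel X).
  exact: borel_comp (@borel_snd X X) mp.
have mp1' : measurable_fun [set: borel Z'] ((fun z => (p' z).1) : borel Z' -> borel X).
  exact: borel_comp (@borel_fst X X) mp'.
have mp2' : measurable_fun [set: borel Z'] ((fun z => (p' z).2) : borel Z' -> borel X).
  exact: borel_comp (@borel_snd X X) mp'.
split.
- split=> //; rewrite sqr_integralD// lte_add_pinfty//.
    exact: (image_sqr_lty fa bint w_ge0 mw mf mr1 mr1' a1 le1).
  exact: (image_sqr_lty fa bint w_ge0 mw mf mr2 mr2' a2 le2).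
- move=> A mA; apply: le_trans (h1 A mA).
  exact: (hmarg_image_le fa fb bint w_ge0 mw mf mp1 mr1 mp1' mr1' a1 le1 x1).
- move=> A mA; apply: le_trans (h2 A mA).
  exact: (hmarg_image_le fa fb bint w_ge0 mw mf mp2 mr2 mp2' mr2' a2 le2 x2).
Qed.

Lemma gcross_image : (forall z, w z * gcross d p' r1' r2' (f z) = gcross d p r1 r2 z) ->
  (\int[b]_y (gcross d p' r1' r2' y)%:E = \int[a]_z (gcross d p r1 r2 z)%:E)%E.
Proof.
move=> e; rewrite bint.
- by apply: eq_integralT => z; rewrite -EFinM e.
- apply/measurable_EFinP; exact: (gcross_borel hd mp' mr1' mr2').
- by move=> y; rewrite lee_fin; exact: gcross_ge0.
Qed.

End ImagePlans.

(** * Plans over the cone and over its cover *)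

(** A named product, so that the square [Y2] of the cover can be handled as a
  single space. *)
Definition prodP (S T : ptopologicalType) : ptopologicalType := (S * T)%type.

Section Spaces.
Context {R : realType} {X : ptopologicalType}.
Local Notation C := (cone R X).

Definition Y1 : ptopologicalType := Yspace R X.
Definition Y2 : ptopologicalType := prodP Y1 Y1.

Lemma borel_fstP (S T : ptopologicalType) :
  measurable_fun [set: borel (prodP S T)] (fst : borel (prodP S T) -> borel S).
Proof. exact: borel_fst. Qed.

Lemma borel_sndP (S T : ptopologicalType) :
  measurable_fun [set: borel (prodP S T)] (snd : borel (prodP S T) -> borel T).
Proof. exact: borel_snd. Qed.

Lemma borel_prodmapP (S S' T T' : ptopologicalType) (f : S -> T) (g : S' -> T') :
  continuous f -> continuous g ->
  measurable_fun [set: borel (prodP S S')]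
    ((fun z : prodP S S' => (f z.1, g z.2)) : borel (prodP S S') -> borel (T * T')%type).
Proof. exact: borel_prodmap. Qed.

Definition Y_x2 (y : Y2) : X * X := (y.1.1, y.2.1).
Definition Y_r1 (y : Y2) : R := hval y.1.2.
Definition Y_r2 (y : Y2) : R := hval y.2.2.
Definition C_r1 (z : C * C) : R := cone_r z.1.
Definition C_r2 (z : C * C) : R := cone_r z.2.

Let hval_snd_borel : measurable_fun [set: borel Y1]
  ((fun y : Y1 => hval y.2) : borel Y1 -> R).
Proof.
exact: (@borel_comp Y1 (halfline R) _ R (@hval R) snd
  (continuous_real (@hval_continuous R)) (@borel_snd X (halfline R))).
Qed.

Lemma Y_r1_borel : measurable_fun [set: borel Y2] (Y_r1 : borel Y2 -> R).
Proof.
exact: (@borel_comp _ Y1 _ R (fun y => hval y.2) fst hval_snd_borel (@borel_fstP Y1 Y1)).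
Qed.

Lemma Y_r2_borel : measurable_fun [set: borel Y2] (Y_r2 : borel Y2 -> R).
Proof.
exact: (@borel_comp _ Y1 _ R (fun y => hval y.2) snd hval_snd_borel (@borel_sndP Y1 Y1)).
Qed.

Lemma Y_x2_borel : measurable_fun [set: borel Y2] (Y_x2 : borel Y2 -> borel (X * X)%type).
Proof.
have c1 : continuous (fst : Y1 -> X) by exact: (@continuous_fst X (halfline R)).
exact: (@borel_prodmapP Y1 Y1 X X fst fst c1 c1).
Qed.

Lemma Y_r1_ge0 y : 0 <= Y_r1 y. Proof. exact: hval_ge0. Qed.
Lemma Y_r2_ge0 y : 0 <= Y_r2 y. Proof. exact: hval_ge0. Qed.
Lemma C_r1_ge0 z : 0 <= C_r1 z. Proof. exact: cone_r_ge0. Qed.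
Lemma C_r2_ge0 z : 0 <= C_r2 z. Proof. exact: cone_r_ge0. Qed.

Variable d : X -> X -> \bar R.
Hypothesis hd : extended_metric_topological d.
Variables (mu1 mu2 : setfun X R).

Definition C_plan := gplan mu1 mu2 (@cone_x2 R X) C_r1 C_r2.
Definition Y_plan := gplan mu1 mu2 Y_x2 Y_r1 Y_r2.

Definition Y_cross : Y2 -> R := gcross d Y_x2 Y_r1 Y_r2.

Lemma C_crossE : gcross d (@cone_x2 R X) C_r1 C_r2 = cross d.
Proof. by []. Qed.

End Spaces.

Section ConcretePlans.
Context {R : realType} {X : ptopologicalType}.
Variable d : X -> X -> \bar R.
Hypothesis hd : extended_metric_topological d.
Variables (mu1 mu2 : setfun X R).
Hypotheses (rmu1 : radon mu1) (rmu2 : radon mu2).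
Local Notation C := (cone R X).
Local Notation Y1 := (@Y1 R X).
Local Notation Y2 := (@Y2 R X).
Local Notation Y_cross := (Y_cross d).
Local Notation C_plan := (C_plan mu1 mu2).
Local Notation Y_plan := (Y_plan mu1 mu2).
Local Notation value := (value mu1 mu2).

Let hX : hausdorff_space X := emt_hausdorff hd.
Let fmu1 := radon_finmeas rmu1.
Let fmu2 := radon_finmeas rmu2.

Lemma C2_hausdorff : hausdorff_space (C * C)%type.
Proof. by apply: hausdorff_prod; exact: cone_hausdorff. Qed.

Lemma Y2_hausdorff : hausdorff_space Y2.
Proof. by apply: (@hausdorff_prod Y1 Y1); exact: Y_hausdorff. Qed.

Let cone_cost_le a x1 (r1 : R) x2 (r2 : R) : 0 <= r1 -> 0 <= r2 ->
  cone_cost d a x1 r1 x2 r2 <= 2 * (r1 ^+ 2 + r2 ^+ 2).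
Proof.
move=> r10 r20; rewrite /cone_cost.
have := cos_geN1 (trunc_dist d a x1 x2); set c := cos _ => c1.
have : - (r1 * r2) <= r1 * r2 * c.
  by rewrite -[X in X <= _]mulrN1 ler_wpM2l// mulr_ge0.
have := sqr_ge0 (r1 - r2); nra.
Qed.

Lemma C_total_cost (a : setfun (C * C)%type R) : C_plan a ->
  exists u, [/\ (\int[a]_z (cross d z)%:E)%E = u%:E,
    (value u <= HKle_cost d mu1 mu2 a)%E &
    (HKle_cost d mu1 mu2 a <= value u)%E <-> a (far_set d) = 0%E].
Proof.
move=> pa; rewrite far_setE//.
apply: (total_cost hd fmu1 fmu2 cone_x2_borel cone_r1_borel cone_r2_borel
  (@C_r1_ge0 R X) (@C_r2_ge0 R X) pa (cone_dist_sq_borel hd)).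
- by move=> z; apply: cone_cost_ge0; exact: cone_r_ge0.
- by move=> z; apply: cone_cost_le; exact: cone_r_ge0.
- by move=> z; have [] := cone_dist_sq_cross hd z.
Qed.

Definition Y_cost (y : Y2) : R :=
  cone_cost d (pi / 2) y.1.1 (hval y.1.2) y.2.1 (hval y.2.2).

Lemma Y_costE y : Y_cost y + 2 * Y_cross y = Y_r1 y ^+ 2 + Y_r2 y ^+ 2.
Proof. rewrite /Y_cost /cone_cost /Y_cross /gcross /cosd /Y_r1 /Y_r2 /=; ring. Qed.

Lemma Y_cross_borel : measurable_fun [set: borel Y2] (Y_cross : borel Y2 -> R).
Proof. exact (gcross_borel hd Y_x2_borel Y_r1_borel Y_r2_borel). Qed.

Lemma Y_cost_borel : measurable_fun [set: borel Y2] (Y_cost : borel Y2 -> R).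
Proof.
rewrite (_ : Y_cost = (fun y => Y_r1 y ^+ 2 + Y_r2 y ^+ 2 - 2 * Y_cross y)).
  apply: measurable_funB.
    apply: measurable_funD; apply: measurable_funX;
      [exact: Y_r1_borel|exact: Y_r2_borel].
  by apply: measurable_funM; [exact: measurable_cst|exact: Y_cross_borel].
by apply/funext => y; rewrite -Y_costE addrK.
Qed.

Definition Y_total (b : setfun Y2 R) : \bar R :=
  (\int[b]_y (Y_cost y)%:E
    + (mu1 setT - hmarg (fun y => (Y_x2 y).1) Y_r1 b setT)
    + (mu2 setT - hmarg (fun y => (Y_x2 y).2) Y_r2 b setT))%E.

Lemma Y_total_cost (b : setfun Y2 R) : Y_plan b ->
  exists u, (\int[b]_y (Y_cross y)%:E)%E = u%:E /\ Y_total b = value u.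
Proof.
move=> pb.
have [|||u [iu ge le]] := total_cost hd fmu1 fmu2 Y_x2_borel Y_r1_borel Y_r2_borel
  (@Y_r1_ge0 R X) (@Y_r2_ge0 R X) pb Y_cost_borel.
- by move=> z; apply: cone_cost_ge0; exact: hval_ge0.
- by move=> z; apply: cone_cost_le; exact: hval_ge0.
- by move=> z; rewrite -/(Y_cross z) Y_costE.
exists u; split=> //; apply/eqP; rewrite eq_le ge andbT; apply/le.
rewrite (_ : [set _ | _] = set0); last first.
  by apply/seteqP; split=> // y /=; rewrite -/(Y_cross y) Y_costE ltxx.
by case: pb => -[[[m ->] _] _] _ _; exact: measure0.
Qed.

Definition Y_proj (y : Y2) : C * C := (cone_proj y.1, cone_proj y.2).

Lemma Y_proj_continuous : continuous (Y_proj : Y2 -> C * C).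
Proof.
exact: (@continuous_prodmap Y1 Y1 C C _ _ (@cone_proj_continuous R X)
  (@cone_proj_continuous R X)).
Qed.

Lemma Y_proj_borel :
  measurable_fun [set: borel Y2] (Y_proj : borel Y2 -> borel (C * C)%type).
Proof. exact: continuous_borel Y_proj_continuous. Qed.

Lemma push_proj_radon (b : setfun Y2 R) : radon b -> radon (push Y_proj b).
Proof.
move=> rb; have hY := Y2_hausdorff; have hC := C2_hausdorff.
apply: (lusin_radon hY hC rb Y_proj_borel).
exact: lusin_continuous hY rb Y_proj_continuous.
Qed.

(** The constant density matches the hypothesis of [gplan_image]. *)
Lemma push_proj_integral (b : setfun Y2 R) (h : C * C -> \bar R) : radon b ->
  measurable_fun [set: borel (C * C)%type] (h : borel (C * C)%type -> \bar R) ->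
  (forall z, 0 <= h z)%E ->
  (\int[push Y_proj b]_z h z = \int[b]_y ((cst 1 y)%:E * h (Y_proj y)))%E.
Proof.
move=> rb mh h0; rewrite (push_integral (radon_finmeas rb) Y_proj_borel)//.
by apply: eq_integralT => y; rewrite mul1e.
Qed.

Lemma Y_proj_r1 y : C_r1 (Y_proj y) = Y_r1 y.
Proof. by rewrite /C_r1 /Y_proj /= cone_r_proj. Qed.

Lemma Y_proj_r2 y : C_r2 (Y_proj y) = Y_r2 y.
Proof. by rewrite /C_r2 /Y_proj /= cone_r_proj. Qed.

Lemma Y_proj_x1 y : 0 < Y_r1 y -> (cone_x2 (Y_proj y)).1 = (Y_x2 y).1.
Proof. by move=> y0; rewrite /Y_proj /cone_x2 /= cone_x_proj. Qed.

Lemma Y_proj_x2 y : 0 < Y_r2 y -> (cone_x2 (Y_proj y)).2 = (Y_x2 y).2.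
Proof. by move=> y0; rewrite /Y_proj /cone_x2 /= cone_x_proj. Qed.

Lemma Y_proj_cross y : cross d (Y_proj y) = Y_cross y.
Proof.
rewrite -C_crossE /Y_cross /gcross Y_proj_r1 Y_proj_r2.
have [->|z1] := eqVneq (Y_r1 y) 0; first by rewrite !mul0r.
have [->|z2] := eqVneq (Y_r2 y) 0; first by rewrite !mulr0 !mul0r.
have y1 : 0 < Y_r1 y by rewrite lt_neqAle eq_sym z1 Y_r1_ge0.
have y2 : 0 < Y_r2 y by rewrite lt_neqAle eq_sym z2 Y_r2_ge0.
congr (_ * cosd _ _ _).
by rewrite [LHS]surjective_pairing Y_proj_x1// Y_proj_x2.
Qed.

End ConcretePlans.

Section PlanTransfer.
Context {R : realType} {X : ptopologicalType}.
Variable d : X -> X -> \bar R.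
Hypothesis hd : extended_metric_topological d.
Variables (mu1 mu2 : setfun X R).
Hypotheses (rmu1 : radon mu1) (rmu2 : radon mu2).
Local Notation C := (cone R X).
Local Notation Y2 := (@Y2 R X).
Local Notation Y_cross := (Y_cross d).
Local Notation C_plan := (C_plan mu1 mu2).
Local Notation Y_plan := (Y_plan mu1 mu2).

Let hX : hausdorff_space X := emt_hausdorff hd.
Let fmu1 := radon_finmeas rmu1.
Let fmu2 := radon_finmeas rmu2.

Let b1 := @cone_r1_borel R X.
Let b2 := @cone_r2_borel R X.
Let bx := @cone_x2_borel R X.

(** The projection can move a point only where the radius is [0], which the
  marginals and the cross term do not see. *)
Lemma C_of_Y_plan (b : setfun Y2 R) : Y_plan b -> C_plan (push Y_proj b) /\
  (\int[push Y_proj b]_z (cross d z)%:E = \int[b]_y (Y_cross y)%:E)%E.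
Proof.
move=> pb; have [[rb boo] h1 h2] := pb.
have i := push_proj_integral rb; split.
  apply: (gplan_image Y_x2_borel Y_r1_borel Y_r2_borel bx b1 b2 i _ _
    Y_proj_borel pb (push_proj_radon hd rb)).
  - by move=> z; exact: ler01.
  - exact: measurable_cst.
  - by move=> z; rewrite mul1r -/(C_r1 _) Y_proj_r1.
  - by move=> z; rewrite mul1r -/(C_r2 _) Y_proj_r2.
  - move=> z; rewrite mul1r -/(C_r1 _) Y_proj_r1 => z0; apply: Y_proj_x1.
    by rewrite lt_neqAle eq_sym Y_r1_ge0 andbT; apply: contraTneq z0 => ->; rewrite expr0n /= ltxx.
  - move=> z; rewrite mul1r -/(C_r2 _) Y_proj_r2 => z0; apply: Y_proj_x2.
    by rewrite lt_neqAle eq_sym Y_r2_ge0 andbT; apply: contraTneq z0 => ->; rewrite expr0n /= ltxx.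
apply: (gcross_image hd bx b1 b2 (@C_r1_ge0 R X) (@C_r2_ge0 R X) i).
by move=> z; rewrite mul1r -[LHS]/(cross d _) Y_proj_cross.
Qed.

Lemma proj_sqr_integral (b : setfun Y2 R) : radon b ->
  (\int[push Y_proj b]_z (cone_r z.1 ^+ 2 + cone_r z.2 ^+ 2)%:E =
   \int[b]_y (Y_r1 y ^+ 2 + Y_r2 y ^+ 2)%:E)%E.
Proof.
move=> rb; rewrite (push_proj_integral rb).
- apply: eq_integralT => y.
  by rewrite mul1e -/(C_r1 _) -/(C_r2 _) Y_proj_r1 Y_proj_r2.
- by apply/measurable_EFinP; apply: measurable_funD; exact: measurable_funX.
- by move=> y; rewrite lee_fin addr_ge0// sqr_ge0.
Qed.

Lemma proj_marginals (b : setfun Y2 R) : radon b ->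
  (\int[b]_y (Y_r1 y ^+ 2 + Y_r2 y ^+ 2)%:E < +oo)%E ->
  eq_meas (hC1 (push Y_proj b)) (hmarg (fun y => (Y_x2 y).1) Y_r1 b) /\
  eq_meas (hC2 (push Y_proj b)) (hmarg (fun y => (Y_x2 y).2) Y_r2 b).
Proof.
move=> rb boo; have fb := radon_finmeas rb.
have fp := radon_finmeas (push_proj_radon hd rb).
have [boo1 boo2] := sqr_lty Y_r1_borel Y_r2_borel fb boo.
have i := push_proj_integral rb.
have c0 (y : Y2) : 0 <= cst 1 y :> R by exact: ler01.
split.
  apply: (hmarg_image_eq fb fp i c0 (@measurable_cst _ _ _ _ _ _) Y_proj_borel
    (borel_comp (@borel_fst X X) Y_x2_borel) Y_r1_borel
    (borel_comp (@borel_fst X X) bx) b1 boo1).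
    by move=> z; rewrite mul1r -/(C_r1 _) Y_proj_r1.
  move=> z z0; apply: Y_proj_x1.
  by rewrite lt_neqAle eq_sym Y_r1_ge0 andbT; apply: contraTneq z0 => ->; rewrite expr0n /= ltxx.
apply: (hmarg_image_eq fb fp i c0 (@measurable_cst _ _ _ _ _ _) Y_proj_borel
    (borel_comp (@borel_snd X X) Y_x2_borel) Y_r2_borel
    (borel_comp (@borel_snd X X) bx) b2 boo2).
  by move=> z; rewrite mul1r -/(C_r2 _) Y_proj_r2.
move=> z z0; apply: Y_proj_x2.
by rewrite lt_neqAle eq_sym Y_r2_ge0 andbT; apply: contraTneq z0 => ->; rewrite expr0n /= ltxx.
Qed.

(** The discarded part has zero cross term. *)
Lemma C_plan_good (a : setfun (C * C)%type R) : C_plan a ->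
  C_plan (restr (good_set d) a) /\
  (\int[restr (good_set d) a]_z (cross d z)%:E = \int[a]_z (cross d z)%:E)%E.
Proof.
move=> pa; have [[ra aoo] h1 h2] := pa; have fa := radon_finmeas ra.
have mg := good_set_borel hd.
have i (h : C * C -> \bar R) : measurable_fun [set: borel (C * C)%type] (h : borel (C * C)%type -> \bar R) ->
    (forall z, 0 <= h z)%E ->
    (\int[restr (good_set d) a]_z h z = \int[a]_z ((\1_(good_set d) z)%:E * h z))%E.
  exact: restr_integral_ind.
have i0 (z : C * C) : 0 <= \1_(good_set d) z :> R by [].
have i1 (z : C * C) : \1_(good_set d) z <= 1 :> R by rewrite indicE lern1 leq_b1.
have mi : measurable_fun [set: borel (C * C)%type] (\1_(good_set d) : borel (C * C)%type -> R).
  exact: measurable_indic.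
have mid : measurable_fun [set: borel (C * C)%type] (id : borel (C * C)%type -> borel (C * C)%type).
  exact: measurable_id.
split.
  apply: (gplan_image bx b1 b2 bx b1 b2 i i0 mi mid pa) => //.
  - exact: restr_radon (C2_hausdorff hd) ra mg.
  - by move=> z; rewrite ler_piMl// sqr_ge0.
  - by move=> z; rewrite ler_piMl// sqr_ge0.
apply: (gcross_image (p := @cone_x2 R X) (r1 := @C_r1 R X) (r2 := @C_r2 R X)
  hd bx b1 b2 (@C_r1_ge0 R X) (@C_r2_ge0 R X) i) => z.
rewrite -[gcross _ _ _ _ _]/(cross d z) indicE.
case: (boolP (z \in _)) => [_|nz]; first by rewrite mul1r.
rewrite mul0r; apply/eqP; rewrite eq_le cross_ge0//= leNgt; apply/negP => c0.
by move/negP : nz; apply; rewrite inE good_setE.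
Qed.

Lemma good_far_null (a : setfun (C * C)%type R) : C_plan a ->
  restr (good_set d) a (far_set d) = 0%E.
Proof.
move=> [[[[m ->] _] _] _ _].
rewrite /restr (_ : _ `&` _ = set0) ?measure0//.
apply/seteqP; split=> // z [[_ /= far] [_ near]].
by have := lt_trans far near; rewrite ltxx.
Qed.

(** The coordinates are continuous off the vertex, so the image is Radon; what the
  restriction discards has a zero radius, hence a zero cross term. *)
Lemma Y_of_C_plan (a : setfun (C * C)%type R) : C_plan a ->
  let b : setfun Y2 R := @push R (C * C)%type Y2 (@cone_y2 R X) (restr (@offvertex2 R X) a) in
  Y_plan b /\ (\int[b]_y (Y_cross y)%:E = \int[a]_z (cross d z)%:E)%E.
Proof.
move=> pa b; have [[ra aoo] h1 h2] := pa; have fa := radon_finmeas ra.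
pose f : C * C -> Y2 := const_off (@offvertex2 R X) (@cone_y2 R X : _ -> Y2).
have cy (z : C * C) : offvertex2 z -> {for z, continuous (@cone_y2 R X : _ -> Y2)}.
  exact: cone_y2_continuous.
have mf : measurable_fun [set: borel (C * C)%type] (f : borel (C * C)%type -> borel Y2).
  exact: (const_off_borel (@open_offvertex2 R X) cy).
have i (h : Y2 -> \bar R) : measurable_fun [set: borel Y2] (h : borel Y2 -> \bar R) ->
    (forall z, 0 <= h z)%E ->
    (\int[b]_z h z = \int[a]_z ((\1_(@offvertex2 R X) z)%:E * h (f z)))%E.
  exact: (push_restr_integral ra (@open_offvertex2 R X) cy).
have rb : radon b.
  exact: (push_restr_radon (C2_hausdorff hd) ra (@open_offvertex2 R X) cy (Y2_hausdorff hd)).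
have mo := open_borel (@open_offvertex2 R X).
have mi : measurable_fun [set: borel (C * C)%type] (\1_(@offvertex2 R X) : borel (C * C)%type -> R).
  exact: measurable_indic.
have i0 (z : C * C) : 0 <= \1_(@offvertex2 R X) z :> R by [].
have fE (z : C * C) : z \in @offvertex2 R X -> f z = cone_y2 z.
  by move=> zo; rewrite /f /const_off zo.
split.
  apply: (gplan_image bx b1 b2 Y_x2_borel Y_r1_borel Y_r2_borel i i0
    mi mf pa rb).
  - move=> z; rewrite indicE; case: (boolP (z \in _)) => zo; rewrite ?mul0r ?sqr_ge0//.
    by rewrite mul1r fE.
  - move=> z; rewrite indicE; case: (boolP (z \in _)) => zo; rewrite ?mul0r ?sqr_ge0//.
    by rewrite mul1r fE.
  - move=> z; rewrite indicE; case: (boolP (z \in _)) => zo; rewrite ?mul0r ?ltxx// => _.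
    by rewrite fE.
  - move=> z; rewrite indicE; case: (boolP (z \in _)) => zo; rewrite ?mul0r ?ltxx// => _.
    by rewrite fE.
apply: (gcross_image (p := @cone_x2 R X) (r1 := @C_r1 R X) (r2 := @C_r2 R X)
  hd Y_x2_borel Y_r1_borel Y_r2_borel (@Y_r1_ge0 R X) (@Y_r2_ge0 R X) i) => z.
rewrite indicE; case: (boolP (z \in _)) => zo; first by rewrite mul1r fE.
rewrite mul0r -[RHS]/(cross d z) crossE.
have [r1|r1] := eqVneq (cone_r z.1) 0; first by rewrite r1 !mul0r.
have [r2|r2] := eqVneq (cone_r z.2) 0; first by rewrite r2 mulr0 mul0r.
exfalso; move/negP : zo; apply; rewrite inE.
by split=> v; [move: r1|move: r2]; rewrite v cone_r_vertex eqxx.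
Qed.

End PlanTransfer.

(** * Completion of the marginals *)

Section Extension.
Context {R : realType} {X : ptopologicalType}.
Variable d : X -> X -> \bar R.
Hypothesis hd : extended_metric_topological d.
Variables (mu1 mu2 : setfun X R).
Hypotheses (rmu1 : radon mu1) (rmu2 : radon mu2).
Local Notation Y1 := (@Y1 R X).
Local Notation Y2 := (@Y2 R X).
Local Notation Y_cross := (Y_cross d).
Local Notation Y_plan := (Y_plan mu1 mu2).

Let hX : hausdorff_space X := emt_hausdorff hd.
Let fmu1 := radon_finmeas rmu1.
Let fmu2 := radon_finmeas rmu2.

Let le_diff (mu nu : setfun X R) : finmeas mu -> finmeas nu -> le_meas nu mu ->
  le_meas (meas_diff mu nu) mu.
Proof.
move=> fm fn le A mA; rewrite meas_diffE//.
by rewrite leeBlDr ?finmeas_fin// leeDl// finmeas_ge0.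
Qed.

Let pair_cst_continuous (S T : ptopologicalType) (c : T) :
  continuous ((fun s => (s, c)) : S -> prodP S T).
Proof.
by move=> s; apply: (@continuous_pair _ _ _ id (cst c) s); [exact: cvg_id|exact: cvg_cst].
Qed.

Let cst_pair_continuous (S T : ptopologicalType) (c : S) :
  continuous ((fun t => (c, t)) : T -> prodP S T).
Proof.
by move=> s; apply: (@continuous_pair _ _ _ (cst c) id s); [exact: cvg_cst|exact: cvg_id].
Qed.

Let o : Y1 := (point, nneg 0).
Let unit_pt (x : X) : Y1 := (x, nneg 1).
Let e1 (x : X) : Y2 := (unit_pt x, o).
Let e2 (x : X) : Y2 := (o, unit_pt x).

Let unit_pt_continuous : continuous unit_pt.
Proof. exact: (@pair_cst_continuous X (halfline R) (nneg 1)). Qed.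

Let e1_continuous : continuous e1.
Proof.
move=> x; exact: (continuous_comp (@unit_pt_continuous x)
  (@pair_cst_continuous Y1 Y1 o (unit_pt x))).
Qed.

Let e2_continuous : continuous e2.
Proof.
move=> x; exact: (continuous_comp (@unit_pt_continuous x)
  (@cst_pair_continuous Y1 Y1 o (unit_pt x))).
Qed.

(** The missing mass [n1 = mu1 - h1 b] is placed on the pairs [((x, 1), o)] and
  [n2 = mu2 - h2 b] on the pairs [(o, (x, 1))], with [o] of radius zero. There
  the cross term vanishes, so its integral is kept. The last conclusion gives
  control of [far_set]. *)
Lemma Y_extend (b : setfun Y2 R) : Y_plan b -> exists b' : setfun Y2 R,
  [/\ radon b' /\ (\int[b']_y (Y_r1 y ^+ 2 + Y_r2 y ^+ 2)%:E < +oo)%E,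
      eq_meas (hmarg (fun y => (Y_x2 y).1) Y_r1 b') mu1,
      eq_meas (hmarg (fun y => (Y_x2 y).2) Y_r2 b') mu2,
      (\int[b']_y (Y_cross y)%:E = \int[b]_y (Y_cross y)%:E)%E &
      forall A : set Y2, (forall y, A y -> 0 < Y_r1 y * Y_r2 y) -> b' A = b A].
Proof.
move=> pb; have [[rb boo] h1 h2] := pb; have fb := radon_finmeas rb.
have [boo1 boo2] := gplan_fin1 Y_r1_borel Y_r2_borel pb.
have hY := Y2_hausdorff hd.
have mx1 := borel_comp (@borel_fst X X) (@Y_x2_borel R X).
have mx2 := borel_comp (@borel_snd X X) (@Y_x2_borel R X).
have fh1 := hmarg_finmeas mx1 Y_r1_borel fb boo1.
have fh2 := hmarg_finmeas mx2 Y_r2_borel fb boo2.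
pose n1 := meas_diff mu1 (hmarg (fun y => (Y_x2 y).1) Y_r1 b).
pose n2 := meas_diff mu2 (hmarg (fun y => (Y_x2 y).2) Y_r2 b).
have fn1 : finmeas n1 by exact: diff_finmeas.
have fn2 : finmeas n2 by exact: diff_finmeas.
have rn1 : radon n1 by apply: radon_dominated rmu1 fn1 _ => //; exact: le_diff.
have rn2 : radon n2 by apply: radon_dominated rmu2 fn2 _ => //; exact: le_diff.
have me1 := continuous_borel e1_continuous.
have me2 := continuous_borel e2_continuous.
pose q1 : setfun Y2 R := @push R X Y2 e1 n1.
pose q2 : setfun Y2 R := @push R X Y2 e2 n2.
have rq1 : radon q1.
  exact: (lusin_radon hX hY rn1 me1 (lusin_continuous hX rn1 e1_continuous)).
have rq2 : radon q2.
  exact: (lusin_radon hX hY rn2 me2 (lusin_continuous hX rn2 e2_continuous)).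
have fq1 := radon_finmeas rq1; have fq2 := radon_finmeas rq2.
pose b1 : setfun Y2 R := fun A => (b A + q1 A)%E.
have rb1 : radon b1 by exact: add_radon.
pose b' : setfun Y2 R := fun A => (b1 A + q2 A)%E.
have rb' : radon b' by exact: add_radon.
have int' (h : Y2 -> \bar R) : measurable_fun [set: borel Y2] (h : borel Y2 -> \bar R) ->
    (forall y, 0 <= h y)%E ->
    (\int[b']_y h y = \int[b]_y h y + \int[n1]_x h (e1 x) + \int[n2]_x h (e2 x))%E.
  move=> mh h0; rewrite (add_integral (radon_finmeas rb1) fq2 mh h0).
  rewrite (add_integral fb fq1 mh h0).
  by rewrite (push_integral fn1 me1 mh h0) (push_integral fn2 me2 mh h0).
have r1e1 x : Y_r1 (e1 x) = 1 by rewrite -[LHS]/(hval (nneg 1)) hval_nneg normr1.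
have r2e1 x : Y_r2 (e1 x) = 0 by rewrite -[LHS]/(hval (nneg 0)) hval_nneg normr0.
have r1e2 x : Y_r1 (e2 x) = 0 by rewrite -[LHS]/(hval (nneg 0)) hval_nneg normr0.
have r2e2 x : Y_r2 (e2 x) = 1 by rewrite -[LHS]/(hval (nneg 1)) hval_nneg normr1.
have int0 (n : setfun X R) (f : X -> R) : finmeas n -> (forall x, f x = 0) ->
    (\int[n]_x (f x)%:E = 0)%E.
  by move=> [m ->] f0; rewrite integral0_eq// => x _; rewrite f0.
have int1 (n : setfun X R) (f : X -> R) (A : set (borel X)) : finmeas n -> measurable A ->
    (forall x, f x = \1_A x) -> (\int[n]_x (f x)%:E = n A)%E.
  move=> [m ->] mA f1; under eq_integral do rewrite f1.
  by rewrite integral_indic// setIT.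
have ms : measurable_fun [set: borel Y2]
    ((fun y => (Y_r1 y ^+ 2 + Y_r2 y ^+ 2)%:E) : borel Y2 -> \bar R).
  by apply/measurable_EFinP; apply: measurable_funD; apply: measurable_funX;
    [exact: Y_r1_borel|exact: Y_r2_borel].
have b'oo : (\int[b']_y (Y_r1 y ^+ 2 + Y_r2 y ^+ 2)%:E < +oo)%E.
  rewrite int'//; last by move=> y; rewrite lee_fin addr_ge0// sqr_ge0.
  have mT := @measurableT _ (borel X).
  rewrite (int1 n1 _ setT)//; last first.
    by move=> x; rewrite r1e1 r2e1 expr1n expr0n addr0 indicT.
  rewrite (int1 n2 _ setT)//; last first.
    by move=> x; rewrite r1e2 r2e2 expr1n expr0n add0r indicT.
  have nT (n : setfun X R) : finmeas n -> (n setT < +oo)%E.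
    by move=> fn; rewrite ltey_eq finmeas_fin.
  by apply: lte_add_pinfty; [apply: lte_add_pinfty; [exact: boo|exact: nT]|exact: nT].
have fb' := radon_finmeas rb'.
have [b'oo1 b'oo2] := sqr_lty Y_r1_borel Y_r2_borel fb' b'oo.
have mind (x : Y2 -> X) (r : Y2 -> R) (A : set (borel X)) :
    measurable_fun [set: borel Y2] (x : borel Y2 -> borel X) ->
    measurable_fun [set: borel Y2] (r : borel Y2 -> R) -> measurable A ->
    measurable_fun [set: borel Y2] ((fun y => (r y ^+ 2 * \1_A (x y))%:E) : borel Y2 -> \bar R).
  move=> mx mr mA; apply/measurable_EFinP; apply: measurable_funM.
    exact: measurable_funX.
  by apply: (@borel_comp _ _ _ _ (\1_A : X -> R)).
have ind0 (x : Y2 -> X) (r : Y2 -> R) (A : set (borel X)) y :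
    (0 <= (r y ^+ 2 * \1_A (x y))%:E)%E.
  by rewrite lee_fin mulr_ge0// sqr_ge0.
exists b'; split.
- by split.
- move=> A mA; rewrite (hmargE mx1 Y_r1_borel fb' b'oo1 mA).
  rewrite int'; [|exact: (mind _ _ A mx1 Y_r1_borel)|exact: (ind0 (fun y => (Y_x2 y).1) Y_r1 A)].
  rewrite (int1 n1 _ A)//; last by move=> x; rewrite r1e1 expr1n mul1r.
  rewrite (int0 n2)//; last by move=> x; rewrite r1e2 expr0n mul0r.
  rewrite adde0 -(hmargE mx1 Y_r1_borel fb boo1 mA).
  by rewrite /n1 meas_diffE// addeC subeK// finmeas_fin.
- move=> A mA; rewrite (hmargE mx2 Y_r2_borel fb' b'oo2 mA).
  rewrite int'; [|exact: (mind _ _ A mx2 Y_r2_borel)|exact: (ind0 (fun y => (Y_x2 y).2) Y_r2 A)].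
  rewrite (int0 n1)//; last by move=> x; rewrite r2e1 expr0n mul0r.
  rewrite (int1 n2 _ A)//; last by move=> x; rewrite r2e2 expr1n mul1r.
  rewrite adde0 -(hmargE mx2 Y_r2_borel fb boo2 mA).
  by rewrite /n2 meas_diffE// addeC subeK// finmeas_fin.
- rewrite int'.
  + rewrite (int0 n1)//; last by move=> x; rewrite /Y_cross /gcross r2e1 mulr0 mul0r.
    rewrite (int0 n2)//; last by move=> x; rewrite /Y_cross /gcross r1e2 !mul0r.
    by rewrite !adde0.
  + by apply/measurable_EFinP; exact: Y_cross_borel.
  + by move=> y; rewrite lee_fin (gcross_ge0 hd) //; [exact: Y_r1_ge0|exact: Y_r2_ge0].
- move=> A Ar; rewrite /b' /b1 /q1 /q2 /push /pushforward.
  rewrite (_ : e1 @^-1` A = set0); last first.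
    by apply/seteqP; split=> // x /= /Ar; rewrite r2e1 mulr0 ltxx.
  rewrite (_ : e2 @^-1` A = set0); last first.
    by apply/seteqP; split=> // x /= /Ar; rewrite r1e2 mul0r ltxx.
  by case: fn1 => m1 ->; case: fn2 => m2 ->; rewrite !measure0 !adde0.
Qed.

End Extension.

(** * Scalar entropy inequalities *)

Section EntropyInequalities.
Context {R : realType}.

Lemma ln_le_sub1 (t : R) : 0 < t -> ln t <= t - 1 ?= iff (t == 1).
Proof.
move=> t0; split.
  have := @le_ln1Dx R (t - 1); rewrite (addrC 1) subrK; apply; lra.
apply/idP/eqP => [/eqP e|->]; last by rewrite ln1 subrr.
apply/eqP; apply/negPn/negP => t1.
have : ln t != 0 by rewrite ln_eq0.
move=> /expR_gt1Dx; rewrite lnK ?posrE// e addrC subrK ltxx//.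
Qed.

Lemma entropy_ge0 (s : R) : 0 <= s -> 0 <= entropy s.
Proof.
rewrite le_eqVlt => /predU1P[<-|s0]; first by rewrite /entropy mul0r subrr add0r.
have si : 0 < s^-1 by rewrite invr_gt0.
have [+ _] := ln_le_sub1 si; rewrite lnV ?posrE// => h.
have : s * - ln s <= s * (s^-1 - 1) by rewrite ler_pM2l.
rewrite mulrBr mulfV ?gt_eqF// /entropy; lra.
Qed.

(** If [s] is the density of [nu] in [mu], this is the density in [nu] of the part
  of the entropy that lies where [s] is positive. *)
Definition rel_entropy (s : R) : R := s^-1 * entropy s.

Lemma rel_entropy_ge0 s : 0 <= s -> 0 <= rel_entropy s.
Proof. by move=> s0; rewrite mulr_ge0 ?invr_ge0// entropy_ge0. Qed.

Lemma rel_entropyE s : 0 < s -> rel_entropy s = ln s - 1 + s^-1.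
Proof.
move=> s0; rewrite /rel_entropy /entropy; field.
by rewrite gt_eqF.
Qed.

Let lnM3 (x y z : R) : 0 < x -> 0 < y -> 0 < z ->
  ln (x * y * z) = ln x + ln y + ln z.
Proof. by move=> x0 y0 z0; rewrite lnM ?posrE ?mulr_gt0// lnM ?posrE. Qed.

(** The difference of the two sides is the sum over [i] of [t - 1 - ln t] at
  [t = s_i r_i ^+ 2], since [ln (k ^+ 2) = - ln (r1 ^+ 2) - ln (r2 ^+ 2)]. *)
Lemma dual_inequality (s1 s2 r1 r2 k : R) : 0 < s1 -> 0 < s2 ->
  0 <= r1 -> 0 <= r2 -> 0 <= k -> r1 * r2 * k = 1 ->
  rel_entropy s1 + rel_entropy s2 - ln (k ^+ 2) + 4 <=
    s1^-1 + s2^-1 + s1 * r1 ^+ 2 + s2 * r2 ^+ 2 /\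
  (rel_entropy s1 + rel_entropy s2 - ln (k ^+ 2) + 4 =
    s1^-1 + s2^-1 + s1 * r1 ^+ 2 + s2 * r2 ^+ 2 ->
   s1 * r1 ^+ 2 = 1 /\ s2 * r2 ^+ 2 = 1).
Proof.
move=> s10 s20; rewrite !le_eqVlt => /predU1P[<-|r10].
  by move=> _ _; rewrite !mul0r => /esym/eqP; rewrite oner_eq0.
move=> /predU1P[<-|r20].
  by move=> _; rewrite mulr0 mul0r => /esym/eqP; rewrite oner_eq0.
move=> /predU1P[<-|k0]; first by rewrite mulr0 => /esym/eqP; rewrite oner_eq0.
move=> e.
have kE : ln (k ^+ 2) = - ln (r1 ^+ 2) - ln (r2 ^+ 2).
  have : ln (r1 ^+ 2 * r2 ^+ 2 * k ^+ 2) = 0.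
    by rewrite -!exprMn e expr1n ln1.
  by rewrite lnM3 ?exprn_gt0//; lra.
have t10 : 0 < s1 * r1 ^+ 2 by rewrite mulr_gt0// exprn_gt0.
have t20 : 0 < s2 * r2 ^+ 2 by rewrite mulr_gt0// exprn_gt0.
have l1 : ln (s1 * r1 ^+ 2) = ln s1 + ln (r1 ^+ 2) by rewrite lnM ?posrE ?exprn_gt0.
have l2 : ln (s2 * r2 ^+ 2) = ln s2 + ln (r2 ^+ 2) by rewrite lnM ?posrE ?exprn_gt0.
have [i1 e1] := ln_le_sub1 t10; have [i2 e2] := ln_le_sub1 t20.
rewrite !rel_entropyE// kE; split; first by lra.
move=> eq; split; apply/eqP; [rewrite -e1|rewrite -e2]; apply/eqP; lra.
Qed.

(** The difference of the two sides is twice [c - 1 - ln c]. *)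
Lemma primal_inequality (s1 s2 q1 q2 k : R) : 0 < s1 -> 0 < s2 -> 0 < k ->
  0 <= q1 -> 0 <= q2 -> q1 * s1 = 1 -> q2 * s2 = 1 ->
  let c := Num.sqrt q1 * Num.sqrt q2 * k in
  s1^-1 + s2^-1 <= rel_entropy s1 + rel_entropy s2 - ln (k ^+ 2) + 2 * c /\
  (s1^-1 + s2^-1 = rel_entropy s1 + rel_entropy s2 - ln (k ^+ 2) + 2 * c -> c = 1).
Proof.
move=> s10 s20 k0 q10 q20 e1 e2 c.
have q1p : 0 < q1.
  by rewrite lt_neqAle q10 andbT; apply: contra_eq_neq e1 => <-; rewrite mul0r eq_sym oner_eq0.
have q2p : 0 < q2.
  by rewrite lt_neqAle q20 andbT; apply: contra_eq_neq e2 => <-; rewrite mul0r eq_sym oner_eq0.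
have c0 : 0 < c by rewrite /c !mulr_gt0// sqrtr_gt0.
have cE : 2 * ln c = ln (k ^+ 2) - ln s1 - ln s2.
  have -> : 2 * ln c = ln (c ^+ 2) by rewrite lnXn// mulr_natl.
  have : ln (c ^+ 2 * s1 * s2) = ln (k ^+ 2).
    congr ln; rewrite /c !exprMn !sqr_sqrtr//.
    transitivity ((q1 * s1) * (q2 * s2) * k ^+ 2); first by ring.
    by rewrite e1 e2 !mul1r.
  by rewrite lnM3 ?exprn_gt0//; lra.
have [i e] := ln_le_sub1 c0.
rewrite !rel_entropyE//; split; first by lra.
by move=> eq; apply/eqP; rewrite -e; apply/eqP; lra.
Qed.

End EntropyInequalities.

(** * Densities of the marginals *)

Section Densities.
Context {R : realType} {X : ptopologicalType}.
Variables (nu mu : setfun X R).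
Hypotheses (fnu : finmeas nu) (fmu : finmeas mu).
Local Open Scope ereal_scope.

Lemma rn_densityP : nu `<< mu ->
  borel_nonneg (rn_density nu mu) /\ eq_meas nu (weight (rn_density nu mu) mu).
Proof.
move=> ac; apply: (@xgetPex _ (fun=> 0%R)
  [set s | borel_nonneg s /\ eq_meas nu (weight s mu)]).
case: (fmu) (fnu) ac => m mE [n nE]; rewrite mE nE => ac.
have [f [f0 ffin fi fE]] := radon_nikodym_sigma_finite ac.
exists (fine \o f); split; first split.
- by apply: measurableT_comp => //; exact: measurable_int fi.
- by move=> x; exact: fine_ge0.
move=> A mA; rewrite fE//; apply: eq_integral => x _.
by rewrite /= fineK.
Qed.

Section WithDensity.
Variable s : X -> R.
Hypotheses (bs : borel_nonneg s) (nuE : eq_meas nu (weight s mu)).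

Lemma density_total : \int[mu]_x (s x)%:E = nu setT.
Proof. by rewrite nuE. Qed.

Lemma density_lty : \int[mu]_x (s x)%:E < +oo.
Proof. by rewrite density_total ltey_eq finmeas_fin. Qed.

Lemma density_integral (g : X -> \bar R) :
  measurable_fun [set: borel X] (g : borel X -> \bar R) -> (forall x, 0 <= g x) ->
  \int[nu]_x g x = \int[mu]_x ((s x)%:E * g x).
Proof.
move=> mg g0; have lty := density_lty.
have fw := weight_finmeas fmu bs lty.
by rewrite (eq_meas_integral _ fnu fw nuE) weight_integral.
Qed.

Let m0 : measurable ([set x | s x = 0%R] : set (borel X)).
Proof.
have [ms _] := bs; rewrite -[X in measurable X]setTI.
exact: (ms measurableT [set 0%R] (measurable_set1 _)).
Qed.

(** This part of [mu] contributes its full mass to the entropy, since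
  [entropy 0 = 1]. *)
Definition lost_mass : \bar R := mu [set x | s x = 0%R].

(** Serves for the entropy, with [g = entropy s], and for the total mass, with
  [g = 1]; the lost masses then cancel when the two are compared. *)
Lemma density_split (g h : X -> R) : (forall x, 0 <= g x)%R ->
  measurable_fun [set: borel X] (g : borel X -> R) ->
  measurable_fun [set: borel X] (h : borel X -> R) ->
  (forall x, 0 <= h x)%R ->
  (forall x, s x = 0%R -> g x = 1%R) -> (forall x, (0 < s x)%R -> g x = (s x * h x)%R) ->
  \int[mu]_x (g x)%:E = lost_mass + \int[nu]_x (h x)%:E.
Proof.
move=> g0 mg mh h0 g1 gh; have [ms s0] := bs.
rewrite density_integral//; last exact/measurable_EFinP.
have mi : measurable_fun [set: borel X] (\1_[set x | s x = 0%R] : borel X -> R).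
  exact: measurable_indic.
rewrite (_ : (\int[mu]_x (g x)%:E)%E =
    \int[mu]_x ((\1_[set x | s x = 0%R] x)%:E + (s x)%:E * (h x)%:E)); last first.
  apply: eq_integralT => x; rewrite -EFinM -EFinD indicE.
  have [sx|sx] := eqVneq (s x) 0%R.
    by rewrite mem_set// g1// sx mul0r addr0.
  rewrite memNset//; last by move=> /= e; rewrite e eqxx in sx.
  by rewrite add0r gh// lt_neqAle eq_sym sx s0.
case: fmu => m mE; rewrite /lost_mass mE ge0_integralD//.
- by rewrite integral_indic// setIT.
- exact/measurable_EFinP.
- by move=> x _; rewrite mule_ge0// lee_fin.
- by apply: emeasurable_funM; exact/measurable_EFinP.
Qed.

Lemma density_pos : {ae nu, forall x, (0 < s x)%R}.
Proof.
have [_ s0] := bs; have nu0 : nu [set x | s x = 0%R] = 0.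
  rewrite nuE// /weight; case: fmu => m ->.
  by apply: integral0_eq => x /= ->.
case: fnu nu0 => n -> n0; exists [set x | s x = 0%R]; split => // x /= h.
by apply: contrapT => sx; apply: h; rewrite lt_neqAle eq_sym s0 andbT; exact/eqP.
Qed.

Let mV : measurable_fun [set: borel X] ((fun x => (s x)^-1)%R : borel X -> R).
Proof. by have [ms _] := bs; exact: measurableT_comp (@measurable_invr R) ms. Qed.

Let ment : measurable_fun [set: borel X] ((fun x => entropy (s x)) : borel X -> R).
Proof.
have [ms _] := bs; apply: measurable_funD => //; apply: measurable_funB => //.
by apply: measurable_funM => //; exact: measurableT_comp.
Qed.

Lemma rel_entropy_borel :
  measurable_fun [set: borel X] ((fun x => rel_entropy (s x)) : borel X -> R).
Proof. exact: measurable_funM. Qed.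

Lemma inv_density_borel :
  measurable_fun [set: borel X] ((fun x => (s x)^-1)%R : borel X -> R).
Proof. exact: mV. Qed.

Lemma entropy_split :
  \int[mu]_x (entropy (s x))%:E = lost_mass + \int[nu]_x (rel_entropy (s x))%:E.
Proof.
have [ms s0] := bs; apply: density_split => //.
- by move=> x; exact: entropy_ge0.
- exact: rel_entropy_borel.
- by move=> x; exact: rel_entropy_ge0.
- by move=> x ->; rewrite /entropy mul0r subrr add0r.
- by move=> x sx; rewrite /rel_entropy mulrA mulfV ?mul1r// gt_eqF.
Qed.

Lemma mass_split : mu setT = lost_mass + \int[nu]_x ((s x)^-1)%:E.
Proof.
have [ms s0] := bs; rewrite -(density_split (g := cst 1%R))//.
- by case: fmu => m ->; rewrite -[LHS]mul1e -integral_cst.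
- by move=> x; rewrite invr_ge0.
- by move=> x sx; rewrite mulfV// gt_eqF.
Qed.

Lemma lost_mass_fin : lost_mass \is a fin_num.
Proof. exact: finmeas_fin. Qed.

End WithDensity.
End Densities.

(** * Two bounds for entropy-transport costs *)

Section LETBounds.
Context {R : realType} {X Z : ptopologicalType}.
Variable d : X -> X -> \bar R.
Hypothesis hd : extended_metric_topological d.
Variables (mu1 mu2 : setfun X R).
Hypotheses (fmu1 : finmeas mu1) (fmu2 : finmeas mu2).
Variables (p : Z -> X * X) (r1 r2 : Z -> R).
Hypothesis mp : measurable_fun [set: borel Z] (p : borel Z -> borel (X * X)%type).
Hypothesis mr1 : measurable_fun [set: borel Z] (r1 : borel Z -> R).
Hypothesis mr2 : measurable_fun [set: borel Z] (r2 : borel Z -> R).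
Hypothesis r1_ge0 : forall z, 0 <= r1 z.
Hypothesis r2_ge0 : forall z, 0 <= r2 z.
Variable b : setfun Z R.
Hypothesis pb : gplan mu1 mu2 p r1 r2 b.

Let g : setfun (X * X)%type R := @push R Z (X * X)%type p b.
Hypotheses (ac1 : marg1 g `<< mu1) (ac2 : marg2 g `<< mu2).

Let s1 := rn_density (marg1 g) mu1.
Let s2 := rn_density (marg2 g) mu2.
Let x1 z := (p z).1.
Let x2 z := (p z).2.
Let k z := cosd d (pi / 2) (p z).
Let cr := gcross d p r1 r2.

Let fb : finmeas b. Proof. by case: pb => -[rb _] _ _; exact: radon_finmeas. Qed.
Let FF := finmeas_ae fb.

Let mx1 : measurable_fun [set: borel Z] (x1 : borel Z -> borel X).
Proof. exact: borel_comp (@borel_fst X X) mp. Qed.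

Let mx2 : measurable_fun [set: borel Z] (x2 : borel Z -> borel X).
Proof. exact: borel_comp (@borel_snd X X) mp. Qed.

Let g1E : marg1 g = push x1 b. Proof. by []. Qed.
Let g2E : marg2 g = push x2 b. Proof. by []. Qed.

Let fg1 : finmeas (marg1 g). Proof. exact: (push_finmeas fb mx1). Qed.
Let fg2 : finmeas (marg2 g). Proof. exact: (push_finmeas fb mx2). Qed.

Let bs1 : borel_nonneg s1. Proof. by have [] := rn_densityP fg1 fmu1 ac1. Qed.
Let bs2 : borel_nonneg s2. Proof. by have [] := rn_densityP fg2 fmu2 ac2. Qed.
Let gE1 : eq_meas (marg1 g) (weight s1 mu1).
Proof. by have [] := rn_densityP fg1 fmu1 ac1. Qed.
Let gE2 : eq_meas (marg2 g) (weight s2 mu2).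
Proof. by have [] := rn_densityP fg2 fmu2 ac2. Qed.

Let A1 := lost_mass mu1 s1.
Let A2 := lost_mass mu2 s2.
Let fA1 : A1 \is a fin_num. Proof. exact: lost_mass_fin. Qed.
Let fA2 : A2 \is a fin_num. Proof. exact: lost_mass_fin. Qed.

Let pos1 : {ae b, forall z, 0 < s1 (x1 z)}.
Proof.
have := density_pos fg1 fmu1 bs1 gE1; rewrite g1E => -[N [mN N0 sN]].
exists (x1 @^-1` N); split=> //; last by move=> z; exact: sN.
by rewrite -[X in measurable X]setTI; exact: mx1.
Qed.

Let pos2 : {ae b, forall z, 0 < s2 (x2 z)}.
Proof.
have := density_pos fg2 fmu2 bs2 gE2; rewrite g2E => -[N [mN N0 sN]].
exists (x2 @^-1` N); split=> //; last by move=> z; exact: sN.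
by rewrite -[X in measurable X]setTI; exact: mx2.
Qed.

Let comp1 (h : X -> R) : measurable_fun [set: borel X] (h : borel X -> R) ->
  measurable_fun [set: borel Z] ((fun z => h (x1 z)) : borel Z -> R).
Proof. by move=> mh; exact: borel_comp mh mx1. Qed.

Let comp2 (h : X -> R) : measurable_fun [set: borel X] (h : borel X -> R) ->
  measurable_fun [set: borel Z] ((fun z => h (x2 z)) : borel Z -> R).
Proof. by move=> mh; exact: borel_comp mh mx2. Qed.

Let int1 (h : X -> R) : measurable_fun [set: borel X] (h : borel X -> R) ->
  (forall x, 0 <= h x) -> (\int[marg1 g]_x (h x)%:E = \int[b]_z (h (x1 z))%:E)%E.
Proof. by move=> mh h0; rewrite g1E push_integral//; exact/measurable_EFinP. Qed.

Let int2 (h : X -> R) : measurable_fun [set: borel X] (h : borel X -> R) ->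
  (forall x, 0 <= h x) -> (\int[marg2 g]_x (h x)%:E = \int[b]_z (h (x2 z))%:E)%E.
Proof. by move=> mh h0; rewrite g2E push_integral//; exact/measurable_EFinP. Qed.

Let add (h l : Z -> \bar R) :
  measurable_fun [set: borel Z] (h : borel Z -> \bar R) -> (forall z, 0 <= h z)%E ->
  measurable_fun [set: borel Z] (l : borel Z -> \bar R) -> (forall z, 0 <= l z)%E ->
  (\int[b]_z (h z + l z) = \int[b]_z h z + \int[b]_z l z)%E.
Proof. by move=> mh h0 ml l0; case: fb => m ->; rewrite ge0_integralD. Qed.

Let rel1 z := (rel_entropy (s1 (x1 z)))%:E.
Let rel2 z := (rel_entropy (s2 (x2 z)))%:E.
Let inv1 z := ((s1 (x1 z))^-1)%:E.
Let inv2 z := ((s2 (x2 z))^-1)%:E.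
Let len z := ell (d (x1 z) (x2 z)).

Let mrel1 : measurable_fun [set: borel Z] (rel1 : borel Z -> \bar R).
Proof. by apply/measurable_EFinP; apply: (comp1 (h := fun x => rel_entropy (s1 x))); exact: rel_entropy_borel. Qed.
Let mrel2 : measurable_fun [set: borel Z] (rel2 : borel Z -> \bar R).
Proof. by apply/measurable_EFinP; apply: (comp2 (h := fun x => rel_entropy (s2 x))); exact: rel_entropy_borel. Qed.
Let minv1 : measurable_fun [set: borel Z] (inv1 : borel Z -> \bar R).
Proof. by apply/measurable_EFinP; apply: (comp1 (h := fun x => (s1 x)^-1)); exact: inv_density_borel. Qed.
Let minv2 : measurable_fun [set: borel Z] (inv2 : borel Z -> \bar R).
Proof. by apply/measurable_EFinP; apply: (comp2 (h := fun x => (s2 x)^-1)); exact: inv_density_borel. Qed.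
Let mlen : measurable_fun [set: borel Z] (len : borel Z -> \bar R).
Proof. exact: borel_comp (ell_borel hd) mp. Qed.
Let mcr : measurable_fun [set: borel Z] ((fun z => (cr z)%:E) : borel Z -> \bar R).
Proof. by apply/measurable_EFinP; exact: gcross_borel. Qed.

Let rel1_ge0 z : (0 <= rel1 z)%E.
Proof. by rewrite lee_fin rel_entropy_ge0//; case: bs1. Qed.
Let rel2_ge0 z : (0 <= rel2 z)%E.
Proof. by rewrite lee_fin rel_entropy_ge0//; case: bs2. Qed.
Let inv1_ge0 z : (0 <= inv1 z)%E.
Proof. by rewrite lee_fin invr_ge0; case: bs1. Qed.
Let inv2_ge0 z : (0 <= inv2 z)%E.
Proof. by rewrite lee_fin invr_ge0; case: bs2. Qed.
Let len_ge0 z : (0 <= len z)%E.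
Proof. exact: (ell_ge0 hd (p z)). Qed.
Let cr_ge0 z : 0 <= cr z.
Proof. exact: gcross_ge0. Qed.

Let L := LET_cost d mu1 mu2 g.

Lemma LET_cost_split : L =
  (A1 + A2 + \int[b]_z (rel1 z + rel2 z + len z))%E.
Proof.
rewrite /L /LET_cost -/s1 -/s2.
rewrite (entropy_split fg1 fmu1 bs1 gE1) (entropy_split fg2 fmu2 bs2 gE2).
rewrite int1; [|exact: rel_entropy_borel|by move=> x; apply: rel_entropy_ge0; case: bs1].
rewrite int2; [|exact: rel_entropy_borel|by move=> x; apply: rel_entropy_ge0; case: bs2].
rewrite (push_integral fb mp (ell_borel hd)); last exact: ell_ge0.
rewrite add//; first 1 last.
- exact: emeasurable_funD.
- by move=> z; rewrite adde_ge0.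
have sh (a1 i1 a2 i2 i3 : \bar R) :
  (a1 + i1 + (a2 + i2) + i3 = a1 + a2 + (i1 + i2 + i3))%E by rewrite addeACA -[LHS]addeA.
by rewrite add//; exact: sh.
Qed.

Lemma masses_split : (mu1 setT + mu2 setT =
  A1 + A2 + \int[b]_z (inv1 z + inv2 z))%E.
Proof.
rewrite (mass_split fg1 fmu1 bs1 gE1) (mass_split fg2 fmu2 bs2 gE2).
rewrite int1; [|exact: inv_density_borel|by move=> x; rewrite invr_ge0; case: bs1].
rewrite int2; [|exact: inv_density_borel|by move=> x; rewrite invr_ge0; case: bs2].
have sh (a1 i1 a2 i2 : \bar R) : (a1 + i1 + (a2 + i2) = a1 + a2 + (i1 + i2))%E.
  by rewrite addeACA.
by rewrite add//; exact: sh.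
Qed.

Let fM1 := finmeas_fin fmu1 (@measurableT _ (borel X)).
Let fM2 := finmeas_fin fmu2 (@measurableT _ (borel X)).

Let finI : (\int[b]_z (inv1 z + inv2 z))%E \is a fin_num.
Proof.
have : (mu1 setT + mu2 setT)%E \is a fin_num by rewrite fin_numD fM1 fM2.
by rewrite masses_split fin_numD => /andP[].
Qed.

Variable u : R.
Hypothesis intu : (\int[b]_z (cr z)%:E)%E = u%:E.

Let finG (h : Z -> \bar R) : (forall z, 0 <= h z)%E -> (0 <= \int[b]_z h z)%E.
Proof. by move=> h0; case: fb => m ->; apply: integral_ge0. Qed.

(** The pointwise inequality [dual_inequality] is integrated. Because the cross
  term is [1], both [u] and the masses of [marg1 g], [marg2 g] are the mass of
  [b], and [h_i b <= mu_i] gives [\int s_i r_i ^+ 2 <= \int s_i dmu_i = u]. *)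
Lemma LET_upper : {ae b, forall z, cr z = 1} ->
  (L <= value mu1 mu2 u)%E /\
  ((value mu1 mu2 u <= L)%E ->
   {ae b, forall z, s1 (x1 z) * r1 z ^+ 2 = 1 /\ s2 (x2 z) * r2 z ^+ 2 = 1}).
Proof.
move=> cr1; have FFb := FF.
have bT : b setT = u%:E.
  rewrite -intu; transitivity (\int[b]_z (cst 1%E z))%E.
    by case: fb => m ->; rewrite integral_cst// mul1e.
  case: fb cr1 => m -> cr1; apply: ae_eq_integral => //.
  by case: cr1 => N [mN N0 sN]; exists N; split=> // z /= h; apply: sN => /= e; apply: h => _; rewrite e.
have [boo1 boo2] := gplan_fin1 mr1 mr2 pb.
case: (pb) => -[rb _] h1 h2.
have [ms1 s10] := bs1; have [ms2 s20] := bs2.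
pose w1 z := (s1 (x1 z) * r1 z ^+ 2)%:E; pose w2 z := (s2 (x2 z) * r2 z ^+ 2)%:E.
have mw1 : measurable_fun [set: borel Z] (w1 : borel Z -> \bar R).
  apply/measurable_EFinP; apply: measurable_funM; first exact: comp1.
  exact: measurable_funX.
have mw2 : measurable_fun [set: borel Z] (w2 : borel Z -> \bar R).
  apply/measurable_EFinP; apply: measurable_funM; first exact: comp2.
  exact: measurable_funX.
have w1_ge0 z : (0 <= w1 z)%E by rewrite lee_fin mulr_ge0// sqr_ge0.
have w2_ge0 z : (0 <= w2 z)%E by rewrite lee_fin mulr_ge0// sqr_ge0.
have iw1 : (\int[b]_z w1 z <= u%:E)%E.
  have -> : (\int[b]_z w1 z = \int[hmarg x1 r1 b]_x (s1 x)%:E)%E.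
    rewrite hmarg_integral//; last exact/measurable_EFinP.
    by apply: eq_integralT => z; rewrite /w1 -EFinM mulrC.
  apply: (le_trans (le_meas_integral (hmarg_finmeas mx1 mr1 fb boo1) fmu1 h1 _ _)).
  - exact/measurable_EFinP.
  - by move=> x; rewrite lee_fin.
  by rewrite (density_total gE1) g1E -bT.
have iw2 : (\int[b]_z w2 z <= u%:E)%E.
  have -> : (\int[b]_z w2 z = \int[hmarg x2 r2 b]_x (s2 x)%:E)%E.
    rewrite hmarg_integral//; last exact/measurable_EFinP.
    by apply: eq_integralT => z; rewrite /w2 -EFinM mulrC.
  apply: (le_trans (le_meas_integral (hmarg_finmeas mx2 mr2 fb boo2) fmu2 h2 _ _)).
  - exact/measurable_EFinP.
  - by move=> x; rewrite lee_fin.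
  by rewrite (density_total gE2) g2E -bT.
(* The constant integrates to [4 u]: the bounds on [w1] and [w2] absorb [2 u], and
   [value u] needs the other [2 u]. *)
pose f z := (rel1 z + rel2 z + len z + 4%:E)%E.
pose h z := (inv1 z + inv2 z + (w1 z + w2 z))%E.
have key : {ae b, forall z, (f z <= h z)%E /\
    (f z = h z -> s1 (x1 z) * r1 z ^+ 2 = 1 /\ s2 (x2 z) * r2 z ^+ 2 = 1)}.
  apply: filterS3 pos1 pos2 cr1 => z z1 z2 zc.
  have kz : 0 < cosd d (pi / 2) (p z).
    rewrite lt_neqAle cosd_half_ge0// andbT eq_sym; apply/eqP => k0.
    by move: zc; rewrite /cr /gcross k0 mulr0 => /esym/eqP; rewrite oner_eq0.
  rewrite /f /h /len [ell _](ell_lt hd kz) /rel1 /rel2 /inv1 /inv2 /w1 /w2.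
  have [le eq] := dual_inequality z1 z2 (r1_ge0 z) (r2_ge0 z) (ltW kz) zc.
  rewrite -!EFinD !lee_fin; split; first by lra.
  by move=> [] e; apply: eq; lra.
have mf : measurable_fun [set: borel Z] (f : borel Z -> \bar R).
  by apply: emeasurable_funD => //; apply: emeasurable_funD => //; exact: emeasurable_funD.
have mh : measurable_fun [set: borel Z] (h : borel Z -> \bar R).
  by apply: emeasurable_funD; exact: emeasurable_funD.
have f0 z : (0 <= f z)%E by rewrite !adde_ge0.
have h0 z : (0 <= h z)%E by rewrite !adde_ge0.
have fE : (\int[b]_z f z = \int[b]_z (rel1 z + rel2 z + len z) + (4 * u)%:E)%E.
  have mJ : measurable_fun [set: borel Z] ((fun z => rel1 z + rel2 z + len z)%E : borel Z -> \bar R).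
    by apply: emeasurable_funD => //; exact: emeasurable_funD.
  have J0 z : (0 <= rel1 z + rel2 z + len z)%E by rewrite !adde_ge0.
  have m4 : measurable_fun [set: borel Z] (cst 4%:E : borel Z -> \bar R) by exact: measurable_cst.
  have p4 (z : Z) : (0 <= cst 4%:E z :> \bar R)%E by rewrite lee_fin.
  rewrite /f (@add (fun z => rel1 z + rel2 z + len z)%E (cst 4%:E) mJ J0 m4 p4).
  have i4 : (\int[b]_z cst 4%:E z = 4%:E * b setT)%E.
    by case: fb => m ->; exact: integral_cst.
  by rewrite i4 bT.
have hE : (\int[b]_z h z = \int[b]_z (inv1 z + inv2 z) +
    (\int[b]_z w1 z + \int[b]_z w2 z))%E.
  rewrite /h (@add (fun z => inv1 z + inv2 z)%E (fun z => w1 z + w2 z)%E).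
  - by rewrite (@add w1 w2).
  - exact: emeasurable_funD.
  - by move=> z; rewrite adde_ge0.
  - exact: emeasurable_funD.
  - by move=> z; rewrite adde_ge0.
have fw1 : (\int[b]_z w1 z)%E \is a fin_num.
  by rewrite ge0_fin_numE ?finG// (le_lt_trans iw1)// ltry.
have fw2 : (\int[b]_z w2 z)%E \is a fin_num.
  by rewrite ge0_fin_numE ?finG// (le_lt_trans iw2)// ltry.
have finh : (\int[b]_z h z)%E \is a fin_num by rewrite hE fin_numD finI fin_numD fw1 fw2.
have fh : (\int[b]_z f z <= \int[b]_z h z)%E.
  by apply: ae_le_integral => //; apply: filterS key => z [].
have finf : (\int[b]_z f z)%E \is a fin_num.
  rewrite ge0_fin_numE ?finG// (le_lt_trans fh)//.
  by rewrite -ge0_fin_numE ?finG.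
have finJ : (\int[b]_z (rel1 z + rel2 z + len z))%E \is a fin_num.
  by move: finf; rewrite fE fin_numD => /andP[].
have ms := masses_split.
rewrite LET_cost_split; split.
  move: fh ms iw1 iw2; rewrite fE hE /value.
  rewrite -(fineK fA1) -(fineK fA2) -(fineK finJ) -(fineK finI) -(fineK fw1) -(fineK fw2).
  rewrite -(fineK fM1) -(fineK fM2) -!EFinD !lee_fin => fh [ms] i1 i2 /=; lra.
move=> ge.
have hf : (\int[b]_z h z <= \int[b]_z f z)%E.
  move: ge ms iw1 iw2; rewrite fE hE /value.
  rewrite -(fineK fA1) -(fineK fA2) -(fineK finJ) -(fineK finI) -(fineK fw1) -(fineK fw2).
  rewrite -(fineK fM1) -(fineK fM2) -!EFinD !lee_fin /= => ge [ms] i1 i2; lra.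
have ae : {ae b, forall z, f z = h z}.
  apply: ae_eq_of_integral_le => //; first by apply: filterS key => z [].
  by rewrite ltey_eq finf.
by apply: filterS2 key ae => z [_ e] /e.
Qed.

(** The pointwise inequality [primal_inequality] is integrated. Where the cosine
  vanishes it holds because [ell] is infinite. *)
Lemma LET_lower (q1 q2 : X -> R) :
  (forall z, r1 z = Num.sqrt (q1 (x1 z))) -> (forall z, r2 z = Num.sqrt (q2 (x2 z))) ->
  (forall x, 0 <= q1 x) -> (forall x, 0 <= q2 x) ->
  {ae b, forall z, q1 (x1 z) * s1 (x1 z) = 1} ->
  {ae b, forall z, q2 (x2 z) * s2 (x2 z) = 1} ->
  (value mu1 mu2 u <= L)%E /\
  ((L <= value mu1 mu2 u)%E -> {ae b, forall z, cr z = 1}).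
Proof.
move=> r1E r2E q10 q20 qs1 qs2; have FFb := FF.
pose f z := (inv1 z + inv2 z)%E.
pose h z := (rel1 z + rel2 z + len z + (2 * cr z)%:E)%E.
have c0 z : (0 <= (2 * cr z)%:E)%E by rewrite lee_fin mulr_ge0.
have mc : measurable_fun [set: borel Z] ((fun z => (2 * cr z)%:E) : borel Z -> \bar R).
  by apply/measurable_EFinP; apply: measurable_funM => //; exact/measurable_EFinP.
have key : {ae b, forall z, (f z <= h z)%E /\ (f z = h z -> cr z = 1)}.
  have qs : {ae b, forall z, q1 (x1 z) * s1 (x1 z) = 1 /\ q2 (x2 z) * s2 (x2 z) = 1}.
    by apply: filterS2 qs1 qs2 => z.
  apply: filterS3 pos1 pos2 qs => z z1 z2 [q1z q2z].
  have [kz|kz] := pselect (0 < cosd d (pi / 2) (p z)); last first.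
    rewrite /f /h /len [ell _](ell_ge hd kz) /rel1 /rel2 /inv1 /inv2.
    by rewrite -!EFinD addey// addye// leey; split.
  rewrite /f /h /len [ell _](ell_lt hd kz) /rel1 /rel2 /inv1 /inv2 /cr /gcross r1E r2E.
  have [le eq] := primal_inequality z1 z2 kz (q10 (x1 z)) (q20 (x2 z)) q1z q2z.
  rewrite -!EFinD !lee_fin; split; first by move: le; rewrite /x1 /x2; lra.
  by move=> [] e; apply: eq; move: e; rewrite /x1 /x2; lra.
have mf : measurable_fun [set: borel Z] (f : borel Z -> \bar R).
  exact: emeasurable_funD.
have mJ : measurable_fun [set: borel Z] ((fun z => rel1 z + rel2 z + len z)%E : borel Z -> \bar R).
  by apply: emeasurable_funD => //; exact: emeasurable_funD.
have mh : measurable_fun [set: borel Z] (h : borel Z -> \bar R).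
  exact: emeasurable_funD.
have J0 z : (0 <= rel1 z + rel2 z + len z)%E by rewrite !adde_ge0.
have f0 z : (0 <= f z)%E by rewrite !adde_ge0.
have h0 z : (0 <= h z)%E by rewrite adde_ge0.
have hE : (\int[b]_z h z = \int[b]_z (rel1 z + rel2 z + len z) + (2 * u)%:E)%E.
  rewrite /h (@add (fun z => rel1 z + rel2 z + len z)%E (fun z => (2 * cr z)%:E))//.
  have -> : (\int[b]_z (2 * cr z)%:E = 2%:E * \int[b]_z (cr z)%:E)%E.
    case: fb => m ->; rewrite -ge0_integralZl_EFin//.
    by move=> z _; rewrite lee_fin.
  by rewrite intu.
have fh : (\int[b]_z f z <= \int[b]_z h z)%E.
  by apply: ae_le_integral => //; apply: filterS key => z [].
have ms := masses_split; rewrite -/f in ms.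
have finf : (\int[b]_z f z)%E \is a fin_num by exact: finI.
rewrite LET_cost_split.
have [finJ|] := boolP ((\int[b]_z (rel1 z + rel2 z + len z))%E \is a fin_num); last first.
  rewrite ge0_fin_numE ?finG// -leNgt leye_eq => /eqP ->.
  by rewrite -(fineK fA1) -(fineK fA2) -EFinD addey// leey; split.
split.
  move: fh ms; rewrite hE /value.
  rewrite -(fineK fA1) -(fineK fA2) -(fineK finJ) -(fineK finf).
  rewrite -(fineK fM1) -(fineK fM2) -!EFinD !lee_fin /= => fh [ms]; lra.
move=> ge.
have hf : (\int[b]_z h z <= \int[b]_z f z)%E.
  move: ge ms; rewrite hE /value.
  rewrite -(fineK fA1) -(fineK fA2) -(fineK finJ) -(fineK finf).
  rewrite -(fineK fM1) -(fineK fM2) -!EFinD !lee_fin /= => ge [ms]; lra.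
have ae : {ae b, forall z, f z = h z}.
  apply: ae_eq_of_integral_le => //; first by apply: filterS key => z [].
  by rewrite ltey_eq finf.
by apply: filterS2 key ae => z [_ e] /e.
Qed.

End LETBounds.

(** * Dilations to unit cross term *)

Section Dilation.
Context {R : realType} {X : ptopologicalType}.
Variable d : X -> X -> \bar R.
Hypothesis hd : extended_metric_topological d.
Variables (mu1 mu2 : setfun X R).
Hypotheses (rmu1 : radon mu1) (rmu2 : radon mu2).
Local Notation C := (cone R X).
Local Notation C_plan := (C_plan mu1 mu2).

Let hX : hausdorff_space X := emt_hausdorff hd.
Let fmu1 := radon_finmeas rmu1.
Let fmu2 := radon_finmeas rmu2.

Let b1 := @cone_r1_borel R X.
Let b2 := @cone_r2_borel R X.
Let bx := @cone_x2_borel R X.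
Let theta := @theta_cross R X d.

Let mtheta : measurable_fun [set: borel (C * C)%type]
  ((fun z => (theta z)%:num) : borel (C * C)%type -> R).
Proof.
apply: (measurableT_comp (continuous_measurable_fun (@sqrt_continuous R))).
exact: cross_borel.
Qed.

Let theta_sqr z : (theta z)%:num ^+ 2 = cross d z.
Proof. by rewrite sqr_sqrtr// cross_ge0. Qed.

Let prd_r1 z : C_r1 (prd theta z) = C_r1 z / (theta z)%:num.
Proof. by rewrite /C_r1 /prd /= cone_r_proj. Qed.

Let prd_r2 z : C_r2 (prd theta z) = C_r2 z / (theta z)%:num.
Proof. by rewrite /C_r2 /prd /= cone_r_proj. Qed.

Let prd_x1 z : 0 < C_r1 (prd theta z) -> (cone_x2 (prd theta z)).1 = (cone_x2 z).1.
Proof.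
rewrite prd_r1 => z0; rewrite /prd /cone_x2 /= cone_x_proj//.
Qed.

Let prd_x2 z : 0 < C_r2 (prd theta z) -> (cone_x2 (prd theta z)).2 = (cone_x2 z).2.
Proof.
rewrite prd_r2 => z0; rewrite /prd /cone_x2 /= cone_x_proj//.
Qed.

Let theta_gt0 z : 0 < cross d z -> 0 < (theta z)%:num.
Proof. by move=> z0; rewrite /theta /theta_cross /= sqrtr_gt0. Qed.

Let prd_cross z : 0 < cross d z -> cross d (prd theta z) = 1.
Proof.
move=> z0; have t0 := theta_gt0 z0.
have : cross d z != 0 by rewrite gt_eqF.
rewrite {1}crossE !mulf_eq0 !negb_or => /andP[/andP[r1 r2] _].
have r1p : 0 < C_r1 z by rewrite lt_neqAle eq_sym r1 C_r1_ge0.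
have r2p : 0 < C_r2 z by rewrite lt_neqAle eq_sym r2 C_r2_ge0.
rewrite crossE -/(C_r1 _) -/(C_r2 _) prd_r1 prd_r2.
have -> : cone_x2 (prd theta z) = cone_x2 z.
  by rewrite [LHS]surjective_pairing prd_x1 ?prd_r1 ?divr_gt0// prd_x2 ?prd_r2 ?divr_gt0//
     -surjective_pairing.
have -> : C_r1 z / (theta z)%:num * (C_r2 z / (theta z)%:num) * cosd d (pi / 2) (cone_x2 z)
   = cross d z / (theta z)%:num ^+ 2.
  by rewrite crossE /C_r1 /C_r2; field; rewrite gt_eqF.
by rewrite theta_sqr divff// gt_eqF.
Qed.

Let sqr_gt0_pos (x : R) (w : R) : 0 <= x -> 0 < w * x ^+ 2 -> 0 < x.
Proof.
rewrite le_eqVlt => /predU1P[<-|//]; by rewrite expr0n mulr0 ltxx.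
Qed.

(** The weight [theta ^+ 2] and the division of the radii by [theta] cancel in
  every expression of degree two in the radii. Pairs with zero cross term get
  weight zero, which is also why the projection to [X * X] is continuous off a
  null set. The marginals can only decrease, by the mass on these pairs. *)
Lemma dilation_plan (a : setfun (C * C)%type R) : C_plan a ->
  let b := dilation theta a in
  [/\ C_plan b, (\int[b]_z (cross d z)%:E = \int[a]_z (cross d z)%:E)%E &
      {ae b, forall z, cross d z = 1}].
Proof.
move=> pa b; have [[ra aoo] h1 h2] := pa; have fa := radon_finmeas ra.
have hC := C2_hausdorff hd.
have bw : borel_nonneg (fun z => (theta z)%:num ^+ 2).
  by split=> [|z]; [exact: measurable_funX|exact: sqr_ge0].
have [u [iu _ _]] := C_total_cost hd rmu1 rmu2 pa.
have woo : (\int[a]_z ((theta z)%:num ^+ 2)%:E < +oo)%E.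
  by rewrite (eq_integralT _ (fun z => congr1 EFin (theta_sqr z))) iu ltry.
pose w := weight (fun z => (theta z)%:num ^+ 2) a.
have rw : radon w by exact: weight_radon.
have w0 (A : set (borel (C * C)%type)) : measurable A ->
    (forall z, A z -> cross d z = 0) -> w A = 0%E.
  move=> mA A0; rewrite /w /weight; case: fa => m ->.
  by apply: integral0_eq => z Az; rewrite theta_sqr A0.
have woff : w (~` @offvertex2 R X) = 0%E.
  apply: w0; first by apply: measurableC; exact: open_borel (@open_offvertex2 R X).
  move=> z zo; rewrite crossE.
  have [r1|r1] := eqVneq (cone_r z.1) 0; first by rewrite r1 !mul0r.
  have [r2|r2] := eqVneq (cone_r z.2) 0; first by rewrite r2 mulr0 mul0r.
  exfalso; apply: zo; split=> v; [move: r1|move: r2]; by rewrite v cone_r_vertex eqxx.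
have mprd := prd_borel mtheta.
have rb : radon b by exact: prd_radon.
have i (h : C * C -> \bar R) : measurable_fun [set: borel (C * C)%type] (h : borel (C * C)%type -> \bar R) ->
    (forall z, 0 <= h z)%E ->
    (\int[b]_z h z = \int[a]_z (((theta z)%:num ^+ 2)%:E * h (prd theta z)))%E.
  move=> mh h0; rewrite /b /dilation (push_integral (radon_finmeas rw) mprd mh h0).
  exact (weight_integral fa bw woo (borel_comp mh mprd) (fun z => h0 _)).
have le (r : R) z : (theta z)%:num ^+ 2 * (r / (theta z)%:num) ^+ 2 <= r ^+ 2.
  have [->|t0] := eqVneq ((theta z)%:num) 0; first by rewrite expr0n mul0r sqr_ge0.
  by rewrite -exprMn mulrC divfK.
split.
- apply: (gplan_image bx b1 b2 bx b1 b2 i _ _ mprd pa rb).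
  + by move=> z; exact: sqr_ge0.
  + by case: bw.
  + by move=> z; rewrite -/(C_r1 _) prd_r1; exact: le.
  + by move=> z; rewrite -/(C_r2 _) prd_r2; exact: le.
  + by move=> z /sqr_gt0_pos z0; apply: prd_x1; apply: z0; exact: C_r1_ge0.
  + by move=> z /sqr_gt0_pos z0; apply: prd_x2; apply: z0; exact: C_r2_ge0.
- apply: (gcross_image (p := @cone_x2 R X) (r1 := @C_r1 R X) (r2 := @C_r2 R X)
    hd bx b1 b2 (@C_r1_ge0 R X) (@C_r2_ge0 R X) i) => z.
  rewrite theta_sqr -[gcross _ _ _ _ (prd _ _)]/(cross d (prd theta z)).
  rewrite -[gcross _ _ _ _ z]/(cross d z).
  have [->|z0] := eqVneq (cross d z) 0; first by rewrite mul0r.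
  by rewrite prd_cross ?mulr1// lt_neqAle eq_sym z0 cross_ge0.
- have mS : measurable (cross d @^-1` (~` [set 1]) : set (borel (C * C)%type)).
    rewrite -[X in measurable X]setTI; apply: (cross_borel hd) => //.
    by apply: measurableC; exact: measurable_set1.
  have b0 : b (cross d @^-1` (~` [set 1])) = 0%E.
    apply: w0; first by rewrite -[X in measurable X]setTI; exact: mprd.
    move=> z zn; apply/eqP; rewrite eq_le cross_ge0// andbT leNgt.
    by apply/negP => /prd_cross.
  by case: rb b0 => -[m ->] _ m0; exists (cross d @^-1` (~` [set 1])); split.
Qed.

Lemma cross1_good_null (b : setfun (C * C)%type R) : finmeas b ->
  {ae b, forall z, cross d z = 1} -> b (~` good_set d) = 0%E.
Proof.
move=> fb c1; have mg := good_set_borel hd.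
case: fb c1 => m -> c1; apply/negligibleP; first exact: measurableC.
apply: negligibleS c1 => z /= nz c1; apply: nz.
by rewrite good_setE//= c1.
Qed.

(** Where the cross term is [1] both radii are nonzero, so a set that is null for
  [mu_i], hence for [h_i b], is null for the marginal of [b]. *)
Lemma LET_plan_of_C (b : setfun (C * C)%type R) : C_plan b ->
  {ae b, forall z, cross d z = 1} ->
  LET_plans mu1 mu2 (push (@cone_x2 R X) b).
Proof.
move=> pb c1; have [[rb boo] h1 h2] := pb; have fb := radon_finmeas rb.
have [boo1 boo2] := gplan_fin1 b1 b2 pb; have FF := finmeas_ae fb.
have hXX : hausdorff_space (X * X)%type by exact: hausdorff_prod.
have mX1 := borel_comp (@borel_fst X X) bx.
have mX2 := borel_comp (@borel_snd X X) bx.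
have off : b (~` @offvertex2 R X) = 0%E.
  apply/eqP; rewrite eq_le finmeas_ge0// andbT -(cross1_good_null fb c1).
  apply: finmeas_le => //.
  - by apply: measurableC; exact: open_borel (@open_offvertex2 R X).
  - by apply: measurableC; exact: good_set_borel.
  - by apply: subsetC; exact: good_offvertex.
split.
- apply: (lusin_radon (C2_hausdorff hd) hXX rb bx).
  apply: (lusin_open (C2_hausdorff hd) rb (@open_offvertex2 R X) off) => z.
  exact: cone_x2_continuous.
- apply: (hmarg_dominates mX1 b1 fb fmu1 boo1 _ h1).
  apply: filterS c1 => z; rewrite crossE => e.
  by apply/eqP => r0; move: e; rewrite r0 !mul0r => /esym/eqP; rewrite oner_eq0.
- apply: (hmarg_dominates mX2 b2 fb fmu2 boo2 _ h2).
  apply: filterS c1 => z; rewrite crossE => e.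
  by apply/eqP => r0; move: e; rewrite r0 mulr0 mul0r => /esym/eqP; rewrite oner_eq0.
Qed.

End Dilation.

(** * Lifts of measures on the base *)

Section Lift.
Context {R : realType} {X : ptopologicalType}.
Variable d : X -> X -> \bar R.
Hypothesis hd : extended_metric_topological d.
Variables (mu1 mu2 : setfun X R).
Hypotheses (rmu1 : radon mu1) (rmu2 : radon mu2).
Local Notation C := (cone R X).
Local Notation C_plan := (C_plan mu1 mu2).
Local Notation value := (value mu1 mu2).

Let hX : hausdorff_space X := emt_hausdorff hd.
Let fmu1 := radon_finmeas rmu1.
Let fmu2 := radon_finmeas rmu2.

Let b1 := @cone_r1_borel R X.
Let b2 := @cone_r2_borel R X.
Let bx := @cone_x2_borel R X.
Let f1 := @borel_fst X X.
Let f2 := @borel_snd X X.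
Let mid : measurable_fun [set: borel (X * X)%type]
  (id : borel (X * X)%type -> borel (X * X)%type).
Proof. exact: measurable_id. Qed.

(** Both the reciprocal densities and the densities of a Lebesgue decomposition
  are admissible for [q1] and [q2]. *)
Section WithRho.
Variables (g : setfun (X * X)%type R) (q1 q2 : X -> R).
Hypotheses (rg : radon g) (bq1 : borel_nonneg q1) (bq2 : borel_nonneg q2).
Hypotheses (le1 : le_meas (weight q1 (marg1 g)) mu1).
Hypotheses (le2 : le_meas (weight q2 (marg2 g)) mu2).

Let fg := radon_finmeas rg.
Let fg1 : finmeas (marg1 g). Proof. exact: (push_finmeas fg f1). Qed.
Let fg2 : finmeas (marg2 g). Proof. exact: (push_finmeas fg f2). Qed.

Definition lift_r1 (p : X * X) : R := Num.sqrt (q1 p.1).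
Definition lift_r2 (p : X * X) : R := Num.sqrt (q2 p.2).

Let lift_r1_borel : measurable_fun [set: borel (X * X)%type] (lift_r1 : borel (X * X)%type -> R).
Proof.
apply: (measurableT_comp (continuous_measurable_fun (@sqrt_continuous R))).
by case: bq1 => m _; exact: borel_comp m f1.
Qed.

Let lift_r2_borel : measurable_fun [set: borel (X * X)%type] (lift_r2 : borel (X * X)%type -> R).
Proof.
apply: (measurableT_comp (continuous_measurable_fun (@sqrt_continuous R))).
by case: bq2 => m _; exact: borel_comp m f2.
Qed.

Let weight_lty (mu nu : setfun X R) (q : X -> R) : finmeas mu ->
  le_meas (weight q nu) mu -> (\int[nu]_x (q x)%:E < +oo)%E.
Proof.
move=> fmu le; apply: le_lt_trans (le setT (@measurableT _ (borel X))) _.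
by rewrite ltey_eq finmeas_fin.
Qed.

Let hmarg_le (x : X * X -> X) (mu : setfun X R) (q : X -> R) :
  measurable_fun [set: borel (X * X)%type] (x : borel (X * X)%type -> borel X) ->
  finmeas mu -> borel_nonneg q -> le_meas (weight q (push x g)) mu ->
  (\int[g]_p (Num.sqrt (q (x p)) ^+ 2)%:E < +oo)%E /\
  le_meas (hmarg x (fun p => Num.sqrt (q (x p))) g) mu.
Proof.
move=> mx fmu bq le; have [mq q0] := bq.
have fx : finmeas (push x g) by exact: push_finmeas fg mx.
have qoo := weight_lty fmu le.
have E (A : set (borel X)) : measurable A ->
    (\int[g]_p (Num.sqrt (q (x p)) ^+ 2 * \1_A (x p))%:E = weight q (push x g) A)%E.
  move=> mA; have [m mE] := weight_finmeas fx bq qoo.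
  have -> : weight q (push x g) A = (\int[weight q (push x g)]_x (\1_A x)%:E)%E.
    by rewrite mE integral_indic// setIT.
  have mi : measurable_fun [set: borel X] ((fun x => (\1_A x)%:E) : borel X -> \bar R).
    by apply/measurable_EFinP; exact: measurable_indic.
  rewrite (weight_integral fx bq qoo mi) ?(push_integral fg mx)//.
  - by apply: eq_integralT => p; rewrite sqr_sqrtr// EFinM.
  - by apply: emeasurable_funM => //; exact/measurable_EFinP.
  - by move=> y; rewrite mule_ge0// lee_fin.
have oo : (\int[g]_p (Num.sqrt (q (x p)) ^+ 2)%:E < +oo)%E.
  have := E setT (@measurableT _ (borel X)).
  under eq_fun do rewrite indicT mulr1.
  by move=> ->.
split=> // A mA; rewrite hmargE//; first by rewrite E// le.
apply: (measurableT_comp (continuous_measurable_fun (@sqrt_continuous R))).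
exact: borel_comp mq mx.
Qed.

(** With radii [q_i ^ (1/2)] on [X * X] the homogeneous marginals are
  [weight q_i (marg_i g)]. *)
Lemma lift_plan : gplan mu1 mu2 id lift_r1 lift_r2 g.
Proof.
have [l1 h1] := hmarg_le f1 fmu1 bq1 le1; have [l2 h2] := hmarg_le f2 fmu2 bq2 le2.
apply: (And3 _ h1 h2); apply: (conj rg).
by rewrite (sqr_integralD lift_r1_borel lift_r2_borel fg) lte_add_pinfty.
Qed.

Let lift_C_r1 p : C_r1 (sqrt_lift q1 q2 p) = lift_r1 p.
Proof. by rewrite /C_r1 /sqrt_lift /= cone_r_proj. Qed.

Let lift_C_r2 p : C_r2 (sqrt_lift q1 q2 p) = lift_r2 p.
Proof. by rewrite /C_r2 /sqrt_lift /= cone_r_proj. Qed.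

Lemma lift_x1 p : 0 < lift_r1 p -> (cone_x2 (sqrt_lift q1 q2 p)).1 = p.1.
Proof. by move=> p0; rewrite /sqrt_lift /cone_x2 /= cone_x_proj. Qed.

Lemma lift_x2 p : 0 < lift_r2 p -> (cone_x2 (sqrt_lift q1 q2 p)).2 = p.2.
Proof. by move=> p0; rewrite /sqrt_lift /cone_x2 /= cone_x_proj. Qed.

Lemma lift_cross p : cross d (sqrt_lift q1 q2 p) = gcross d id lift_r1 lift_r2 p.
Proof.
rewrite crossE -/(C_r1 _) -/(C_r2 _) lift_C_r1 lift_C_r2 /gcross.
have [->|z1] := eqVneq (lift_r1 p) 0; first by rewrite !mul0r.
have [->|z2] := eqVneq (lift_r2 p) 0; first by rewrite !mulr0 !mul0r.
have p1 : 0 < lift_r1 p by rewrite lt_neqAle eq_sym z1 sqrtr_ge0.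
have p2 : 0 < lift_r2 p by rewrite lt_neqAle eq_sym z2 sqrtr_ge0.
congr (_ * cosd _ _ _).
by rewrite [LHS]surjective_pairing lift_x1// lift_x2// -surjective_pairing.
Qed.

Let sqr_gt0_pos (x : R) : 0 <= x -> 0 < 1 * x ^+ 2 -> 0 < x.
Proof. by rewrite le_eqVlt => /predU1P[<-|//]; rewrite expr0n mulr0 ltxx. Qed.

Lemma lift_C_plan : let b := push (sqrt_lift q1 q2) g in
  C_plan b /\
  (\int[b]_z (cross d z)%:E = \int[g]_p (gcross d id lift_r1 lift_r2 p)%:E)%E.
Proof.
move=> b; have mL := sqrt_lift_borel bq1 bq2.
have rb : radon b by exact: sqrt_lift_radon.
have i (h : C * C -> \bar R) : measurable_fun [set: borel (C * C)%type] (h : borel (C * C)%type -> \bar R) ->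
    (forall z, 0 <= h z)%E ->
    (\int[b]_z h z = \int[g]_z ((cst 1 z)%:E * h (sqrt_lift q1 q2 z)))%E.
  move=> mh h0; rewrite /b (push_integral fg mL mh h0).
  by apply: eq_integralT => p; rewrite mul1e.
split.
  apply: (gplan_image mid lift_r1_borel lift_r2_borel bx b1 b2 i _ _ mL lift_plan rb).
  - by move=> z; exact: ler01.
  - exact: measurable_cst.
  - by move=> z; rewrite mul1r -/(C_r1 _) lift_C_r1.
  - by move=> z; rewrite mul1r -/(C_r2 _) lift_C_r2.
  - move=> z; rewrite -/(C_r1 _) lift_C_r1 => /sqr_gt0_pos z0; apply: lift_x1.
    by apply: z0; exact: sqrtr_ge0.
  - move=> z; rewrite -/(C_r2 _) lift_C_r2 => /sqr_gt0_pos z0; apply: lift_x2.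
    by apply: z0; exact: sqrtr_ge0.
apply: (gcross_image (p := id) (r1 := lift_r1) (r2 := lift_r2)
    hd bx b1 b2 (@C_r1_ge0 R X) (@C_r2_ge0 R X) i) => z.
by rewrite mul1r -[LHS]/(cross d _) lift_cross.
Qed.

(** [LET_lower] on [X * X], transported to the cone. *)
Lemma LET_ge_lift : LET_plans mu1 mu2 g ->
  {ae marg1 g, forall x, q1 x * rn_density (marg1 g) mu1 x = 1} ->
  {ae marg2 g, forall x, q2 x * rn_density (marg2 g) mu2 x = 1} ->
  let b := push (sqrt_lift q1 q2) g in
  exists u, [/\ (\int[b]_z (cross d z)%:E)%E = u%:E,
    (value u <= LET_cost d mu1 mu2 g)%E &
    (LET_cost d mu1 mu2 g <= value u)%E -> {ae b, forall z, cross d z = 1}].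
Proof.
move=> [_ ac1 ac2] e1 e2 b; have [pb iE] := lift_C_plan.
have [u [iu _ _]] := C_total_cost hd rmu1 rmu2 pb.
exists u; have mL := sqrt_lift_borel bq1 bq2.
have iu' : (\int[g]_p (gcross d id lift_r1 lift_r2 p)%:E)%E = u%:E by rewrite -iE.
have ae1 : {ae g, forall p, q1 p.1 * rn_density (marg1 g) mu1 p.1 = 1}.
  case: e1 => N [mN N0 sN]; exists (fst @^-1` N); split=> //.
    by rewrite -[X in measurable X]setTI; exact: f1.
  by move=> p; exact: sN.
have ae2 : {ae g, forall p, q2 p.2 * rn_density (marg2 g) mu2 p.2 = 1}.
  case: e2 => N [mN N0 sN]; exists (snd @^-1` N); split=> //.
    by rewrite -[X in measurable X]setTI; exact: f2.
  by move=> p; exact: sN.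
have [ge eq] := @LET_lower R X (X * X)%type d hd mu1 mu2 fmu1 fmu2 id lift_r1 lift_r2
  mid lift_r1_borel lift_r2_borel (fun p => sqrtr_ge0 _) (fun p => sqrtr_ge0 _)
  g lift_plan ac1 ac2 u iu' q1 q2 (fun p => erefl) (fun p => erefl) bq1.2 bq2.2 ae1 ae2.
split=> // /eq c1.
have mS : measurable (cross d @^-1` (~` [set 1]) : set (borel (C * C)%type)).
  rewrite -[X in measurable X]setTI; apply: (cross_borel hd) => //.
  by apply: measurableC; exact: measurable_set1.
exists (cross d @^-1` (~` [set 1])); split=> //.
have mP : measurable (sqrt_lift q1 q2 @^-1` (cross d @^-1` (~` [set 1])) : set (borel (X * X)%type)).
  by rewrite -[X in measurable X]setTI; exact: mL.
rewrite /b /push /pushforward; case: fg c1 => m -> c1; apply/negligibleP => //.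
by apply: negligibleS c1 => p /= np c1; apply: np; rewrite lift_cross.
Qed.

End WithRho.
End Lift.

(** * Reciprocal densities *)

Section DensityInverses.
Context {R : realType} {X : ptopologicalType}.
Variables (nu mu : setfun X R).
Hypotheses (fnu : finmeas nu) (fmu : finmeas mu) (ac : nu `<< mu).
Let s := rn_density nu mu.
Let bs : borel_nonneg s. Proof. by have [] := rn_densityP fnu fmu ac. Qed.
Let nuE : eq_meas nu (weight s mu). Proof. by have [] := rn_densityP fnu fmu ac. Qed.
Local Open Scope ereal_scope.

Let weight_density (q : X -> R) (A : set (borel X)) : borel_nonneg q -> measurable A ->
  weight q nu A = \int[mu]_(x in A) ((s x)%:E * (q x)%:E).
Proof.
move=> [mq q0] mA; have mqA : measurable_fun [set: borel X]
    ((fun x => ((q \_ A) x)%:E) : borel X -> \bar R).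
  apply/measurable_EFinP; apply/(measurable_restrictT _ _).1 => //.
  exact: measurable_funTS.
have -> : weight q nu A = \int[nu]_x ((q \_ A) x)%:E.
  rewrite /weight; case: fnu => n ->; rewrite integral_mkcond.
  by apply: eq_integral => x _; rewrite !patchE; case: ifP.
have qA0 x : 0 <= ((q \_ A) x)%:E by rewrite patchE; case: ifP; rewrite lee_fin.
rewrite (density_integral fnu fmu bs nuE mqA qA0).
case: fmu => m ->; rewrite [RHS]integral_mkcond.
apply: eq_integral => x _; rewrite !patchE; case: ifP => //.
by rewrite mule0.
Qed.

Lemma inv_density_nonneg : borel_nonneg (fun x => (s x)^-1)%R.
Proof.
split; first exact: inv_density_borel.
by move=> x; rewrite invr_ge0; case: bs.
Qed.

Lemma inv_density_le : le_meas (weight (fun x => (s x)^-1)%R nu) mu.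
Proof.
have [ms s0] := bs; have [mi i0] := inv_density_nonneg.
move=> A mA; rewrite (weight_density inv_density_nonneg mA).
case: fmu => m ->; rewrite -(setIid A) -integral_indic// setIid.
apply: ge0_le_integral => //.
- by move=> x _; rewrite mule_ge0// lee_fin.
- by apply: measurable_funTS; apply: emeasurable_funM; exact/measurable_EFinP.
- by apply: measurable_funTS; exact/measurable_EFinP.
move=> x Ax; rewrite indicE mem_set// -EFinM lee_fin.
by have [->|sx] := eqVneq (s x) 0%R; [rewrite mul0r|rewrite mulfV].
Qed.

Lemma inv_density_ae : {ae nu, forall x, (s x)^-1 * s x = 1}%R.
Proof.
have := density_pos fnu fmu bs nuE; have FF := finmeas_ae fnu.
by apply: filterS => x sx; rewrite mulVf// gt_eqF.
Qed.

Variable rho : X -> R.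
Hypothesis dec : lebesgue_decomposition mu nu rho.

Lemma decomposition_le : le_meas (weight rho nu) mu.
Proof.
have [_ [mu' [rmu' _ e]]] := dec.
by move=> A mA; rewrite e// leeDl// finmeas_ge0//; exact: radon_finmeas.
Qed.

(** Let [N] be null for the singular part and carry [nu]. For [E] inside [N],
  [mu E] is the integral of [s * rho] over [E], so [s * rho = 1] almost
  everywhere on [N] for [mu], hence for [nu]. *)
Lemma decomposition_ae : {ae nu, forall x, rho x * s x = 1}%R.
Proof.
have [brho [mu' [rmu' [N [mN N0 nuN]] e]]] := dec.
have [ms s0] := bs; have [mr r0] := brho.
have msr : measurable_fun [set: borel X] ((fun x => (s x)%:E * (rho x)%:E) : borel X -> \bar R).
  by apply: emeasurable_funM; exact/measurable_EFinP.
have fm' := radon_finmeas rmu'.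
have muE (E : set (borel X)) : E `<=` N -> measurable E ->
    mu E = \int[mu]_(x in E) ((s x)%:E * (rho x)%:E).
  move=> EN mE; rewrite e// weight_density// (_ : mu' E = 0) ?adde0//.
  by apply/eqP; rewrite eq_le finmeas_ge0// andbT -N0 finmeas_le.
case: (fmu) muE => m mE; rewrite mE => muE.
have ae : ae_eq m N (cst 1) (fun x => (s x)%:E * (rho x)%:E).
  apply: integral_ae_eq => //.
  - apply/integrableP; split; first exact: measurable_cst.
    under eq_integral do rewrite gee0_abs//.
    by rewrite integral_cst// mul1e -ge0_fin_numE// fin_num_measure.
  - exact: measurable_funTS.
  - by move=> E EN mE'; rewrite -muE// integral_cst// mul1e.
case: (fnu) (ac) nuN => n nE; rewrite nE mE => nm nN.
have [B [mB B0 sB]] := ae.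
exists (~` N `|` B); split.
- by apply: measurableU => //; exact: measurableC.
- apply/eqP; rewrite -measure_le0 (le_trans (measureU2 _ _ _))//; first exact: measurableC.
  move/null_content_dominatesP : nm => /(_ B mB B0) nB.
  by rewrite -[leRHS]adde0; apply: leeD; [rewrite -nN|rewrite -nB].
move=> x /= h; have [Nx|nNx] := pselect (N x); last by left.
right; apply: sB => /= /(_ Nx); rewrite -EFinM => -[e']; apply: h.
by rewrite mulrC.
Qed.

End DensityInverses.

(** * Optimality as maximality of the cross term *)

Section Attainable.
Context {R : realType} {X : ptopologicalType}.
Variable d : X -> X -> \bar R.
Hypothesis hd : extended_metric_topological d.
Variables (mu1 mu2 : setfun X R).
Hypotheses (rmu1 : radon mu1) (rmu2 : radon mu2).
Local Notation C := (cone R X).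
Local Notation Y2 := (@Y2 R X).
Local Notation Y_cross := (Y_cross d).
Local Notation C_plan := (C_plan mu1 mu2).
Local Notation Y_plan := (Y_plan mu1 mu2).
Local Notation value := (value mu1 mu2).

Let hX : hausdorff_space X := emt_hausdorff hd.
Let fmu1 := radon_finmeas rmu1.
Let fmu2 := radon_finmeas rmu2.

Let b1 := @cone_r1_borel R X.
Let b2 := @cone_r2_borel R X.
Let bx := @cone_x2_borel R X.

(** The values of the quantity that all the problems maximize. *)
Definition attainable (u : R) : Prop :=
  exists a : setfun (C * C)%type R, C_plan a /\ (\int[a]_z (cross d z)%:E)%E = u%:E.

Definition maximal (u : R) : Prop := forall v, attainable v -> v <= u.

Lemma attainable_Y (b : setfun Y2 R) u : Y_plan b ->
  (\int[b]_y (Y_cross y)%:E)%E = u%:E -> attainable u.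
Proof.
move=> pb iu; have [pa ia] := C_of_Y_plan hd pb.
by exists (push Y_proj b); rewrite ia.
Qed.

Definition Yeq_plan (b : setfun Y2 R) : Prop :=
  [/\ radon b /\ (\int[b]_y (Y_r1 y ^+ 2 + Y_r2 y ^+ 2)%:E < +oo)%E,
      eq_meas (hmarg (fun y => (Y_x2 y).1) Y_r1 b) mu1 &
      eq_meas (hmarg (fun y => (Y_x2 y).2) Y_r2 b) mu2].

Lemma Yeq_Y_plan b : Yeq_plan b -> Y_plan b.
Proof. by move=> [rb /eq_meas_le h1 /eq_meas_le h2]; split. Qed.

Let mT := @measurableT _ (borel X).

Lemma Yeq_total b : Yeq_plan b -> Y_total d mu1 mu2 b = (\int[b]_y (Y_cost d y)%:E)%E.
Proof.
move=> [rb h1 h2]; rewrite /Y_total h1// h2//.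
by rewrite !subee ?finmeas_fin// !adde0.
Qed.

Lemma HK_C_plan (a : setfun (C * C)%type R) : HK_plans mu1 mu2 a -> C_plan a.
Proof. by move=> [ra /eq_meas_le h1 /eq_meas_le h2]; split. Qed.

Lemma HK_total (a : setfun (C * C)%type R) : HK_plans mu1 mu2 a ->
  HKle_cost d mu1 mu2 a = cost_C d a.
Proof.
move=> [ra h1 h2]; rewrite /HKle_cost h1// h2//.
by rewrite !subee ?finmeas_fin// !adde0.
Qed.

Lemma HK_of_Yeq (b : setfun Y2 R) : radon b ->
  HK_plans mu1 mu2 (push Y_proj b) <-> Yeq_plan b.
Proof.
move=> rb; have sE := proj_sqr_integral rb; split.
  move=> [[_ oo] h1 h2]; have boo : (\int[b]_y (Y_r1 y ^+ 2 + Y_r2 y ^+ 2)%:E < +oo)%E.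
    by rewrite -sE.
  have [m1 m2] := proj_marginals hd rb boo.
  by split=> // A mA; [rewrite -m1// h1|rewrite -m2// h2].
move=> [[_ oo] h1 h2]; have [m1 m2] := proj_marginals hd rb oo.
split; first by split; [exact (push_proj_radon hd rb)|rewrite sE].
  by move=> A mA; rewrite m1// h1.
by move=> A mA; rewrite m2// h2.
Qed.

Lemma attainable_Y_plan v : attainable v ->
  exists b : setfun Y2 R, Y_plan b /\ (\int[b]_y (Y_cross y)%:E)%E = v%:E.
Proof.
move=> [a [pa ia]]; have [pb ib] := Y_of_C_plan hd pa.
by exists (@push R (C * C)%type Y2 (@cone_y2 R X) (restr (@offvertex2 R X) a)); rewrite ib.
Qed.

(** A cone plan is cut to [good_set], lifted and completed. The completion adds no
  mass to [far_set], because it only adds pairs with a zero radius. *)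
Lemma attainable_Yeq v : attainable v -> exists b : setfun Y2 R,
  [/\ Yeq_plan b, (\int[b]_y (Y_cross y)%:E)%E = v%:E &
      push Y_proj b (far_set d) = 0%E].
Proof.
move=> [a [pa ia]]; have [pa' ia'] := C_plan_good hd pa.
have far0 := good_far_null d pa.
set a' := restr (good_set d) a in pa' ia' far0.
have [pb ib] := Y_of_C_plan hd pa'.
have [b [rb h1 h2 ib' bA]] := Y_extend hd rmu1 rmu2 pb.
exists b; apply: And3; [by split|by rewrite ib' ib ia'|].
rewrite /push /pushforward bA; last first.
  move=> y [[/= /cone_r_gt0 z1 /cone_r_gt0 z2] _]; apply: mulr_gt0.
    by rewrite -Y_proj_r1.
  by rewrite -Y_proj_r2.
rewrite -far0 /push /pushforward /restr; congr (a _).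
apply/seteqP; split=> z /=.
  move=> [[far _] good]; apply: (conj _ good).
  by move: far; rewrite /Y_proj /= !cone_yK; case: (z).
move=> [far good]; apply: (conj (conj _ (good_offvertex good)) good).
by rewrite /Y_proj /= !cone_yK; case: (z) far.
Qed.

Lemma attainable_HK v : attainable v ->
  exists a, HK_plans mu1 mu2 a /\ (cost_C d a <= value v)%E.
Proof.
move=> /attainable_Yeq [b [yb ib far0]]; have [[rb _] _ _] := yb.
have ha := (HK_of_Yeq rb).2 yb.
exists (push Y_proj b); split=> //; rewrite -(HK_total ha).
have [pa ia] := C_of_Y_plan hd (Yeq_Y_plan yb).
have [u [iu _ le]] := C_total_cost hd rmu1 rmu2 pa.
have <- : u = v by apply/EFin_inj; rewrite -iu ia.
exact/le.
Qed.

Lemma attainable_HKle v : attainable v ->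
  exists a, C_plan a /\ (HKle_cost d mu1 mu2 a <= value v)%E.
Proof.
move=> /attainable_HK [a [ha le]]; exists a; split; first exact: HK_C_plan.
by rewrite HK_total.
Qed.

(** The cost is at least [value u], and a plan of cost at most [value v] exists for
  every attainable [v]. An optimal plan therefore has cost exactly [value u] with
  [u] maximal, and the equality case is the vanishing on [far_set]. *)
Lemma HKle_optP (a : setfun (C * C)%type R) : HKle_opt d mu1 mu2 a <->
  [/\ C_plan a, a (far_set d) = 0%E &
      exists u, (\int[a]_z (cross d z)%:E)%E = u%:E /\ maximal u].
Proof.
split=> [[pa opt]|[pa far0 [u [iu mx]]]].
  have [u [iu ge le]] := C_total_cost hd rmu1 rmu2 pa.
  have au : attainable u by exists a.
  have leV v : attainable v -> (HKle_cost d mu1 mu2 a <= value v)%E.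
    move=> /attainable_HKle [a' [pa' le']]; exact: le_trans (opt _ pa') le'.
  split=> //; first by apply/le; exact: leV.
  exists u; split=> // v /leV h; apply/(value_le mu1 mu2).
  exact: le_trans ge h.
split=> // a' pa'.
have [u' [iu' ge' _]] := C_total_cost hd rmu1 rmu2 pa'.
have [u'' [iu'' _ le]] := C_total_cost hd rmu1 rmu2 pa.
have e : u'' = u by apply/EFin_inj; rewrite -iu''.
rewrite e in le; apply: le_trans (le.2 far0) _; apply: le_trans ge'.
by apply/value_le; apply: mx; exists a'.
Qed.

Lemma HK_optP (a : setfun (C * C)%type R) : HK_opt d mu1 mu2 a <->
  [/\ HK_plans mu1 mu2 a, a (far_set d) = 0%E &
      exists u, (\int[a]_z (cross d z)%:E)%E = u%:E /\ maximal u].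
Proof.
split=> [[ha opt]|[ha far0 [u [iu mx]]]].
  have pa := HK_C_plan ha.
  have [u [iu ge le]] := C_total_cost hd rmu1 rmu2 pa.
  have au : attainable u by exists a.
  have leV v : attainable v -> (HKle_cost d mu1 mu2 a <= value v)%E.
    move=> /attainable_HK [a' [ha' le']]; rewrite HK_total//.
    exact: le_trans (opt _ ha') le'.
  split=> //; first by apply/le; exact: leV.
  exists u; split=> // v /leV h; apply/(value_le mu1 mu2).
  exact: le_trans ge h.
have opt : HKle_opt d mu1 mu2 a.
  by apply/HKle_optP; split; [exact: HK_C_plan| |exists u].
split=> // a' ha'; rewrite -(HK_total ha) -(HK_total ha').
by apply: opt.2; exact: HK_C_plan.
Qed.

Lemma Y_optP (b : setfun Y2 R) u : Y_plan b ->
  (\int[b]_y (Y_cross y)%:E)%E = u%:E ->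
  (forall b', Y_plan b' -> (Y_total d mu1 mu2 b <= Y_total d mu1 mu2 b')%E) <-> maximal u.
Proof.
have tot b' v : Y_plan b' -> (\int[b']_y (Y_cross y)%:E)%E = v%:E ->
    Y_total d mu1 mu2 b' = value v.
  move=> pb' iv; have [w [iw ->]] := Y_total_cost hd rmu1 rmu2 pb'.
  by congr (value _); apply/EFin_inj; rewrite -iw.
move=> pb iu; rewrite (tot _ _ pb iu); split=> [opt v av|mx b' pb'].
  have [b' [pb' iv]] := attainable_Y_plan av.
  by apply/(value_le mu1 mu2); rewrite -(tot _ _ pb' iv) opt.
have [v [iv ->]] := Y_total_cost hd rmu1 rmu2 pb'.
by apply/value_le; apply: mx; exact: attainable_Y pb' iv.
Qed.

Lemma Yeq_optP (b : setfun Y2 R) u : Yeq_plan b ->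
  (\int[b]_y (Y_cross y)%:E)%E = u%:E ->
  (forall b', Yeq_plan b' ->
    (\int[b]_y (Y_cost d y)%:E <= \int[b']_y (Y_cost d y)%:E)%E) <-> maximal u.
Proof.
have tot b' v : Yeq_plan b' -> (\int[b']_y (Y_cross y)%:E)%E = v%:E ->
    (\int[b']_y (Y_cost d y)%:E)%E = value v.
  move=> yb' iv; rewrite -(Yeq_total yb').
  have [w [iw ->]] := Y_total_cost hd rmu1 rmu2 (Yeq_Y_plan yb').
  by congr (value _); apply/EFin_inj; rewrite -iw.
move=> yb iu; rewrite (tot _ _ yb iu); split=> [opt v av|mx b' yb'].
  have [b' [yb' iv _]] := attainable_Yeq av.
  by apply/(value_le mu1 mu2); rewrite -(tot _ _ yb' iv) opt.
have [v [iv _]] := Y_total_cost hd rmu1 rmu2 (Yeq_Y_plan yb').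
rewrite (tot _ _ yb' iv); apply/value_le; apply: mx.
exact: attainable_Y (Yeq_Y_plan yb') iv.
Qed.

(** [LET_upper] for the projection of the dilated plan; in the equality case the
  radii are the reciprocal square roots of the densities. *)
Lemma LET_of_dilation (a : setfun (C * C)%type R) u : C_plan a ->
  (\int[a]_z (cross d z)%:E)%E = u%:E ->
  let b := dilation (theta_cross d) a in
  let g := push (@cone_x2 R X) b in
  [/\ LET_plans mu1 mu2 g, (LET_cost d mu1 mu2 g <= value u)%E &
   (value u <= LET_cost d mu1 mu2 g)%E -> {ae b, forall z,
     rn_density (marg1 g) mu1 (cone_x z.1) * cone_r z.1 ^+ 2 = 1 /\
     rn_density (marg2 g) mu2 (cone_x z.2) * cone_r z.2 ^+ 2 = 1}].
Proof.
move=> pa ia b g; have [pb ib c1] := dilation_plan hd rmu1 rmu2 pa.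
have pg := LET_plan_of_C hd rmu1 rmu2 pb c1.
have [_ ac1 ac2] := pg; split=> //;
  have [] := LET_upper hd fmu1 fmu2 bx b1 b2 (@C_r1_ge0 R X) (@C_r2_ge0 R X) pb
    ac1 ac2 (etrans ib ia) c1 => //.
Qed.

Lemma attainable_LET v : attainable v ->
  exists g, LET_plans mu1 mu2 g /\ (LET_cost d mu1 mu2 g <= value v)%E.
Proof.
move=> [a [pa ia]]; have [pg le _] := LET_of_dilation pa ia.
by exists (push (@cone_x2 R X) (dilation (theta_cross d) a)).
Qed.

Lemma LET_attainable g : LET_plans mu1 mu2 g ->
  exists u, attainable u /\ (value u <= LET_cost d mu1 mu2 g)%E.
Proof.
move=> pg; have [rg ac1 ac2] := pg; have fg := radon_finmeas rg.
have fg1 : finmeas (marg1 g) by exact: (push_finmeas fg (@borel_fst X X)).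
have fg2 : finmeas (marg2 g) by exact: (push_finmeas fg (@borel_snd X X)).
have n1 := inv_density_nonneg fg1 fmu1 ac1.
have n2 := inv_density_nonneg fg2 fmu2 ac2.
have l1 := inv_density_le fg1 fmu1 ac1.
have l2 := inv_density_le fg2 fmu2 ac2.
have [u [iu le _]] := LET_ge_lift hd rmu1 rmu2 rg n1 n2 l1 l2 pg
  (inv_density_ae fg1 fmu1 ac1) (inv_density_ae fg2 fmu2 ac2).
exists u; split=> //.
by eexists; split; last exact: iu; exact: (lift_C_plan hd rmu1 rmu2 rg n1 n2 l1 l2).1.
Qed.

(** Each competitor of one problem yields one of the other at no larger cost. *)
Lemma HK2_eq_LET : HK2 d mu1 mu2 = LET d mu1 mu2.
Proof.
apply/eqP; rewrite eq_le; apply/andP; split; apply: le_ereal_inf_tmp => _ [x px <-].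
  have [u [au ge]] := LET_attainable px; have [a [ha le]] := attainable_HK au.
  by apply: le_trans ge; apply: le_trans le; apply: ereal_inf_lbound; exists a.
have pa := HK_C_plan px; have [u [iu ge _]] := C_total_cost hd rmu1 rmu2 pa.
have [|g [pg le]] := @attainable_LET u; first by exists x.
rewrite -(HK_total px); apply: le_trans ge; apply: le_trans le.
by apply: ereal_inf_lbound; exists g.
Qed.

Lemma LET_opt_le g : LET_opt d mu1 mu2 g ->
  forall v, attainable v -> (LET_cost d mu1 mu2 g <= value v)%E.
Proof.
move=> [_ opt] v /attainable_LET [g' [pg' le]].
exact: le_trans (opt _ pg') le.
Qed.

Lemma LET_optI g u : LET_plans mu1 mu2 g -> maximal u ->
  (LET_cost d mu1 mu2 g <= value u)%E -> LET_opt d mu1 mu2 g.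
Proof.
move=> pg mx le; split=> // g' pg'.
have [v [av ge]] := LET_attainable pg'.
by apply: le_trans le (le_trans _ ge); apply/value_le; exact: mx.
Qed.

End Attainable.

(** * Optimal plans *)

(** The dilated plan is recovered from its projection through this lemma, [f] being
  the projection followed by the lift. *)
Lemma push_ae_id {R : realType} (T : ptopologicalType) (b : setfun T R) (f : T -> T) :
  finmeas b -> measurable_fun [set: borel T] (f : borel T -> borel T) ->
  {ae b, forall z, f z = z} -> eq_meas b (push f b).
Proof.
case=> m -> mf [N [mN N0 sN]] A mA.
have mB : measurable (f @^-1` A : set (borel T)).
  by rewrite -[X in measurable X]setTI; exact: mf.
have key (S U : set (borel T)) : measurable S -> measurable U ->
    (forall z, S z -> ~ N z -> U z) -> (m S <= m U)%E.
  move=> mS mU SU; apply: (@le_trans _ _ (m (U `|` N))).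
    rewrite le_measure ?inE//; first exact: measurableU.
    by move=> z Sz; have [Nz|nNz] := pselect (N z); [right|left; exact: SU].
  apply: (le_trans (measureU2 _ mU mN)).
  by rewrite -[leRHS]adde0; apply: leeD => //; rewrite -N0.
have fixN z : ~ N z -> f z = z.
  by move=> nN; apply: contrapT => h; apply: nN; exact: sN.
change (m A = m (f @^-1` A)).
apply/eqP; rewrite eq_le; apply/andP; split; apply: key => // z.
  by move=> Az /fixN e; rewrite /= e.
by rewrite /= => fz /fixN e; rewrite -e.
Qed.

Lemma minimizer_transfer {R : realType} (A B : Type) (f : A -> B) (g : B -> A)
    (P : set A) (Q : set B) (c : A -> \bar R) (k : B -> \bar R) :
  cancel g f -> (forall a, P a = Q (f a)) -> (forall a, c a = k (f a)) ->
  forall a, (P a /\ forall b, P b -> (c a <= c b)%E) <->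
    (Q (f a) /\ forall b, Q b -> (k (f a) <= k b)%E).
Proof.
move=> gK PQ ck a; split=> -[Pa le].
  split=> [|b Qb]; first by rewrite -PQ.
  by have := le (g b); rewrite PQ !ck gK => /(_ Qb).
by split=> [|b]; rewrite PQ// !ck; exact: le.
Qed.

Section Conclusion.
Context {R : realType} {X : ptopologicalType}.
Variable d : X -> X -> \bar R.
Hypothesis hd : extended_metric_topological d.
Variables (mu1 mu2 : setfun X R).
Hypotheses (rmu1 : radon mu1) (rmu2 : radon mu2).
Local Notation C := (cone R X).
Local Notation Y2 := (@Y2 R X).
Local Notation C_plan := (C_plan mu1 mu2).
Local Notation Y_plan := (Y_plan mu1 mu2).

Let hX : hausdorff_space X := emt_hausdorff hd.
Let fmu1 := radon_finmeas rmu1.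
Let fmu2 := radon_finmeas rmu2.

Let bx := @cone_x2_borel R X.

Lemma far_null (a : setfun (C * C)%type R) :
  HK_opt d mu1 mu2 a \/ HKle_opt d mu1 mu2 a -> a (far_set d) = 0%E.
Proof.
case=> [/(HK_optP hd rmu1 rmu2)[]//|/(HKle_optP hd rmu1 rmu2)[]//].
Qed.

Local Notation YY := (Yspace R X * Yspace R X)%type.

(** [Yin] and [Yout] are identities; they mark where the product is replaced by the
  named space. *)
Definition Yin (b : setfun YY R) : setfun Y2 R := b.
Definition Yout (b : setfun Y2 R) : setfun YY R := b.

Let YoutK : cancel Yout Yin. Proof. by []. Qed.

Let Yle_plansE b : Yle_plans mu1 mu2 b = Y_plan (Yin b). Proof. by []. Qed.

Let Yle_costE b : Yle_cost d mu1 mu2 b = Y_total d mu1 mu2 (Yin b).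
Proof. by []. Qed.

Let Yeq_plansE b : Yeq_plans mu1 mu2 b = Yeq_plan mu1 mu2 (Yin b).
Proof. by []. Qed.

Let cost_YE b : cost_Y d b = (\int[Yin b]_y (Y_cost d y)%:E)%E.
Proof. by []. Qed.

Lemma Yle_optE b : Yle_opt d mu1 mu2 b <-> Y_plan (Yin b) /\
  forall b', Y_plan b' -> (Y_total d mu1 mu2 (Yin b) <= Y_total d mu1 mu2 b')%E.
Proof. exact (minimizer_transfer YoutK Yle_plansE Yle_costE b). Qed.

Lemma Yeq_optE b : Yeq_opt d mu1 mu2 b <-> Yeq_plan mu1 mu2 (Yin b) /\
  forall b', Yeq_plan mu1 mu2 b' ->
    (\int[Yin b]_y (Y_cost d y)%:E <= \int[b']_y (Y_cost d y)%:E)%E.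
Proof. exact (minimizer_transfer YoutK Yeq_plansE cost_YE b). Qed.

Lemma HKle_opt_lift (a : setfun (C * C)%type R) :
  HKle_opt d mu1 mu2 a <-> [/\ HKle_plans mu1 mu2 a, a (far_set d) = 0%E &
     Yle_opt d mu1 mu2 (push (@cone_y2 R X) (restr (@offvertex2 R X) a))].
Proof.
split=> [/(HKle_optP hd rmu1 rmu2)[pa far0 [u [iu mx]]]|[pa far0 opt]].
  have [pb ib] := Y_of_C_plan hd pa.
  apply: (And3 pa far0); apply: (Yle_optE _).2.
  exact (conj pb ((Y_optP hd rmu1 rmu2 pb (etrans ib iu)).2 mx)).
apply/(HKle_optP hd rmu1 rmu2); split=> //.
have [pb ib] := Y_of_C_plan hd pa.
have [u [iu _ _]] := C_total_cost hd rmu1 rmu2 pa.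
exists u; split=> //; apply/(Y_optP hd rmu1 rmu2 pb (etrans ib iu)).
exact ((Yle_optE _).1 opt).2.
Qed.

Lemma Yeq_proj_opt (b : setfun Y2 R) : radon b ->
  ((Yeq_plan mu1 mu2 b /\ forall b', Yeq_plan mu1 mu2 b' ->
    (\int[b]_y (Y_cost d y)%:E <= \int[b']_y (Y_cost d y)%:E)%E) /\
    push Y_proj b (far_set d) = 0%E <->
  HK_opt d mu1 mu2 (push Y_proj b)).
Proof.
move=> rb.
split=> [[[yb opt] far0]|/(HK_optP hd rmu1 rmu2)[hb far0 [u [iu mx]]]].
  have [pa ia] := C_of_Y_plan hd (Yeq_Y_plan yb).
  have [u [iu _]] := Y_total_cost hd rmu1 rmu2 (Yeq_Y_plan yb).
  apply/(HK_optP hd rmu1 rmu2); split=> //.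
    exact/(HK_of_Yeq hd _ _ rb).
  exists u; rewrite ia; split=> //.
  by apply/(Yeq_optP hd rmu1 rmu2 yb iu).
have yb := (HK_of_Yeq hd mu1 mu2 rb).1 hb.
have [pa ia] := C_of_Y_plan hd (Yeq_Y_plan yb).
exact (conj (conj yb
  ((Yeq_optP hd rmu1 rmu2 yb (etrans (esym ia) iu)).2 mx)) far0).
Qed.

(** A unit cross term forces the distance to be less than [pi / 2]. *)
Lemma cross1_far_null (b : setfun (C * C)%type R) : finmeas b ->
  {ae b, forall z, cross d z = 1} -> b (far_set d) = 0%E.
Proof.
move=> fb c1; apply/eqP; rewrite eq_le finmeas_ge0// andbT.
rewrite -(cross1_good_null hd fb c1); apply: finmeas_le => //.
- exact: far_set_borel.
- by apply: measurableC; exact: good_set_borel.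
- move=> z [_ /= far] [_ near].
  by have := lt_trans far near; rewrite ltxx.
Qed.

(** By [LET_ge_lift] the lift has value at most the optimal cost, and by
  [LET_opt_le] that cost is at most the value of the lift. The equality case
  gives the unit cross term. *)
Lemma LET_opt_lift (g : setfun (X * X)%type R) (rho1 rho2 : X -> R) :
  LET_opt d mu1 mu2 g ->
  lebesgue_decomposition mu1 (marg1 g) rho1 ->
  lebesgue_decomposition mu2 (marg2 g) rho2 ->
  let b := push (sqrt_lift rho1 rho2) g in
  [/\ HKle_opt d mu1 mu2 b, {ae b, forall z, cross d z = 1} &
      b (~` good_set d) = 0%E].
Proof.
move=> og dec1 dec2 b; have [pg _] := og; have [rg ac1 ac2] := pg.
have fg := radon_finmeas rg.
have fg1 : finmeas (marg1 g) by exact: (push_finmeas fg (@borel_fst X X)).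
have fg2 : finmeas (marg2 g) by exact: (push_finmeas fg (@borel_snd X X)).
have n1 := dec1.1; have n2 := dec2.1.
have l1 := decomposition_le dec1; have l2 := decomposition_le dec2.
have [u [iu ge eq]] := LET_ge_lift hd rmu1 rmu2 rg n1 n2 l1 l2 pg
  (decomposition_ae fg1 fmu1 ac1 dec1) (decomposition_ae fg2 fmu2 ac2 dec2).
have [pb ib] := lift_C_plan hd rmu1 rmu2 rg n1 n2 l1 l2.
have fb : finmeas b by case: pb => -[rb _] _ _; exact: radon_finmeas.
have au : attainable d mu1 mu2 u by exists b.
have c1 := eq (LET_opt_le hd rmu1 rmu2 og au).
have mx : maximal d mu1 mu2 u.
  move=> v av; apply/(value_le mu1 mu2).
  exact: le_trans ge (LET_opt_le hd rmu1 rmu2 og av).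
have ob : HKle_opt d mu1 mu2 b.
  apply/(HKle_optP hd rmu1 rmu2).
  apply: (And3 pb (cross1_far_null fb c1)); exists u; exact (conj iu mx).
exact (And3 ob c1 (cross1_good_null hd fb c1)).
Qed.

Section OfOptimal.
Variable a : setfun (C * C)%type R.
Hypothesis oa : HK_opt d mu1 mu2 a.
Let a' := restr (good_set d) a.
Let b := dilation (theta_cross d) a'.
Let g := push (@cone_x2 R X) b.

Let data : exists u, [/\ C_plan a', a' (far_set d) = 0%E,
  (\int[a']_z (cross d z)%:E)%E = u%:E & maximal d mu1 mu2 u].
Proof.
have [ha far0 [u [iu mx]]] := (HK_optP hd rmu1 rmu2 a).1 oa.
have pa := HK_C_plan ha; have [pa' ia'] := C_plan_good hd pa.
by exists u; exact (And4 pa' (good_far_null d pa) (etrans ia' iu) mx).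
Qed.

Lemma good_opt : HKle_opt d mu1 mu2 a'.
Proof.
have [u [pa' far0 iu mx]] := data.
apply/(HKle_optP hd rmu1 rmu2); apply: (And3 pa' far0).
by exists u; exact (conj iu mx).
Qed.

Lemma dilation_opt : HKle_opt d mu1 mu2 b /\ {ae b, forall z, cross d z = 1}.
Proof.
have [u [pa' far0 iu mx]] := data.
have [pb ib c1] := dilation_plan hd rmu1 rmu2 pa'.
have fb : finmeas b by case: pb => -[rb _] _ _; exact: radon_finmeas.
apply: (conj _ c1); apply/(HKle_optP hd rmu1 rmu2).
apply: (And3 pb (cross1_far_null fb c1)).
by exists u; exact (conj (etrans ib iu) mx).
Qed.

Lemma dilation_LET_opt : LET_opt d mu1 mu2 g.
Proof.
have [u [pa' far0 iu mx]] := data.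
have [pg le _] := LET_of_dilation hd rmu1 rmu2 pa' iu.
exact (LET_optI hd rmu1 rmu2 pg mx le).
Qed.

(** The dilated plan attains equality in [LET_upper], which makes
  [sigma_i r_i ^+ 2 = 1]; as [rho_i sigma_i = 1], its radii are
  [rho_i ^ (1/2)]. *)
Lemma dilation_is_lift (rho1 rho2 : X -> R) :
  lebesgue_decomposition mu1 (marg1 g) rho1 ->
  lebesgue_decomposition mu2 (marg2 g) rho2 ->
  eq_meas b (push (sqrt_lift rho1 rho2) g).
Proof.
move=> dec1 dec2; have [u [pa' far0 iu mx]] := data.
have [pb ib c1] := dilation_plan hd rmu1 rmu2 pa'.
have fb : finmeas b by case: pb => -[rb _] _ _; exact: radon_finmeas.
have [pg le eq] := LET_of_dilation hd rmu1 rmu2 pa' iu.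
have [rg ac1 ac2] := pg; have fg := radon_finmeas rg.
have fg1 : finmeas (marg1 g) by exact: (push_finmeas fg (@borel_fst X X)).
have fg2 : finmeas (marg2 g) by exact: (push_finmeas fg (@borel_snd X X)).
have [v [av ge]] := LET_attainable hd rmu1 rmu2 pg.
have sr : {ae b, forall z,
     rn_density (marg1 g) mu1 (cone_x z.1) * cone_r z.1 ^+ 2 = 1 /\
     rn_density (marg2 g) mu2 (cone_x z.2) * cone_r z.2 ^+ 2 = 1}.
  by apply: eq; apply: le_trans ge; apply/value_le; exact: mx.
have mX1 := borel_comp (@borel_fst X X) bx.
have mX2 := borel_comp (@borel_snd X X) bx.
have q1 : {ae b, forall z, rho1 (cone_x z.1) * rn_density (marg1 g) mu1 (cone_x z.1) = 1}.
  have [N [mN N0 sN]] := decomposition_ae fg1 fmu1 ac1 dec1.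
  exists ((fun z : C * C => cone_x z.1) @^-1` N); split=> //.
    by rewrite -[X in measurable X]setTI; exact: mX1.
  by move=> z; exact: sN.
have q2 : {ae b, forall z, rho2 (cone_x z.2) * rn_density (marg2 g) mu2 (cone_x z.2) = 1}.
  have [N [mN N0 sN]] := decomposition_ae fg2 fmu2 ac2 dec2.
  exists ((fun z : C * C => cone_x z.2) @^-1` N); split=> //.
    by rewrite -[X in measurable X]setTI; exact: mX2.
  by move=> z; exact: sN.
have FF := finmeas_ae fb.
have fixed : {ae b, forall z, sqrt_lift rho1 rho2 (cone_x2 z) = z}.
  apply: filterS3 sr q1 q2 => -[z1 z2] /= [s1 s2] r1 r2.
  have E (c : C) (q s : R) : s * cone_r c ^+ 2 = 1 -> q * s = 1 ->
      cone_proj (cone_x c, (Num.sqrt q)%:nng : halfline R) = c.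
    move=> e1 e2; rewrite -[RHS](cone_yK c); congr (cone_proj (_, _)).
    apply: hval_inj; rewrite -[RHS]/(cone_r c) -[RHS]ger0_norm ?cone_r_ge0//.
    rewrite -sqrtr_sqr; congr Num.sqrt.
    by rewrite -[LHS]mulr1 -e1 mulrA e2 mul1r.
  by rewrite /sqrt_lift /cone_x2 /=; congr (_, _); [exact: E s1 r1|exact: E s2 r2].
exact: (push_ae_id fb (borel_comp (sqrt_lift_borel dec1.1 dec2.1) bx) fixed).
Qed.

End OfOptimal.
End Conclusion.
Unset Implicit Arguments.

Theorem theorem7p20 (R : realType) (X : ptopologicalType) (d : X -> X -> \bar R)
    (hX : extended_metric_topological d)
    (mu1 mu2 : setfun X R) (hmu1 : radon mu1) (hmu2 : radon mu2) :
  [/\ HK2 d mu1 mu2 = LET d mu1 mu2,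
      (forall a : setfun (cone R X * cone R X)%type R,
        HK_opt d mu1 mu2 a \/ HKle_opt d mu1 mu2 a -> a (far_set d) = 0%E) &
  [/\ (* (i) *)
      forall a : setfun (cone R X * cone R X)%type R, radon a ->
        (HKle_opt d mu1 mu2 a <->
          [/\ HKle_plans mu1 mu2 a, a (far_set d) = 0%E &
              Yle_opt d mu1 mu2
                (push (@cone_y2 R X) (restr (@offvertex2 R X) a))]),
      (* (ii) *)
      forall b : setfun (Yspace R X * Yspace R X)%type R, radon b ->
        (Yeq_opt d mu1 mu2 b /\ push (@cone_proj2 R X) b (far_set d) = 0%E <->
          HK_opt d mu1 mu2 (push (@cone_proj2 R X) b)),
      (* (iii) *)
      forall (g : setfun (X * X)%type R) (rho1 rho2 : X -> R),
        LET_opt d mu1 mu2 g ->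
        lebesgue_decomposition mu1 (marg1 g) rho1 ->
        lebesgue_decomposition mu2 (marg2 g) rho2 ->
        let b := push (sqrt_lift rho1 rho2) g in
        [/\ HKle_opt d mu1 mu2 b,
            {ae b, forall z, cross d z = 1} &
            b (~` good_set d) = 0%E] &
      (* (iv) *)
      forall a : setfun (cone R X * cone R X)%type R, HK_opt d mu1 mu2 a ->
        let a' := restr (good_set d) a in
        let b := dilation (theta_cross d) a' in
        let g := push (@cone_x2 R X) b in
        [/\ HKle_opt d mu1 mu2 a',
            HKle_opt d mu1 mu2 b /\ {ae b, forall z, cross d z = 1},
            separable X -> metrizable (R := R) X -> LET_opt d mu1 mu2 g &
            separable X -> metrizable (R := R) X ->
            forall rho1 rho2 : X -> R,
              lebesgue_decomposition mu1 (marg1 g) rho1 ->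
              lebesgue_decomposition mu2 (marg2 g) rho2 ->
              eq_meas b (push (sqrt_lift rho1 rho2) g)]]].
Proof.
split; first exact: HK2_eq_LET.
  exact: far_null.
split.
- by move=> a _; exact: HKle_opt_lift.
- move=> b rb.
  exact (iff_trans (and_iff_compat_r _ (Yeq_optE d mu1 mu2 b))
    (Yeq_proj_opt hX hmu1 hmu2 (b := Yin b) rb)).
- exact: LET_opt_lift.
- move=> a oa a' b g; split.
  + exact: good_opt.
  + exact: dilation_opt.
  + by move=> _ _; exact: dilation_LET_opt.
  + by move=> _ _; exact: dilation_is_lift.
Qed.
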